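(* There is an absolute constant $C>0$ with the following property. Let $L>0$ and let $\mu$ be a probability measure on $\mathbb{R}$ with zero mean and unit variance, supported on the interval $[-L,L]$. For $n\ge 1$ let $\mu^{(n)}$ be the normalized $n$-time free additive convolution of $\mu$ with itself, $\mu^{(n)}(du)=(\mu\boxplus\cdots\boxplus\mu)(\sqrt{n}\,du)$ ($n$ copies of $\mu$), and let $\mathcal{F}_n(x)=\mu^{(n)}((-\infty,x])$ be its cumulative distribution function. Let $\Phi$ be the cumulative distribution function of the standard semicircle law. Then for all large enough $n$, $$\sup_{x\in\mathbb{R}}\left|\mathcal{F}_n(x)-\Phi(x)\right|\le C L^{3} n^{-1/2}.$$
   Context: Free additive convolution. For a compactly supported probability measure $\mu$ on $\mathbb{R}$, its Cauchy transform is $G_\mu(z)=\int_{\mathbb{R}}\frac{d\mu(t)}{z-t}$. It is univalent for $|z|$ large, so it has a functional inverse $K_\mu$ (the $K$-function of $\mu$), defined in a punctured neighborhood of $0$: $K_\mu(G_\mu(z))=z$. For compactly supported probability measures $\mu_1,\mu_2$, the free convolution $\mu_1\boxplus\mu_2$ is the unique compactly supported probability measure whose $K$-function is $K_{\mu_1}(z)+K_{\mu_2}(z)-\frac1z$. The notation $\mu^{(n)}(du)=(\mu\boxplus\cdots\boxplus\mu)(\sqrt n\,du)$ means $\mu^{(n)}(E)=(\mu\boxplus\cdots\boxplus\mu)(\sqrt n\,E)$ for Borel sets $E$. The standard semicircle law is the probability measure with cumulative distribution function $\Phi(x)=\frac{1}{2\pi}\int_{-\infty}^{x}\sqrt{4-t^2}\,\chi_{[-2,2]}(t)\,dt$,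 where $\chi_{[-2,2]}$ is the indicator function of $[-2,2]$. ''For all large enough $n$'' means for all $n\ge n_0$, where the threshold $n_0$ may depend on $\mu$ and $L$. *)

(* Defs.v *)
From HB Require Import structures.
From mathcomp Require Import all_boot all_order all_algebra.
From mathcomp Require Import all_classical all_reals all_analysis.
From mathcomp Require Import complex.

Set Implicit Arguments.
Unset Strict Implicit.
Unset Printing Implicit Defensive.

Import Order.TTheory GRing.Theory Num.Theory.
Import numFieldNormedType.Exports.

Local Open Scope classical_set_scope.
Local Open Scope ring_scope.
Local Open Scope complex_scope.

Notation probR R := (probability (measurableTypeR R) R).

Definition supported_on (R : realType) (mu : probR R) (L : R) : Prop :=
  mu `[- L, L]%classic = 1%E.

Definition compactly_supported (R : realType) (mu : probR R) : Prop :=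
  exists L : R, supported_on mu L.

(* The library integrates real functions only, so the complex integral is taken
   componentwise; it is meaningful for [z] outside the support of [mu]. *)
Definition cauchy_transform (R : realType) (mu : probR R) (z : R[i]) : R[i] :=
  (\int[mu]_t complex.Re ((z - t%:C)^-1)) +i*
  (\int[mu]_t complex.Im ((z - t%:C)^-1)).

(* [K] represents the germ at [0] of the K-function of [mu].  For [mu] compactly
   supported, the image under the Cauchy transform of a neighbourhood of
   infinity is a punctured neighbourhood of [0], so this equation determines
   [K] on some punctured neighbourhood of [0] and says nothing elsewhere. *)
Definition is_K_function (R : realType) (mu : probR R) (K : R[i] -> R[i]) :
    Prop :=
  exists M : R, forall z : R[i], M%:C < `|z| -> K (cauchy_transform mu z) = z.

(* [nu] is the free additive convolution of [mu1] and [mu2].  It is a relation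
   because existence and uniqueness of [nu] are theorems. *)
Definition is_free_conv (R : realType) (mu1 mu2 nu : probR R) : Prop :=
  compactly_supported nu /\
  exists K1 K2 : R[i] -> R[i],
    [/\ is_K_function mu1 K1, is_K_function mu2 K2 &
        is_K_function nu (fun z => K1 z + K2 z - z^-1)].

(* [is_free_conv_pow mu n nu]: [nu] is the free convolution of [n >= 1] copies
   of [mu]. *)
Inductive is_free_conv_pow (R : realType) (mu : probR R) :
    nat -> probR R -> Prop :=
| free_conv_pow1 : is_free_conv_pow mu 1 mu
| free_conv_powS (n : nat) (nu nu' : probR R) :
    is_free_conv_pow mu n nu -> is_free_conv nu mu nu' ->
    is_free_conv_pow mu n.+1 nu'.

Definition normalized (R : realType) (n : nat) (nu : probR R) (E : set R) :
    \bar R :=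
  nu [set Num.sqrt n%:R * u | u in E].

Definition normalized_cdf (R : realType) (n : nat) (nu : probR R) (x : R) : R :=
  fine (normalized n nu `]-oo, x]%classic).

Definition semicircle_cdf (R : realType) (x : R) : R :=
  (2 * pi)^-1 *
  \int[lebesgue_measure]_(t in `]-oo, x])
     (Num.sqrt (4 - t ^+ 2) * \1_(`[- 2, 2] : set R) t).

(* Main.v *)
(* Write G for the Cauchy transform.  Near v = 0 the definition of the n-fold free
   convolution nu says that nu's transform takes the value G_mu(1/v) at
   n/v - (n-1)/G_mu(1/v).  Both sides continue along a segment from 0 to v as long
   as this point stays in the upper half-plane: the discrepancy vanishes at many
   points of the segment, and bounds on its divided differences then make it vanish a
   little further on.  With v = w / sqrt n, the point divided by sqrt n is
   zeta w = 1/w + w + O(L w / sqrt n), so the resolvent of the normalized measure is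
   known on the image of {|w| <= 1 - O(L / sqrt n), Im w < 0}.

   The imaginary part of the integral of the resolvent along a ray in w gives the mean
   of atan ((Re zeta - t) / Im zeta), up to O(L / sqrt n).  A combination of these means
   at two heights of order L / sqrt n differs from the step function by at most a
   constant times the Poisson kernel at that height; as the resolvent is
   bounded, it determines the distribution function up to O(L / sqrt n) near
   x = 2 cos t, where it agrees with the semicircle distribution function
   1 - (t - sin t cos t) / pi.  Monotonicity fills in the other points x.  The
   resulting bound is O(L / sqrt n), and L >= 1 as the variance is 1. *)

Require Import Defs.
From mathcomp Require Import all_boot all_order all_algebra.
From mathcomp Require Import all_classical all_reals all_analysis.
From mathcomp Require Import complex measurable_realfun ring lra zify.

Set Implicit Arguments.
Unset Strict Implicit.
Unset Printing Implicit Defensive.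

Import Order.TTheory GRing.Theory Num.Theory.
Import numFieldNormedType.Exports.

Local Open Scope classical_set_scope.
Local Open Scope ring_scope.
Local Open Scope complex_scope.

Import Normc.

(** * Complex modulus and bounded measurable functions *)

(** The germ holds on a neighbourhood of [v = 0] of unknown size, whereas [|v|] close to [n^(-1/2)]
    has to be reached. The divided differences of the discrepancy are bounded geometrically with one
    ratio for the whole segment, so the step length is fixed and finitely many steps suffice. This
    takes the place of an identity theorem for analytic functions.

    Near the edges of the spectrum the heights are only of order [d sin t], where [d] is a fixed
    multiple of [L / sqrt n], so an error of order [d] could push the point out of the upper
    half-plane. The perturbation of [1/w + w] is therefore controlled as a Lipschitz function that
    commutes with conjugation, which gains a factor [|Im w|] in its imaginary part.

    Why a ray: for the semicircle law the resolvent at [1/w + w] is [w], and the differential of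
    that point is [(1 - w^(-2)) dw]. The phase is then [arg w - Im (w^2) / 2] up to a constant, and
    [arg w] does not change along a ray. At the vertex the point escapes to infinity in the
    direction of [1/w], which supplies the initial value. *)

Section ComplexModulus.
Variable R : realType.
Implicit Types (x y : R) (z w : R[i]).

Lemma normcE2 z : normc z = Num.sqrt (complex.Re z ^+ 2 + complex.Im z ^+ 2).
Proof. by case: z. Qed.

Lemma normc_ge0 z : 0 <= normc z.
Proof. by rewrite normcE2 sqrtr_ge0. Qed.

Lemma normc_sqr z : normc z ^+ 2 = complex.Re z ^+ 2 + complex.Im z ^+ 2.
Proof. by rewrite normcE2 sqr_sqrtr// addr_ge0// sqr_ge0. Qed.

Lemma normc_norm z : (normc z)%:C = `|z|.
Proof. by case: z. Qed.

Lemma lenormcD z w : normc (z + w) <= normc z + normc w.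
Proof. exact: (@le_normcD R z w). Qed.

Lemma normc_opp z : normc (- z) = normc z.
Proof. exact: (@normcN R z). Qed.

Lemma lenormcB z w : normc (z - w) <= normc z + normc w.
Proof. by rewrite -(normc_opp w) lenormcD. Qed.

Lemma lerB_normc z w : normc z - normc w <= normc (z + w).
Proof. by rewrite lerBlDr -{1}(addrK w z) lenormcB. Qed.

Lemma normc_real x : normc x%:C = `|x|.
Proof. by rewrite normcE2/= expr0n/= addr0 sqrtr_sqr. Qed.

Lemma normc_zero : normc (0 : R[i]) = 0.
Proof. by rewrite -[0](rmorph0 (real_complex R)) normc_real normr0. Qed.

Lemma normc_one : normc (1 : R[i]) = 1.
Proof. by rewrite -[1](rmorph1 (real_complex R)) normc_real normr1. Qed.

Lemma normc_nat n : normc (n%:R : R[i]) = n%:R.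
Proof. by rewrite -(rmorph_nat (real_complex R)) normc_real ger0_norm. Qed.

Lemma Re_le_normc z : `|complex.Re z| <= normc z.
Proof. by rewrite -sqrtr_sqr normcE2 ler_wsqrtr// lerDl sqr_ge0. Qed.

Lemma Im_le_normc z : `|complex.Im z| <= normc z.
Proof. by rewrite -sqrtr_sqr normcE2 ler_wsqrtr// lerDr sqr_ge0. Qed.

Lemma normc_le_ReIm z : normc z <= `|complex.Re z| + `|complex.Im z|.
Proof.
rewrite -[leRHS]ger0_norm ?addr_ge0// -sqrtr_sqr normcE2 ler_wsqrtr//.
by rewrite sqrrD !real_normK ?num_real// lerD2r lerDl mulrn_wge0// mulr_ge0.
Qed.

Lemma normc_eq0 z : (normc z == 0) = (z == 0).
Proof.
by apply/eqP/eqP => [/eq0_normc//|->]; rewrite normcE2/= expr0n/= addr0 sqrtr0.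
Qed.

Lemma normc_gt0 z : (0 < normc z) = (z != 0).
Proof. by rewrite lt_def normc_eq0 normc_ge0 andbT. Qed.

Lemma normcX z n : normc (z ^+ n) = normc z ^+ n.
Proof.
elim: n => [|n IH]; first by rewrite !expr0 normc_one.
by rewrite !exprS normcM IH.
Qed.

Lemma ReD z w : complex.Re (z + w) = complex.Re z + complex.Re w.
Proof. by case: z w => [? ?] []. Qed.
Lemma ImD z w : complex.Im (z + w) = complex.Im z + complex.Im w.
Proof. by case: z w => [? ?] []. Qed.
Lemma ReN z : complex.Re (- z) = - complex.Re z.
Proof. by case: z. Qed.
Lemma ImN z : complex.Im (- z) = - complex.Im z.
Proof. by case: z. Qed.
Lemma ReM z w : complex.Re (z * w) =
  complex.Re z * complex.Re w - complex.Im z * complex.Im w.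
Proof. by case: z w => [? ?] []. Qed.
Lemma ImM z w : complex.Im (z * w) =
  complex.Re z * complex.Im w + complex.Im z * complex.Re w.
Proof. by case: z w => [? ?] []. Qed.
Lemma ReV z : complex.Re z^-1 = complex.Re z / normc z ^+ 2.
Proof. by rewrite normc_sqr; case: z. Qed.
Lemma ImV z : complex.Im z^-1 = - (complex.Im z / normc z ^+ 2).
Proof. by rewrite normc_sqr; case: z. Qed.

Lemma ReZ x z : complex.Re (x%:C * z) = x * complex.Re z.
Proof. by rewrite ReM/= mul0r subr0. Qed.
Lemma ImZ x z : complex.Im (x%:C * z) = x * complex.Im z.
Proof. by rewrite ImM/= mul0r addr0. Qed.

Lemma eq_complexP z w :
  complex.Re z = complex.Re w -> complex.Im z = complex.Im w -> z = w.
Proof. by case: z w => [a b] [c d] /= -> ->. Qed.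

End ComplexModulus.

(** * Bounded measurable functions on a set *)

Section BoundedMeasurable.
Variables (R : realType) (D : set (measurableTypeR R)).
Hypothesis mD : measurable D.

(** On a set of full measure such a function is integrable for any probability measure, so
    integrability reduces to closure rules. *)
Definition bmeas (f : measurableTypeR R -> R) :=
  measurable_fun D f /\ exists M : R, forall t, D t -> `|f t| <= M.

Definition cbmeas (f : measurableTypeR R -> R[i]) :=
  bmeas (fun t => complex.Re (f t)) /\ bmeas (fun t => complex.Im (f t)).

Lemma bmeas_cst x : bmeas (fun=> x).
Proof. by split; [exact: measurable_cst|exists `|x|]. Qed.

Lemma bmeasD f g : bmeas f -> bmeas g -> bmeas (fun t => f t + g t).
Proof.
move=> [mf [M hM]] [mg [N hN]]; split; first exact: measurable_funD.
by exists (M + N) => t Dt; apply: le_trans (ler_normD _ _) (lerD (hM t Dt) (hN t Dt)).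
Qed.

Lemma bmeasM f g : bmeas f -> bmeas g -> bmeas (fun t => f t * g t).
Proof.
move=> [mf [M hM]] [mg [N hN]]; split; first exact: measurable_funM.
by exists (M * N) => t Dt; rewrite normrM ler_pM// ?hM ?hN.
Qed.

Lemma bmeasN f : bmeas f -> bmeas (fun t => - f t).
Proof.
move=> [mf [M hM]]; split; first exact: measurable_funN.
by exists M => t Dt; rewrite normrN hM.
Qed.

Lemma bmeasV f d : bmeas f -> 0 < d -> (forall t, D t -> d <= f t) ->
  bmeas (fun t => (f t)^-1).
Proof.
move=> [mf _] d0 hd; split.
  (* The function is positive on [D], where its inverse is a composition of measurable functions. *)
  apply: (eq_measurable_fun (fun t => expR (- ln (f t)))).
    move=> t /[!inE] Dt; rewrite expRN lnK// posrE (lt_le_trans d0)//; exact: hd.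
  apply: measurableT_comp => //; apply: measurable_funN.
  exact: (measurableT_comp (@measurable_ln R)).
exists d^-1 => t Dt; have ft : d <= f t by exact: hd.
by rewrite ger0_norm ?invr_ge0 ?lef_pV2 ?posrE//; lra.
Qed.

Lemma bmeas_comp (h : R -> R) (M : R) f : continuous h -> (forall x, `|h x| <= M) ->
  bmeas f -> bmeas (fun t => h (f t)).
Proof.
move=> ch hM [mf _]; split; last by exists M => t _.
apply: measurableT_comp mf; exact: continuous_measurable_fun.
Qed.

Lemma cbmeas_cst z : cbmeas (fun=> z).
Proof. by split; exact: bmeas_cst. Qed.

Lemma cbmeasD f g : cbmeas f -> cbmeas g -> cbmeas (fun t => f t + g t).
Proof.
move=> [rf jf] [rg jg]; split.
- by under [X in bmeas X]eq_fun do rewrite ReD; exact: bmeasD.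
- by under [X in bmeas X]eq_fun do rewrite ImD; exact: bmeasD.
Qed.

Lemma cbmeasN f : cbmeas f -> cbmeas (fun t => - f t).
Proof.
move=> [rf jf]; split.
- by under [X in bmeas X]eq_fun do rewrite ReN; exact: bmeasN.
- by under [X in bmeas X]eq_fun do rewrite ImN; exact: bmeasN.
Qed.

Lemma cbmeasB f g : cbmeas f -> cbmeas g -> cbmeas (fun t => f t - g t).
Proof. by move=> bf bg; apply: cbmeasD => //; exact: cbmeasN. Qed.

Lemma cbmeasM f g : cbmeas f -> cbmeas g -> cbmeas (fun t => f t * g t).
Proof.
move=> [rf jf] [rg jg]; split.
- under [X in bmeas X]eq_fun do rewrite ReM.
  by apply: bmeasD; [|apply: bmeasN]; exact: bmeasM.
- by under [X in bmeas X]eq_fun do rewrite ImM; apply: bmeasD; exact: bmeasM.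
Qed.

Lemma cbmeasX f n : cbmeas f -> cbmeas (fun t => f t ^+ n).
Proof.
move=> bf; elim: n => [|n IH].
  by under [X in cbmeas X]eq_fun do rewrite expr0; exact: cbmeas_cst.
by under [X in cbmeas X]eq_fun do rewrite exprS; exact: cbmeasM.
Qed.

Lemma cbmeasV f d : cbmeas f -> 0 < d -> (forall t, D t -> d <= normc (f t)) ->
  cbmeas (fun t => (f t)^-1).
Proof.
move=> [rf jf] d0 hd.
have nV : bmeas (fun t => (normc (f t) ^+ 2)^-1).
  apply: (@bmeasV _ (d ^+ 2)).
  - under [X in bmeas X]eq_fun do rewrite normc_sqr !expr2.
    by apply: bmeasD; exact: bmeasM.
  - by rewrite exprn_gt0.
  - by move=> t Dt; rewrite lerXn2r ?nnegrE ?normc_ge0 ?hd// ltW.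
split.
- by under [X in bmeas X]eq_fun do rewrite ReV; exact: bmeasM.
- by under [X in bmeas X]eq_fun do rewrite ImV; apply: bmeasN; exact: bmeasM.
Qed.

Lemma cbmeas_real f : bmeas f -> cbmeas (fun t => (f t)%:C).
Proof. by move=> bf; split => //; exact: bmeas_cst. Qed.

End BoundedMeasurable.

(** * Real and complex means with respect to a probability measure *)

Section Means.
Variables (R : realType) (P : probR R) (D : set (measurableTypeR R)).
Hypotheses (mD : measurable D) (PD : P D = 1%E).
Implicit Types (f g : measurableTypeR R -> R) (F G : measurableTypeR R -> R[i]).

(** Integrating over a set of full measure lets pointwise bounds be required on the support only. *)
Definition mean f : R := \int[P]_(t in D) f t.

Definition cmean F : R[i] :=
  mean (fun t => complex.Re (F t)) +i* mean (fun t => complex.Im (F t)).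

Lemma bmeas_integrable f : bmeas D f -> P.-integrable D (EFin \o f).
Proof.
move=> [mf [M hM]]; apply: measurable_bounded_integrable => //.
  exact: (eq_ind_r (fun x => (x < +oo)%E) (ltry (1 : R)) PD).
exists M; split; first exact: num_real.
by move=> x Mx t Dt; apply: le_trans (hM t Dt) (ltW Mx).
Qed.

Lemma mean_cst x : mean (fun=> x) = x.
Proof.
rewrite /mean Rintegral_cst// (_ : fine _ = 1) ?mulr1//.
by transitivity (fine (1%E : \bar R)) => //; congr fine; exact: PD.
Qed.

Lemma meanD f g : bmeas D f -> bmeas D g ->
  mean (fun t => f t + g t) = mean f + mean g.
Proof. by move=> bf bg; rewrite /mean RintegralD//; exact: bmeas_integrable. Qed.

Lemma meanZ x f : bmeas D f -> mean (fun t => x * f t) = x * mean f.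
Proof. by move=> bf; rewrite /mean RintegralZl//; exact: bmeas_integrable. Qed.

Lemma meanN f : bmeas D f -> mean (fun t => - f t) = - mean f.
Proof.
move=> bf; rewrite -mulN1r -meanZ//; congr mean.
by apply/funext => t; rewrite mulN1r.
Qed.

Lemma meanB f g : bmeas D f -> bmeas D g ->
  mean (fun t => f t - g t) = mean f - mean g.
Proof. by move=> bf bg; rewrite meanD ?meanN//; exact: bmeasN. Qed.

Lemma le_mean f g : bmeas D f -> bmeas D g -> (forall t, D t -> f t <= g t) ->
  mean f <= mean g.
Proof.
by move=> bf bg fg; apply: le_Rintegral => //; exact: bmeas_integrable.
Qed.

Lemma eq_mean f g : (forall t, D t -> f t = g t) -> mean f = mean g.
Proof. by move=> fg; apply: eq_Rintegral => t /[!inE]; exact: fg. Qed.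

Lemma norm_mean_le f g : bmeas D f -> bmeas D g ->
  (forall t, D t -> `|f t| <= g t) -> `|mean f| <= mean g.
Proof.
move=> bf bg fg; rewrite ler_norml -meanN//; apply/andP; split.
- by apply: le_mean => //; [exact: bmeasN|] => t /fg; rewrite ler_norml => /andP[].
- by apply: le_mean => // t /fg; rewrite ler_norml => /andP[].
Qed.

Lemma cmean_cst z : cmean (fun=> z) = z.
Proof. by rewrite /cmean !mean_cst; case: z. Qed.

Lemma cmeanD F G : cbmeas D F -> cbmeas D G ->
  cmean (fun t => F t + G t) = cmean F + cmean G.
Proof.
move=> [rF jF] [rG jG]; apply: eq_complexP.
- by rewrite ReD/= -meanD//; congr mean; apply/funext => t; rewrite ReD.
- by rewrite ImD/= -meanD//; congr mean; apply/funext => t; rewrite ImD.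
Qed.

Lemma cmeanN F : cbmeas D F -> cmean (fun t => - F t) = - cmean F.
Proof.
move=> [rF jF]; apply: eq_complexP.
- by rewrite ReN/= -meanN//; congr mean; apply/funext => t; rewrite ReN.
- by rewrite ImN/= -meanN//; congr mean; apply/funext => t; rewrite ImN.
Qed.

Lemma cmeanB F G : cbmeas D F -> cbmeas D G ->
  cmean (fun t => F t - G t) = cmean F - cmean G.
Proof. by move=> bF bG; rewrite cmeanD ?cmeanN//; exact: cbmeasN. Qed.

Lemma cmeanZ z F : cbmeas D F -> cmean (fun t => z * F t) = z * cmean F.
Proof.
move=> [rF jF]; have bZ x f : bmeas D f -> bmeas D (fun t => x * f t).
  by move=> bf; apply: bmeasM => //; exact: bmeas_cst.
apply: eq_complexP.
- rewrite ReM/= -!meanZ// -meanB; [|exact: bZ..].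
  by congr mean; apply/funext => t; rewrite ReM.
- rewrite ImM/= -!meanZ// -meanD; [|exact: bZ..].
  by congr mean; apply/funext => t; rewrite ImM.
Qed.

Lemma eq_cmean F G : (forall t, D t -> F t = G t) -> cmean F = cmean G.
Proof.
by move=> FG; rewrite /cmean; congr Complex; apply: eq_mean => t Dt; rewrite FG.
Qed.

Lemma normc_cmean_le F g : cbmeas D F -> bmeas D g ->
  (forall t, D t -> normc (F t) <= g t) -> normc (cmean F) <= mean g.
Proof.
move=> bF bg Fg; have [->|I0] := eqVneq (cmean F) 0.
  rewrite normc_zero -[leLHS](mean_cst 0).
  by apply: le_mean => // [|t /Fg]; [exact: bmeas_cst|apply: le_trans; exact: normc_ge0].
(* rotate the mean onto the positive real axis *)
pose I := cmean F; pose c := I^* / (normc I)%:C.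
have nI : 0 < normc I by rewrite normc_gt0.
have cI : c * I = (normc I)%:C.
  have II : I * I^* = (normc I)%:C ^+ 2.
    rewrite -(rmorphXn (real_complex R)) normc_sqr; case: (I) => a b.
    by apply: eq_complexP; rewrite /= ?expr2; ring.
  rewrite /c mulrAC (mulrC _ I) II expr2 mulfK//.
  by apply/eqP => -[] /eqP; rewrite gt_eqF.
have nc : normc c = 1.
  rewrite normcM normcV normc_real ger0_norm ?normc_ge0//.
  have -> : normc I^* = normc I by case: (I) => a b /=; rewrite sqrrN.
  by rewrite divff// gt_eqF.
have -> : normc (cmean F) = mean (fun t => complex.Re (c * F t)).
  by rewrite -[RHS]/(complex.Re (cmean (fun t => c * F t))) cmeanZ// cI.
apply: le_mean => //.
  by have [] : cbmeas D (fun t => c * F t) by apply: cbmeasM => //; exact: cbmeas_cst.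
move=> t Dt; apply: le_trans (Fg t Dt); apply: le_trans (ler_norm _) _.
by apply: le_trans (Re_le_normc _) _; rewrite normcM nc mul1r.
Qed.

Lemma normc_cmean_bound F M : cbmeas D F -> (forall t, D t -> normc (F t) <= M) ->
  normc (cmean F) <= M.
Proof.
move=> bF hM; rewrite -[leRHS]mean_cst; apply: normc_cmean_le => //.
exact: bmeas_cst.
Qed.

Lemma integral_supported (h : measurableTypeR R -> \bar R) :
  measurable_fun setT h -> (\int[P]_t h t = \int[P]_(t in D) h t)%E.
Proof.
move=> mh; rewrite [RHS]integral_mkcond; apply: ae_eq_integral => //.
  by apply/(measurable_restrictT h mD); exact: measurable_funS mh.
exists (~` D); split; first exact: measurableC.
- have e : (1 - P D = 0)%E by rewrite PD subee.
  exact: etrans (probability_setC P mD) e.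
- move=> t /= nt Dt; apply: nt => _.
  by rewrite patchE mem_set.
Qed.

(** Zeros of [f] are allowed: there the inverse and the real power of exponent -1 both take the
    default value 0. The Cauchy transform integrates over the whole line, where [z - t] may
    vanish. *)
Lemma measurable_invr (f : measurableTypeR R -> R) : measurable_fun setT f ->
  (forall t, 0 <= f t) -> measurable_fun setT (fun t => (f t)^-1).
Proof.
move=> mf f0; under eq_fun do rewrite -powR_inv1//.
exact: (measurableT_comp (@measurable_powR R (-1))).
Qed.

Lemma cauchy_transformE z :
  cauchy_transform P z = cmean (fun t => (z - (t : R)%:C)^-1).
Proof.
have mn : measurable_fun setT
    (fun t : measurableTypeR R => (normc (z - (t : R)%:C) ^+ 2)^-1).
  apply: measurable_invr => [|t]; last by rewrite sqr_ge0.
  under eq_fun do rewrite normc_sqr; apply: measurable_funD.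
  - apply: measurable_funX; under eq_fun do rewrite ReD ReN/=.
    by apply: measurable_funB => //; exact: measurable_cst.
  - apply: measurable_funX; under eq_fun do rewrite ImD ImN/=.
    exact: measurable_cst.
rewrite /cauchy_transform /cmean /mean /Rintegral; congr (fine _ +i* fine _).
- rewrite integral_supported//; apply/measurable_EFinP.
  under eq_fun do rewrite ReV; apply: measurable_funM => //.
  under eq_fun do rewrite ReD ReN/=.
  by apply: measurable_funB => //; exact: measurable_cst.
- rewrite integral_supported//; apply/measurable_EFinP.
  under eq_fun do rewrite ImV; apply: measurable_funN; apply: measurable_funM => //.
  under eq_fun do rewrite ImD ImN/=; exact: measurable_cst.
Qed.

End Means.

Lemma measurable_segment (R : realType) (B : R) :
  measurable ([set` `[- B, B]] : set (measurableTypeR R)).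
Proof. exact: measurable_itv. Qed.

(** * First two moments of the given measure *)

Section Moments.
Variables (R : realType) (mu : probR R) (L : R).
Hypothesis muL : supported_on mu L.
Hypothesis mu0 : ('E_mu[(fun u : measurableTypeR R => (u : R))] = 0)%E.
Hypothesis mu1 : (variance mu (fun u : measurableTypeR R => (u : R)) = 1)%E.
Let D : set (measurableTypeR R) := `[- L, L]%classic.

Lemma mean_id : mean mu D (fun t => t) = 0.
Proof.
rewrite /mean /Rintegral -(integral_supported (measurable_segment L) muL); last exact/measurable_EFinP.
by have := mu0; rewrite unlock => ->.
Qed.

Lemma mean_sqr : mean mu D (fun t => (t : R) ^+ 2) = 1.
Proof.
rewrite /mean /Rintegral -(integral_supported (measurable_segment L) muL); last first.
  by apply/measurable_EFinP; exact: measurable_funX.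
have := mu1; rewrite /variance unlock mu0 unlock/= => h.
rewrite (_ : 1 = fine 1%E)// -h; congr fine; apply: eq_integral => t _.
by rewrite -[RHS]/((((t : R) - 0) * ((t : R) - 0))%:E) subr0 expr2.
Qed.

End Moments.

(** * Divided differences *)

Section DividedDifferences.
Variable K : fieldType.
Implicit Types (f g : K -> K) (l : seq K) (a x : K).

(** The classical divided difference at the nodes [x :: l], with [x] kept apart as the moving point
    so that inductions on [l] can replace it by a node. *)
Fixpoint divdiff f l x : K :=
  if l is a :: l' then (divdiff f l' x - divdiff f l' a) / (x - a) else f x.

Lemma eq_divdiff f g l x : {in x :: l, f =1 g} -> divdiff f l x = divdiff g l x.
Proof.
elim: l x => [|a l IH] x fg /=; first by rewrite fg// mem_head.
rewrite !IH// => y; rewrite !inE => /orP[yx|yl]; apply: fg;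
  by rewrite !inE ?yx ?yl ?orbT.
Qed.

Lemma divdiff_cst c a l x : divdiff (fun=> c) (a :: l) x = 0.
Proof.
elim: l a x => [|b l IH] a x; first by rewrite /= subrr mul0r.
by rewrite [LHS]/= -!/(divdiff _ (b :: l) _) !IH subrr mul0r.
Qed.

(** In Newton's interpolation formula all coefficients but the last involve values at the nodes of
    [l] only, hence vanish; the remainder term is what survives. *)
Lemma divdiff_newton f l x : uniq (x :: l) -> {in l, forall a, f a = 0} ->
  f x = (\prod_(a <- l) (x - a)) * divdiff f l x.
Proof.
elim: l x => [|a l IH] x; first by rewrite big_nil mul1r.
rewrite cons_uniq inE negb_or => /andP[/andP[xa xl] ul] f0.
have f0' : {in l, forall b, f b = 0} by move=> b bl; rewrite f0// inE bl orbT.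
(* The induction hypothesis at the node [a] writes [f a = 0] as a product whose first factor is
   nonzero. *)
have al : divdiff f l a = 0.
  have /eqP := IH a ul f0'; rewrite f0 ?mem_head// eq_sym mulf_eq0.
  case/orP => [|/eqP//]; rewrite prodf_seq_eq0 => /hasP[b bl /=].
  by rewrite subr_eq0 => /eqP ab; move: ul; rewrite /= ab bl.
rewrite (IH x)//; last by rewrite /= xl; case/andP: ul.
rewrite big_cons /= al subr0; field.
by rewrite subr_eq0.
Qed.

(** The Leibniz rule for divided differences: each term splits the list of nodes in two, the parts
    sharing one node. *)
Lemma divdiff_mul f g l x : divdiff (fun y => f y * g y) l x =
  f x * divdiff g l x +
  \sum_(i < size l) divdiff f (take i.+1 l) x *
                    divdiff g (drop i.+1 l) (nth 0 l i).
Proof.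
elim: l x => [|a l IH] x /=; first by rewrite big_ord0 addr0.
rewrite !IH big_ord_recl /= take0 drop0 /=.
under [in RHS]eq_bigr => i _ do rewrite mulrAC mulrBl.
by rewrite -mulr_suml sumrB; ring.
Qed.

End DividedDifferences.

(** * Geometric bounds for divided differences of a reciprocal *)

Section ReciprocalBound.
Variables (R : realType) (U : R[i] -> Prop) (P : R[i] -> R[i]) (d A r : R).
Hypotheses (d0 : 0 < d) (A0 : 0 <= A) (r0 : 0 < r).
Hypothesis Pd : forall x, U x -> d <= normc (P x).
Hypothesis PA : forall a l x, (forall y, y \in x :: a :: l -> U y) ->
  uniq (x :: a :: l) -> normc (divdiff P (a :: l) x) <= A * r ^+ (size l).+1.

(** The product of [P] and its reciprocal is 1, whose divided differences vanish. The Leibniz rule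
    thus expresses the top divided difference of the reciprocal through those on shorter lists, and
    a geometric bound solves the resulting recursion. *)
Lemma divdiff_inv_bound l x : (forall y, y \in x :: l -> U y) -> uniq (x :: l) ->
  normc (divdiff (fun y => (P y)^-1) l x) <= d^-1 * (r * (1 + A / d)) ^+ size l.
Proof.
set M := r * _; set Q := fun y => _; have [n] := ubnP (size l).
elim: n => // n IHn in l x *; case: l => [|a l] ln hU ul.
  have Px := Pd (hU x (mem_head _ _)).
  by rewrite expr0 mulr1 /= normcV lef_pV2 ?posrE// (lt_le_trans d0).
have P0 y : y \in x :: a :: l -> P y != 0.
  by move=> /hU/Pd/(lt_le_trans d0); rewrite normc_gt0.
have Px : d <= normc (P x) by apply/Pd/hU/mem_head.
have := divdiff_mul P Q (a :: l) x.
rewrite (@eq_divdiff _ _ (fun=> 1)) ?divdiff_cst; last first.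
  by move=> y /P0 ?; rewrite /Q mulfV.
set N := size (a :: l) in ln *.
move=> /eqP; rewrite eq_sym addr_eq0 => /eqP e.
have {e} : normc (P x) * normc (divdiff Q (a :: l) x) <=
    \sum_(i < N) (A * r ^+ i.+1) * (d^-1 * M ^+ (N - i.+1)).
  rewrite -normcM e normc_opp.
  have: forall (I : Type) (s : seq I) (F : I -> R[i]) (G : I -> R),
      (forall i, normc (F i) <= G i) -> normc (\sum_(i <- s) F i) <= \sum_(i <- s) G i.
    move=> I s F G FG; elim: s => [|i s IH].
      by rewrite !big_nil normc_zero.
    by rewrite !big_cons (le_trans (lenormcD _ _))// lerD.
  apply => i; rewrite normcM ler_pM ?normc_ge0//.
    have -> : take i.+1 (a :: l) = a :: take i l by [].
    have -> : i.+1 = (size (take i l)).+1 by rewrite size_takel// -ltnS ltn_ord.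
    apply: PA.
      move=> y; rewrite !inE => /or3P[/eqP->|/eqP->|/mem_take yl]; apply: hU;
      by rewrite !inE ?eqxx ?yl ?orbT.
    move: ul; rewrite !cons_uniq !inE !negb_or => /and3P[/andP[-> xl] al ul] /=.
    rewrite take_uniq// andbT; apply/andP; split.
      by apply: contra xl => /mem_take.
    by apply: contra al => /mem_take.
  rewrite -(size_drop i.+1 (a :: l)); apply: IHn.
  - by rewrite size_drop; move: ln; rewrite /N /=; lia.
  - move=> y; rewrite inE => /orP[/eqP->|/mem_drop yl]; apply: hU; rewrite inE.
      by rewrite mem_nth ?orbT.
    by rewrite yl orbT.
  - rewrite -drop_nth//; apply: drop_uniq; by move: ul => /= /andP[].
(* [M] is chosen for this identity: it turns the convolution sum into the factorization of
   [M ^ N - r ^ N]. *)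
have Mr : M - r = A * r / d by rewrite /M mulrDr mulr1 mulrA; ring.
have -> : \sum_(i < N) (A * r ^+ i.+1) * (d^-1 * M ^+ (N - i.+1)) = M ^+ N - r ^+ N.
  rewrite subrXX Mr mulr_sumr; apply: eq_bigr => i _.
  by rewrite -predn_sub -subnS exprS; ring.
have M0 : 0 <= r ^+ N by rewrite exprn_ge0// ltW.
move=> h; rewrite mulrC ler_pdivlMr// mulrC.
have := normc_ge0 (divdiff Q (a :: l) x) => h0.
have : d * normc (divdiff Q (a :: l) x) <= normc (P x) * normc (divdiff Q (a :: l) x).
  by rewrite ler_wpM2r.
by lra.
Qed.

End ReciprocalBound.

(** * Divided differences under the mean *)

Section DivdiffMean.
Variables (R : realType) (P : probR R) (D : set (measurableTypeR R)).
Hypotheses (mD : measurable D) (PD : P D = 1%E).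
Variable Q : measurableTypeR R -> R[i] -> R[i].

Lemma cbmeas_divdiff l x : (forall y, y \in x :: l -> cbmeas D (Q^~ y)) ->
  cbmeas D (fun t => divdiff (Q t) l x).
Proof.
elim: l x => [|a l IH] x h /=; first exact/h/mem_head.
apply: cbmeasM => //; last exact: cbmeas_cst.
apply: cbmeasB; apply: IH => y; rewrite inE => /orP[yx|yl]; apply: h;
  by rewrite !inE ?yx ?yl ?orbT.
Qed.

(** A divided difference is a finite linear combination of values, so it passes under the mean, and
    bounds can be proved for each [t] separately. *)
Lemma divdiff_cmean l x : (forall y, y \in x :: l -> cbmeas D (Q^~ y)) ->
  divdiff (fun y => cmean P D (Q^~ y)) l x = cmean P D (fun t => divdiff (Q t) l x).
Proof.
elim: l x => [|a l IH] x h //=.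
have hx : forall y, y \in x :: l -> cbmeas D (Q^~ y).
  by move=> y; rewrite inE => /orP[yx|yl]; apply: h; rewrite !inE ?yx ?yl ?orbT.
have ha : forall y, y \in a :: l -> cbmeas D (Q^~ y).
  by move=> y yl; apply: h; rewrite inE yl orbT.
rewrite !IH// -cmeanB//; [|exact: cbmeas_divdiff..].
rewrite mulrC -cmeanZ//; last by apply: cbmeasB => //; exact: cbmeas_divdiff.
by apply: eq_cmean => t _; rewrite mulrC.
Qed.

End DivdiffMean.

(** * The germ of the free convolution power *)

(** Picard iteration from 0: the increments are at most [r / 2^k], so real and imaginary parts
    converge, and the limit stays in the disc. *)
Lemma complex_contraction (R : realType) (f : R[i] -> R[i]) (r : R) : 0 <= r ->
  (forall v, normc v <= r -> normc (f v) <= r) ->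
  (forall v w, normc v <= r -> normc w <= r ->
     normc (f v - f w) <= 2^-1 * normc (v - w)) ->
  exists2 v, normc v <= r & f v = v.
Proof.
move=> r0 fr fl; pose x k := iter k f 0.
have xr k : normc (x k) <= r.
  elim: k => [|k IH]; last exact: fr.
  by rewrite /x /iter normc_zero.
have dx k : normc (x k.+1 - x k) <= r * 2^-1 ^+ k.
  elim: k => [|k IH].
    by rewrite expr0 mulr1 /x subr0 fr// normc_zero.
  rewrite exprS mulrCA; apply: le_trans (fl (x k.+1) (x k) (xr _) (xr _)) _.
  by rewrite ler_wpM2l// invr_ge0.
have cvg_coord (a : R^nat) : (forall k, `|a k.+1 - a k| <= r * 2^-1 ^+ k) -> cvgn a.
  move=> da; have sa : a = series (telescope a) \+ cst (a 0%N).
    by apply/funext => n; rewrite /= telescopeK /= subrK.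
  rewrite sa; apply: is_cvgD; last exact: is_cvg_cst.
  apply: normed_cvg; apply: (@series_le_cvg _ _ (geometric r 2^-1)) => [n|n|n|].
  - exact: normr_ge0.
  - by rewrite /geometric/= mulr_ge0// exprn_ge0// invr_ge0.
  - exact: da.
  - by apply: is_cvg_geometric_series; rewrite ger0_norm ?invr_ge0// invf_lt1 ?ltr1n.
have /cvg_ex[p xp] : cvgn (fun k => complex.Re (x k)).
  apply: cvg_coord => k; apply: le_trans (dx k).
  by have := Re_le_normc (x k.+1 - x k); rewrite ReD ReN.
have /cvg_ex[q xq] : cvgn (fun k => complex.Im (x k)).
  apply: cvg_coord => k; apply: le_trans (dx k).
  by have := Im_le_normc (x k.+1 - x k); rewrite ImD ImN.
pose v := p +i* q.
have near_v e : 0 < e -> exists k, normc (v - x k) <= e /\ normc (v - x k.+1) <= e.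
  move=> e0; have e2 : 0 < e / 2 by rewrite divr_gt0.
  have /cvgrPdist_le/(_ _ e2)[N1 _ h1] := xp.
  have /cvgrPdist_le/(_ _ e2)[N2 _ h2] := xq.
  have h k : (maxn N1 N2 <= k)%N -> normc (v - x k) <= e.
    rewrite geq_max => /andP[k1 k2]; apply: le_trans (normc_le_ReIm _) _.
    rewrite ReD ReN ImD ImN /=.
    by have := h1 k k1; have := h2 k k2; rewrite /=; lra.
  by exists (maxn N1 N2); split; apply: h => //; exact: leqW.
have vr : normc v <= r.
  apply/ler_addgt0Pr => e /near_v[k [hk _]].
  have := lenormcD (v - x k) (x k); rewrite subrK; have := xr k; lra.
exists v => //; apply/eqP; rewrite -subr_eq0 -normc_eq0; apply/eqP/le_anti.
rewrite normc_ge0 andbT; apply/ler_addgt0Pr => e e0; rewrite add0r.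
have e2 : 0 < e / 2 by rewrite divr_gt0.
have [k [h1 h2]] := near_v _ e2.
have -> : f v - v = (f v - f (x k)) + - (v - x k.+1) by rewrite /x/=; ring.
apply: le_trans (lenormcD _ _) _; rewrite normc_opp.
by have := fl _ _ vr (xr k); lra.
Qed.

(** * The Cauchy transform near infinity *)

Section CauchyGerm.
Variables (R : realType) (P : probR R) (B : R).
Hypothesis PB : supported_on P B.
Hypothesis B0 : 0 < B.
Let D : set (measurableTypeR R) := `[- B, B]%classic.
Let mD : measurable D := measurable_segment B.

Lemma segment_norm t : D t -> `|t| <= B.
Proof. by rewrite /D /= in_itv/= ler_norml. Qed.

Lemma normc_onem_ge (t : R) (v : R[i]) : `|t| <= B -> normc v * B <= 2^-1 ->
  2^-1 <= normc (1 - t%:C * v).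
Proof.
move=> tB vB; have := lerB_normc 1 (- (t%:C * v)).
rewrite normc_opp normcM normc_real normc_one.
have : `|t| * normc v <= B * normc v by rewrite ler_wpM2r// normc_ge0.
by rewrite mulrC; lra.
Qed.

Lemma onem_neq0 (t : R) (v : R[i]) : `|t| <= B -> normc v * B <= 2^-1 ->
  1 - t%:C * v != 0.
Proof.
move=> tB vB; rewrite -normc_gt0; apply: lt_le_trans (normc_onem_ge tB vB).
by rewrite invr_gt0.
Qed.

Lemma normc_onemV (t : R) (v : R[i]) : `|t| <= B -> normc v * B <= 2^-1 ->
  normc (1 - t%:C * v)^-1 <= 2.
Proof.
move=> tB vB; rewrite normcV -[leRHS]invrK lef_pV2 ?posrE ?normc_onem_ge//.
by rewrite normc_gt0 onem_neq0.
Qed.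

Lemma bmeas_id : bmeas D (fun t : measurableTypeR R => (t : R)).
Proof. by split; [exact: measurable_id|exists B => t /segment_norm]. Qed.

Lemma cbmeas_onem v : cbmeas D (fun t : measurableTypeR R => 1 - (t : R)%:C * v).
Proof.
apply: cbmeasB => //; first exact: cbmeas_cst.
by apply: cbmeasM => //; [apply: cbmeas_real; exact: bmeas_id|exact: cbmeas_cst].
Qed.

Lemma cbmeas_onemV v : normc v * B <= 2^-1 ->
  cbmeas D (fun t : measurableTypeR R => (1 - (t : R)%:C * v)^-1).
Proof.
move=> vB; apply: (cbmeasV (d := 2^-1)) => //; first exact: cbmeas_onem.
by move=> t /segment_norm tB; exact: normc_onem_ge.
Qed.

(* The generating function [sum_k m_k v^k] of the moments of [P]. *)
Definition mgen v := cmean P D (fun t : measurableTypeR R => (1 - (t : R)%:C * v)^-1).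

Lemma cauchy_transform_inv v : v != 0 -> normc v * B <= 2^-1 ->
  cauchy_transform P v^-1 = v * mgen v.
Proof.
move=> v0 vB; rewrite (cauchy_transformE mD PB) -(cmeanZ mD PB); last exact: cbmeas_onemV.
apply: eq_cmean => t /segment_norm tB; field.
by rewrite v0 onem_neq0.
Qed.

Lemma normc_mgen1 v : normc v * B <= 2^-1 -> normc (mgen v - 1) <= 2 * B * normc v.
Proof.
move=> vB; have bK := cbmeas_onemV vB.
rewrite -(cmean_cst mD PB 1) -cmeanB//; last exact: cbmeas_cst.
apply: (normc_cmean_bound mD PB).
  by apply: cbmeasB => //; exact: cbmeas_cst.
move=> t /segment_norm tB.
have -> : (1 - (t : R)%:C * v)^-1 - 1 = (t : R)%:C * v * (1 - (t : R)%:C * v)^-1.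
  by field; exact: onem_neq0.
rewrite !normcM normc_real; have h1 := normc_onemV tB vB.
have h2 : `|t| * normc v <= B * normc v by rewrite ler_wpM2r// normc_ge0.
have := ler_pM (mulr_ge0 (normr_ge0 t) (normc_ge0 v)) (normc_ge0 _) h2 h1.
by rewrite [X in _ <= X]mulrC mulrA.
Qed.

Lemma mgen_half v : normc v * B <= 4^-1 -> 2^-1 <= normc (mgen v).
Proof.
move=> vB; have /normc_mgen1 h : normc v * B <= 2^-1 by lra.
have := lerB_normc 1 (mgen v - 1); rewrite addrCA subrr addr0 normc_one.
by have : B * normc v <= 4^-1 by [rewrite mulrC]; lra.
Qed.

Lemma mgen_le v : normc v * B <= 4^-1 -> normc (mgen v) <= 2.
Proof.
move=> vB; have /normc_mgen1 h : normc v * B <= 2^-1 by lra.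
have := lenormcD 1 (mgen v - 1); rewrite addrCA subrr addr0 normc_one.
by have : B * normc v <= 4^-1 by [rewrite mulrC]; lra.
Qed.

(** A K-function is constrained only at values of the Cauchy transform at large points, so small [w]
    must be shown to be such values. With [z = 1/v] the equation reads
    [v = w - mean (t v^2 / (1 - t v))], a fixed point problem on the disc of radius [2 |w|]. The
    constant 40 gives [r B <= 1/20] and a contraction factor of 21/50. *)
Lemma cauchy_transform_onto w : w != 0 -> 40 * (normc w * B) <= 1 ->
  exists2 z, cauchy_transform P z = w & (2 * normc w)^-1 <= normc z.
Proof.
move=> w0 wB; pose r := 2 * normc w.
have w_gt0 : 0 < normc w by rewrite normc_gt0.
have rB : r * B <= 20^-1 by rewrite /r; lra.
pose g v (t : measurableTypeR R) : R[i] := (t : R)%:C * v ^+ 2 * (1 - (t : R)%:C * v)^-1.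
have half v : normc v <= r -> normc v * B <= 20^-1.
  by move=> vr; apply: le_trans rB; rewrite ler_wpM2r// ltW.
have bg v : normc v <= r -> cbmeas D (g v).
  move=> /half vB; apply: cbmeasM => //; last by apply: cbmeas_onemV; lra.
  by apply: cbmeasM => //; [apply: cbmeas_real; exact: bmeas_id|exact: cbmeas_cst].
have [v vr|v1 v2 h1 h2|v vr vE] :=
    @complex_contraction R (fun v => w - cmean P D (g v)) r (ltac:(rewrite /r; lra)).
- have h : normc (cmean P D (g v)) <= B * (normc v * normc v) * 2.
    apply: (normc_cmean_bound mD PB) => [|t /segment_norm tB]; first exact: bg.
    have h1 : normc (1 - (t : R)%:C * v)^-1 <= 2.
      by apply: normc_onemV => //; have := half _ vr; lra.
    rewrite /g expr2 !normcM normc_real ler_pM ?mulr_ge0 ?normc_ge0//.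
    by rewrite ler_wpM2r ?mulr_ge0 ?normc_ge0.
  have := lenormcB w (cmean P D (g v)); have := half _ vr.
  have : normc v * B * normc v <= 20^-1 * r.
    by rewrite ler_pM ?mulr_ge0 ?normc_ge0 ?half// ltW.
  by rewrite /r in vr *; nra.
- have -> : w - cmean P D (g v1) - (w - cmean P D (g v2)) =
     cmean P D (fun t => g v2 t - g v1 t).
    by rewrite cmeanB//; [ring|exact: bg..].
  apply: (normc_cmean_bound mD PB) => [|t /segment_norm tB].
    by apply: cbmeasB; exact: bg.
  have t1 : 1 - (t : R)%:C * v1 != 0 by apply: onem_neq0 => //; have := half _ h1; lra.
  have t2 : 1 - (t : R)%:C * v2 != 0 by apply: onem_neq0 => //; have := half _ h2; lra.
  have -> : g v2 t - g v1 t = (t : R)%:C * (v1 - v2) *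
     ((t : R)%:C * v1 * v2 - (v1 + v2)) *
     ((1 - (t : R)%:C * v1)^-1 * (1 - (t : R)%:C * v2)^-1).
    by rewrite /g; field; rewrite t1 t2.
  have k1 : normc (1 - (t : R)%:C * v1)^-1 <= 2.
    by apply: normc_onemV => //; have := half _ h1; lra.
  have k2 : normc (1 - (t : R)%:C * v2)^-1 <= 2.
    by apply: normc_onemV => //; have := half _ h2; lra.
  rewrite normcM [normc (_ * (_ * _ * _ - _))]normcM [normc (_ * (v1 - v2))]normcM.
  rewrite [normc (_^-1 * _)]normcM normc_real.
  have k12 : normc (1 - (t : R)%:C * v1)^-1 * normc (1 - (t : R)%:C * v2)^-1 <= 4.
    by rewrite (_ : 4 = 2 * 2) ?ler_pM ?normc_ge0//; ring.
  have ks : normc ((t : R)%:C * v1 * v2 - (v1 + v2)) <= B * normc v1 * r + 2 * r.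
    apply: le_trans (lenormcB _ _) _; rewrite lerD//; last first.
      by apply: le_trans (lenormcD _ _) _; lra.
    rewrite !normcM normc_real ler_pM ?mulr_ge0 ?normc_ge0//.
    by rewrite ler_wpM2r ?normc_ge0.
  have r0 : 0 <= r by apply: le_trans h1; exact: normc_ge0.
  set n12 := normc (v1 - v2); have n0 : 0 <= n12 by exact: normc_ge0.
  have kB : B * normc v1 * r <= 20^-1 * r by rewrite ler_wpM2r// mulrC half.
  have ks' : normc ((t : R)%:C * v1 * v2 - (v1 + v2)) <= 21 / 10 * r by lra.
  have e1 : `|t| * n12 * normc ((t : R)%:C * v1 * v2 - (v1 + v2)) <=
      (B * n12) * (21 / 10 * r).
    by rewrite ler_pM ?mulr_ge0 ?normc_ge0// ler_wpM2r.
  have e2 : (B * n12) * (21 / 10 * r) <= n12 * (21 / 200).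
    have -> : (B * n12) * (21 / 10 * r) = n12 * (21 / 10 * (r * B)) by ring.
    by rewrite ler_wpM2l//; lra.
  have e3 : `|t| * n12 * normc ((t : R)%:C * v1 * v2 - (v1 + v2)) <= n12 * (21 / 200).
    exact: le_trans e1 e2.
  have e4 : 0 <= `|t| * n12 * normc ((t : R)%:C * v1 * v2 - (v1 + v2)).
    by rewrite !mulr_ge0 ?normc_ge0.
  apply: le_trans (ler_pM e4 _ e3 k12) _; first by rewrite mulr_ge0 ?normc_ge0.
  lra.
have v0 : v != 0.
  apply/eqP => v0; move: vE; rewrite v0 (_ : g 0 = fun=> 0) ?(cmean_cst mD PB).
    by rewrite subr0 => /eqP; rewrite (negbTE w0).
  by apply/funext => t; rewrite /g expr0n/= mulr0 mul0r.
have vB := half _ vr; exists v^-1.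
  have vB2 : normc v * B <= 2^-1 by lra.
  rewrite cauchy_transform_inv// /mgen -(cmeanZ mD PB); last exact: cbmeas_onemV.
  have -> : w = v + cmean P D (g v) by apply/eqP; rewrite -subr_eq; apply/eqP; exact: vE.
  rewrite -[v in v + _](cmean_cst mD PB) -cmeanD//; [|exact: cbmeas_cst|exact: bg].
  by apply: eq_cmean => t /segment_norm tB; rewrite /g; field; exact: onem_neq0.
by rewrite normcV lef_pV2 ?posrE ?normc_gt0//; rewrite mulr_gt0.
Qed.

End CauchyGerm.

(** * The functional equation of convolution powers near infinity *)

Section FreeConvolutionGerm.
Variables (R : realType) (mu : probR R) (L : R).
Hypotheses (muL : supported_on mu L) (L0 : 0 < L).

Lemma supported_on_pos (P : probR R) : compactly_supported P ->
  exists2 B : R, supported_on P B & 0 < B.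
Proof.
move=> [B PB]; exists (`|B| + 1); last by rewrite ltr_wpDl.
have mB (b : R) : measurable ([set` `[- b, b]] : set (measurableTypeR R)).
  exact: measurable_segment.
apply/eqP; rewrite eq_le probability_le1//=.
have <- : P `[- B, B]%classic = 1%E by exact: PB.
apply: le_measure; rewrite ?inE; [exact: mB|exact: mB|].
apply: subset_itv; rewrite bnd_simp; have := ler_norm B.
- by have := ler_norm (- B); rewrite normrN; lra.
- by lra.
Qed.

(** Put [w = G_mu (1/v)]. By induction the K-function of the [n]-th power sends [w] to
    [n/v - (n-1)/w], while that of [mu] sends it to [1/v]. Adding these and subtracting [1/w] gives
    the same formula for [n + 1]. *)
Lemma free_conv_pow_germ n (nu : probR R) : is_free_conv_pow mu n nu ->
  [/\ (0 < n)%N, compactly_supported nu & exists M : R, forall v : R[i], v != 0 ->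
    normc v * M <= 1 ->
    cauchy_transform nu (n%:R / v - (n.-1)%:R / cauchy_transform mu v^-1) =
    cauchy_transform mu v^-1].
Proof.
elim=> [|{}n {}nu nu' _ [n0 _ [M hM]] [cnu' [K1 [K2 [[M1 hK1] [M2 hK2] [M3 hK3]]]]]].
  by split=> //; [exists L|exists 0 => v v0 _; rewrite mul0r subr0 mul1r].
split=> //; have [B nuB B0] := supported_on_pos cnu'.
(* One threshold dominating the six smallness conditions on [x] in [bounds]; the summand 4 makes the
   inequalities for [M1], [M2], [M3] strict. *)
pose N := `|M| + 2 * `|M1| + `|M2| + 4 * `|M3| + 80 * B + 8 * (L * n%:R) + 4.
have LN0 : 0 <= L * n%:R by rewrite mulr_ge0// ltW.
exists N => v v0; set x := normc v => xN.
have x0 : 0 < x by rewrite normc_gt0.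
have le_xN c : c <= N -> x * c <= 1 by move=> cN; apply: le_trans xN; rewrite ler_pM2l.
have bounds : [/\ x * M <= 1, x * (2 * M1 + 4) <= 1, x * (M2 + 4) <= 1,
    x * (4 * M3 + 4) <= 1 & x * (80 * B) <= 1] /\ x * (8 * (L * n%:R)) <= 1.
  have := ler_norm M; have := ler_norm M1; have := ler_norm M2; have := ler_norm M3.
  have := normr_ge0 M; have := normr_ge0 M1; have := normr_ge0 M2; have := normr_ge0 M3.
  by rewrite /N in le_xN => *; split; [split|]; apply: le_xN; lra.
have {bounds} [[bM bM1 bM2 bM3 bB] bL] := bounds.
have nR1 : 1 <= n%:R :> R by rewrite ler1n.
have xL : x * L <= 8^-1.
  have : x * (8 * L) <= x * (8 * (L * n%:R)) by rewrite ler_pM2l// ler_pM2l// ler_peMr// ltW.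
  by move=> h; have : x * (8 * L) <= 1 by [apply: le_trans bL]; lra.
have xLn : x * L * n%:R <= 8^-1 by have : x * (8 * (L * n%:R)) = 8 * (x * L * n%:R); [ring|lra].
have vL : normc v * L <= 4^-1 by rewrite -/x; lra.
have vL2 : normc v * L <= 2^-1 by rewrite -/x; lra.
set m := mgen mu L v; have wE : cauchy_transform mu v^-1 = v * m.
  exact: cauchy_transform_inv.
have m_ge : 2^-1 <= normc m by exact: (mgen_half muL).
have m_le : normc m <= 2 by exact: (mgen_le muL).
have m0 : m != 0 by rewrite -normc_gt0; lra.
have gt_inv c d : 0 < d -> x * (c + d) <= 1 -> c < x^-1.
  by move=> d0 h; rewrite -(ltr_pM2l x0) divff ?gt_eqF//; apply: lt_le_trans h; rewrite ltr_pM2l//; lra.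
rewrite wE; set w := v * m; have w0 : w != 0 by rewrite mulf_neq0.
set z0 : R[i] := n%:R / v - n.-1%:R / w.
have nE : n%:R = n.-1%:R + 1 :> R[i] by rewrite -[in LHS](prednK n0) -natr1.
(* [z0] is [1/v] up to a relative error of at most [4 n L x <= 1/2], so it lies where [K1] is
   prescribed. *)
have hz0 : 2^-1 / x <= normc z0.
  have -> : z0 = v^-1 * (1 + n.-1%:R * ((m - 1) / m)).
    by rewrite /z0 /w nE; field; rewrite v0 m0.
  rewrite normcM normcV -/x mulrC ler_pM2l ?invr_gt0//.
  apply: le_trans (lerB_normc _ _); rewrite normc_one.
  suff : normc (n.-1%:R * ((m - 1) / m)) <= 2^-1 by lra.
  rewrite !normcM normcV normc_nat.
  have h1 : normc (m - 1) <= 2 * (L * x) by have := normc_mgen1 muL vL2; rewrite -/m -/x; lra.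
  have h2 : (normc m)^-1 <= 2 by rewrite -[leRHS]invrK lef_pV2 ?posrE//; lra.
  have h3 : normc (m - 1) * (normc m)^-1 <= 2 * (L * x) * 2.
    by rewrite ler_pM ?normc_ge0// invr_ge0 normc_ge0.
  have h4 : (n.-1)%:R <= n%:R :> R by rewrite ler_nat leq_pred.
  have : (n.-1)%:R * (normc (m - 1) * (normc m)^-1) <= n%:R * (2 * (L * x) * 2).
    by rewrite ler_pM// mulr_ge0 ?normc_ge0// invr_ge0 normc_ge0.
  by have -> : n%:R * (2 * (L * x) * 2) = 4 * (x * L * n%:R); [ring|lra].
have ltcn c (z : R[i]) : c < normc z -> c%:C < `|z| by rewrite -(normc_norm z) ltcR.
have K1w : K1 w = z0.
  rewrite -(hK1 z0); last first.
    apply: ltcn; apply: lt_le_trans hz0.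
    by have := gt_inv _ _ _ bM1; have := invr_gt0 x; rewrite x0 => *; lra.
  by rewrite /z0 /w -wE hM.
have K2w : K2 w = v^-1.
  by rewrite -(hK2 v^-1) ?wE//; apply: ltcn; rewrite normcV -/x (gt_inv _ 4).
have nw : normc w = x * normc m by rewrite /w normcM.
have wB : 40 * (normc w * B) <= 1.
  have : normc w * B <= 2 * (x * B).
    by rewrite nw -mulrA mulrCA ler_wpM2r// mulr_ge0 ?ltW.
  lra.
(* [K3] is known only along the transform of [nu']; a large preimage [z'] of [w] is produced, and
   the K-function relation then identifies it. *)
have [z' z'w z'_ge] := cauchy_transform_onto nuB B0 w0 wB.
suff -> : n.+1%:R / v - n%:R / w = z' by [].
rewrite -(hK3 z').
  by rewrite z'w K1w K2w /z0 -natr1 nE; field; rewrite v0 w0.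
apply: ltcn; apply: lt_le_trans z'_ge.
have : normc w <= 2 * x by rewrite nw mulrC ler_wpM2r// ltW.
move=> w2x; have w_gt0 : 0 < normc w by rewrite normc_gt0.
have : (4 * x)^-1 <= (2 * normc w)^-1.
  by rewrite lef_pV2 ?posrE; move: w2x w_gt0 x0; move: (normc w) (x) => p q; lra.
by have := gt_inv _ _ _ bM3; rewrite invfM; lra.
Qed.
End FreeConvolutionGerm.

(** * Continuation along a ray *)

Lemma divdiffB (K : fieldType) (f g : K -> K) l x :
  divdiff (fun y => f y - g y) l x = divdiff f l x - divdiff g l x.
Proof. by elim: l x => [//|a l IH] x /=; rewrite !IH; ring. Qed.

(** A Moebius transformation of [y] has divided differences in closed product form. [resden] is a
    mean of such functions over [tau], with [c = n]. *)
Lemma divdiff_geometric (K : fieldType) (c t tau a x : K) l :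
  uniq [:: x, a & l] -> {in [:: x, a & l], forall y, 1 - tau * y != 0} ->
  divdiff (fun y => (c - t * y) / (1 - tau * y) - (c - 1)) (a :: l) x =
  (c * tau - t) * tau ^+ size l * \prod_(y <- [:: x, a & l]) (1 - tau * y)^-1.
Proof.
elim: l a x => [|b l IH] a x.
  rewrite /= !inE andbT => xa k0; rewrite !big_cons big_nil expr0.
  have x0 : 1 - tau * x != 0 by apply: k0; rewrite mem_head.
  have a0 : 1 - tau * a != 0 by apply: k0; rewrite !inE eqxx orbT.
  by field; rewrite a0 x0 subr_eq0.
move=> u k0; rewrite [LHS]/= -!/(divdiff _ (b :: l) _).
have xu : uniq [:: x, b & l].
  move: u => /=/andP[xabl /and3P[_ bl ul]]; rewrite bl ul !andbT.
  by apply: contra xabl; rewrite !inE => ->; rewrite orbT.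
have au : uniq [:: a, b & l] by case/andP: u.
rewrite !IH//; last 2 first.
- by move=> y ay; apply: k0; rewrite inE ay orbT.
- move=> y; rewrite inE => /orP[yx|ybl]; apply: k0; rewrite !inE ?yx//.
  by move: ybl; rewrite inE => ->; rewrite !orbT.
rewrite !big_cons [size (b :: l)]/= exprS.
have x0 : 1 - tau * x != 0 by apply: k0; rewrite mem_head.
have a0 : 1 - tau * a != 0 by apply: k0; rewrite !inE eqxx orbT.
have b0 : 1 - tau * b != 0 by apply: k0; rewrite !inE eqxx !orbT.
have xa : x - a != 0.
  by rewrite subr_eq0; move: u; rewrite cons_uniq inE negb_or => /andP[/andP[]].
by field; rewrite xa x0 a0 b0.
Qed.

Section Continuation.
Variables (R : realType) (mu nu : probR R) (L B : R) (n : nat).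
Hypotheses (muL : supported_on mu L) (L0 : 0 < L).
Hypotheses (nuB : supported_on nu B) (B0 : 0 < B).
Let D : set (measurableTypeR R) := `[- L, L]%classic.
Let mD : measurable D := measurable_segment L.
Let E : set (measurableTypeR R) := `[- B, B]%classic.
Let mE : measurable E := measurable_segment B.

(* With [v = 1/z] this is the point [n z - (n-1) / G_mu(z)], which the Cauchy
   transform of [nu] maps to [G_mu(z)]. *)
Definition kfun (v : R[i]) : R[i] := n%:R / v - n.-1%:R / (v * mgen mu L v).

(* [(v * mgen v) * (kfun v - t)], whose divided differences, unlike those of
   [kfun], are bounded up to [v = 0]. *)
Definition resden (t : R) (v : R[i]) : R[i] :=
  n%:R * mgen mu L v - n.-1%:R - t%:C * v * mgen mu L v.

Hypothesis n0 : (0 < n)%N.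

Let nE : n%:R = n.-1%:R + 1 :> R[i].
Proof. by rewrite -[in LHS](prednK n0) -natr1. Qed.

Lemma resdenE t v : v != 0 -> normc v * L <= 4^-1 ->
  resden t v = v * mgen mu L v * (kfun v - t%:C).
Proof.
move=> v0 vL; have m0 : mgen mu L v != 0.
  by rewrite -normc_gt0; have := mgen_half muL vL; lra.
by rewrite /resden /kfun; field; rewrite v0 m0.
Qed.

Lemma resden_cmean t v : normc v * L <= 2^-1 -> resden t v =
  cmean mu D (fun tau : measurableTypeR R =>
    (n%:R - t%:C * v) / (1 - (tau : R)%:C * v) - (n%:R - 1)).
Proof.
move=> vL; have bK := cbmeas_onemV vL.
rewrite cmeanB//; [|by apply: cbmeasM => //; exact: cbmeas_cst|exact: cbmeas_cst].
by rewrite cmeanZ// (cmean_cst mD muL) -/(mgen mu L v) /resden nE; ring.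
Qed.

(** In the closed form, each of the [size l + 2] inverse factors is at most 2, the power of [tau] is
    at most [L ^ size l], and [n tau - t] is at most [n L + B]. The bound is arranged as [A * r ^ k]
    to feed the reciprocal estimate. *)
Lemma divdiff_resden t a l x : `|t| <= B ->
  (forall y, y \in [:: x, a & l] -> normc y * L <= 2^-1) -> uniq [:: x, a & l] ->
  normc (divdiff (resden t) (a :: l) x) <=
  2 * (n%:R * L + B) / L * (2 * L) ^+ (size l).+1.
Proof.
move=> tB yL u.
pose q (tau : measurableTypeR R) (v : R[i]) : R[i] :=
  (n%:R - t%:C * v) / (1 - (tau : R)%:C * v) - (n%:R - 1).
have bq y : y \in [:: x, a & l] -> cbmeas D (q^~ y).
  move=> /yL h; apply: cbmeasB => //; last exact: cbmeas_cst.
  by apply: cbmeasM => //; [exact: cbmeas_cst|exact: cbmeas_onemV].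
rewrite (@eq_divdiff _ _ (fun v => cmean mu D (q^~ v))); last first.
  by move=> y /yL h; exact: resden_cmean.
rewrite divdiff_cmean//; apply: (normc_cmean_bound mD muL); first exact: cbmeas_divdiff.
move=> tau /segment_norm tauL.
rewrite divdiff_geometric//; last by move=> y /yL h; exact: onem_neq0 h.
have hprod (s : seq R[i]) : (forall y, y \in s -> normc y * L <= 2^-1) ->
    normc (\prod_(y <- s) (1 - (tau : R)%:C * y)^-1) <= 2 ^+ size s.
  elim: s => [|y s IH] h; first by rewrite big_nil normc_one.
  rewrite big_cons normcM exprS ler_pM ?normc_ge0//.
    exact: (normc_onemV tauL (h y (mem_head _ _))).
  by apply: IH => z zs; rewrite h// inE zs orbT.
have h1 : normc (n%:R * (tau : R)%:C - t%:C) <= n%:R * L + B.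
  apply: le_trans (lenormcB _ _) _; rewrite normcM normc_nat !normc_real.
  by rewrite lerD// ler_wpM2l.
have h2 : normc ((tau : R)%:C ^+ size l) <= L ^+ size l.
  by rewrite normcX normc_real lerXn2r// nnegrE// ltW.
have -> : 2 * (n%:R * L + B) / L * (2 * L) ^+ (size l).+1 =
    (n%:R * L + B) * L ^+ size l * 2 ^+ (size l).+2.
  by rewrite exprMn !exprS; field; rewrite gt_eqF.
rewrite normcM [normc (_ * _ ^+ _)]normcM.
by rewrite ler_pM ?mulr_ge0 ?normc_ge0 ?hprod// ler_pM ?normc_ge0.
Qed.

Variable v : R[i].
Hypotheses (v0 : v != 0) (vL : normc v * L <= 4^-1).
Variable eta : R.
Hypothesis eta0 : 0 < eta.
Hypothesis kfun_eta : forall s : R, 0 < s <= 1 -> eta <= complex.Im (kfun (s%:C * v)).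

Let ray (s : R) : R[i] := s%:C * v.
(** On the segment, [J u] is the quotient of the transform of [nu] at [kfun u] by [u * mgen mu L u],
    so the equation to be continued is [J = 1]. *)
Let J (u : R[i]) := cmean nu E (fun t : measurableTypeR R => (resden t u)^-1).

Let ray_neq0 s : 0 < s -> ray s != 0.
Proof. by move=> s0; rewrite mulf_neq0// -normc_eq0 normc_real normr_eq0 gt_eqF. Qed.

Let normc_ray s : 0 < s -> normc (ray s) = s * normc v.
Proof. by move=> s0; rewrite normcM normc_real gtr0_norm. Qed.

Let ray_le s : 0 < s <= 1 -> normc (ray s) * L <= 4^-1.
Proof.
move=> /andP[s0 s1]; rewrite normc_ray//; apply: le_trans vL.
by rewrite -mulrA ler_piMl// mulr_ge0 ?normc_ge0// ltW.
Qed.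

Let ray_le2 s : 0 < s <= 1 -> normc (ray s) * L <= 2^-1.
Proof. by move=> /ray_le; lra. Qed.

Let eta_le s t : 0 < s <= 1 -> eta <= normc (kfun (ray s) - t%:C).
Proof.
move=> s01; apply: le_trans (kfun_eta s01) _; apply: le_trans (ler_norm _) _.
apply: le_trans (Im_le_normc _).
by rewrite [in leRHS]ImD [in leRHS]ImN/= oppr0 addr0.
Qed.

Let resden_ge s t : 0 < s <= 1 -> s * normc v / 2 * eta <= normc (resden t (ray s)).
Proof.
move=> s01; have /andP[s0 s1] := s01.
rewrite resdenE ?ray_neq0 ?ray_le// !normcM normc_real gtr0_norm//.
rewrite ler_pM ?mulr_ge0 ?invr_ge0 ?normc_ge0 ?eta_le//; [exact: ltW..| |].
  by rewrite ltW.
by rewrite ler_pM2l ?(mgen_half muL) ?ray_le// mulr_gt0// normc_gt0.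
Qed.

Let cbmeas_resden s : 0 < s <= 1 ->
  cbmeas E (fun t : measurableTypeR R => (resden t (ray s))^-1).
Proof.
move=> s01; have /andP[s0 s1] := s01.
apply: (cbmeasV (d := s * normc v / 2 * eta)) => //; last 2 first.
- by rewrite !mulr_gt0 ?normc_gt0.
- by move=> t _; exact: resden_ge.
apply: cbmeasB => //; first exact: cbmeas_cst.
apply: cbmeasM => //; last exact: cbmeas_cst.
by apply: cbmeasM => //; [apply: cbmeas_real; exact: bmeas_id|exact: cbmeas_cst].
Qed.

Lemma cauchy_transform_kfunE s : 0 < s <= 1 ->
  cauchy_transform nu (kfun (ray s)) = ray s * mgen mu L (ray s) * J (ray s).
Proof.
move=> s01; have /andP[s0 s1] := s01.
rewrite (cauchy_transformE mE nuB) -(cmeanZ mE nuB); last exact: cbmeas_resden.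
apply: eq_cmean => t _; rewrite resdenE ?ray_neq0 ?ray_le//.
have m0 : mgen mu L (ray s) != 0.
  by rewrite -normc_gt0; have := mgen_half muL (ray_le s01); lra.
have z0 : kfun (ray s) - (t : R)%:C != 0.
  by rewrite -normc_gt0; exact: lt_le_trans eta0 (eta_le _ s01).
by field; rewrite z0 m0 ray_neq0.
Qed.

Let J_eq1_small : (exists M : R, forall u : R[i], u != 0 -> normc u * M <= 1 ->
    cauchy_transform nu (n%:R / u - n.-1%:R / cauchy_transform mu u^-1) =
    cauchy_transform mu u^-1) ->
  exists2 a, 0 < a <= 1 & forall s, 0 < s <= a -> J (ray s) = 1.
Proof.
move=> [M hM]; pose a := (1 + `|M| * normc v)^-1.
have d1 : 1 <= 1 + `|M| * normc v by rewrite lerDl mulr_ge0 ?normc_ge0.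
have a1 : 0 < a <= 1 by rewrite invr_gt0 invf_le1 ?d1 ?andbT; lra.
exists a => // s /andP[s0 sa]; have s01 : 0 < s <= 1.
  by rewrite s0/=; apply: le_trans sa _; case/andP: a1.
have m0 : mgen mu L (ray s) != 0.
  by rewrite -normc_gt0; have := mgen_half muL (ray_le s01); lra.
have := hM _ (ray_neq0 s0); rewrite normc_ray// (cauchy_transform_inv muL).
- move=> h; have {h} := h _; rewrite -/(kfun _) cauchy_transform_kfunE// => h.
  have vm0 : ray s * mgen mu L (ray s) != 0 by rewrite mulf_neq0// ray_neq0.
  apply: (mulfI vm0); rewrite mulr1; apply: h.
  have : s * (1 + `|M| * normc v) <= 1.
    by move: sa; rewrite /a -ler_pdivlMr ?div1r//; lra.
  have : s * normc v * M <= s * normc v * `|M|.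
    by rewrite ler_wpM2l ?ler_norm// mulr_ge0 ?normc_ge0 ?ltW.
  by lra.
- exact: ray_neq0.
- exact: ray_le2.
Qed.

(** [d] bounds [resden] from below at every parameter at least [a], so [M], and with it the
    admissible step [c], is independent of the point [b] already reached. *)
Let J_eq1_step (a d M : R) : 0 < a -> d = a * normc v / 2 * eta ->
  M = 2 * L * (1 + 2 * (n%:R * L + B) / L / d) ->
  forall b c s, a <= b < s -> s <= 1 -> 0 < c -> s - b <= c -> c <= b - a ->
  4 * c * normc v * M <= 1 ->
  (forall s', a <= s' <= b -> J (ray s') = 1) -> J (ray s) = 1.
Proof.
move=> a0 dE ME b c s /andP[ab bs] s1 c0 sbc cba cM J1.
have nv0 : 0 < normc v by rewrite normc_gt0.
have d0 : 0 < d by rewrite dE !mulr_gt0// invr_gt0.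
have A0 : 0 <= 2 * (n%:R * L + B) / L.
  by rewrite divr_ge0 ?mulr_ge0 ?addr_ge0 ?mulr_ge0// ltW.
have r0 : 0 < 2 * L by rewrite mulr_gt0.
have M0 : 0 < M.
  by rewrite ME mulr_gt0// ltr_wpDr// divr_ge0// ltW.
pose U u := exists2 s', a <= s' <= 1 & u = ray s'.
(* [J - 1] vanishes at the [N+1] nodes below, all within [2 c] of [s], so Newton's
   form of the interpolation remainder applies. *)
have bound N : normc (J (ray s) - 1) <= d^-1 * 2^-1 ^+ N.+1.
  pose node (i : nat) := ray (b - c * (i%:R / N.+1%:R)).
  pose l := [seq node i | i <- iota 0 N.+1].
  have nodeP i : (i < N.+1)%N -> exists s', [/\ a <= s' <= b, s - s' <= 2 * c &
      node i = ray s'].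
    move=> iN; have : 0 <= c * (i%:R / N.+1%:R) <= c.
      rewrite mulr_ge0 ?divr_ge0 ?(ltW c0)//= ler_piMr ?(ltW c0)//.
      by rewrite ler_pdivrMr// mul1r ler_nat ltnW.
    rewrite /node; set q := c * _ => /andP[? ?].
    by exists (b - q); split=> //; [apply/andP|]; lra.
  have lP y : y \in l -> exists s', [/\ a <= s' <= b, s - s' <= 2 * c & y = ray s'].
    by move=> /mapP [k]; rewrite mem_iota => /andP[_ /nodeP h] ->.
  have ray_inj : injective ray.
    move=> p q /(mulIf v0) /complexI; exact.
  have ul : uniq (ray s :: l).
    rewrite cons_uniq map_inj_uniq ?iota_uniq ?andbT.
      by apply/negP => rl; have [s' [/andP[_ s'b] _ /ray_inj e]] := lP _ rl; lra.
    move=> i j /ray_inj/addrI/oppr_inj/(mulfI (lt0r_neq0 c0)) e.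
    apply/eqP; rewrite -(eqr_nat R); apply/eqP; apply: mulIf e.
    by rewrite invr_neq0.
  have lU y : y \in ray s :: l -> U y.
    rewrite inE => /orP[/eqP->|yl]; first by exists s => //; lra.
    by have [s' [/andP[? ?] _ ->]] := lP _ yl; exists s' => //; lra.
  have UP u : U u -> exists2 s', 0 < s' <= 1 & u = ray s'.
    by move=> [s' /andP[? ?] ->]; exists s' => //; lra.
  have bQ y : y \in ray s :: l ->
      cbmeas E (fun t : measurableTypeR R => (resden t y)^-1).
    by move=> /lU/UP[s' s'01 ->]; exact: cbmeas_resden.
  have size_l : size l = N.+1 by rewrite size_map size_iota.
  have dd : normc (divdiff J l (ray s)) <= d^-1 * M ^+ N.+1.
    rewrite /J (@divdiff_cmean _ nu _ mE nuB (fun t u => (resden t u)^-1))//.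
    apply: (normc_cmean_bound mE nuB) => [|t /segment_norm tB].
      exact: (@cbmeas_divdiff _ _ (fun t u => (resden t u)^-1)).
    rewrite -size_l ME; apply: (divdiff_inv_bound (U := U)) => //.
    - move=> u [s' /andP[as' s'1] ->]; have s'01 : 0 < s' <= 1 by lra.
      apply: le_trans (resden_ge t s'01).
      by rewrite dE ler_pM2r// ler_pM2r ?invr_gt0// ler_pM2r.
    - move=> y k x hU; apply: divdiff_resden => // z /hU/UP[s' s'01 ->].
      exact: ray_le2.
  have := @divdiff_newton _ (fun u => J u - 1) l (ray s) ul.
  rewrite divdiffB; have -> : divdiff (fun=> 1) l (ray s) = 0 :> R[i].
    by move: size_l; case: (l) => // y k _; exact: divdiff_cst.
  rewrite subr0 => ->; last first.
    by move=> y yl; have [s' [? _ ->]] := lP _ yl; rewrite J1 ?subrr.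
  rewrite normcM.
  have prod_le : normc (\prod_(y <- l) (ray s - y)) <= (2 * c * normc v) ^+ N.+1.
    rewrite -size_l; elim: (l) lP => [|y k IH] kP.
      by rewrite big_nil normc_one.
    rewrite big_cons normcM exprS ler_pM ?normc_ge0//; last first.
      by apply: IH => z zk; apply: kP; rewrite inE zk orbT.
    have [s' [/andP[_ ?] ? ->]] := kP y (mem_head _ _).
    rewrite /ray -mulrBl -(rmorphB (real_complex R)) normcM normc_real.
    by rewrite ler_wpM2r ?normc_ge0// ger0_norm; lra.
  apply: le_trans (ler_pM (normc_ge0 _) (normc_ge0 _) prod_le dd) _.
  rewrite mulrCA -exprMn ler_pM2l ?invr_gt0// lerXn2r ?nnegrE ?invr_ge0//.
    by rewrite !mulr_ge0 ?normc_ge0// ltW.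
  by lra.
apply/eqP; rewrite -subr_eq0 -normc_eq0 eq_le normc_ge0 andbT.
rewrite leNgt; apply/negP => h.
have [N hN] : exists N : nat, d^-1 * 2^-1 ^+ N < normc (J (ray s) - 1).
  have h' : 0 < d * normc (J (ray s) - 1) by rewrite mulr_gt0.
  have /cvgrPdist_lt/(_ _ h')[N _ hN] : (fun k => 2^-1 ^+ k : R) @ \oo --> (0 : R).
    by apply: cvg_expr; rewrite ger0_norm ?invr_ge0// invf_lt1 ?ltr1n.
  exists N; rewrite mulrC ltr_pdivrMr// mulrC.
  by have /= := hN N (leqnn N); rewrite sub0r normrN ger0_norm// exprn_ge0// invr_ge0.
have := bound N; rewrite exprS.
have : 0 <= d^-1 * 2^-1 ^+ N by rewrite mulr_ge0 ?invr_ge0 ?exprn_ge0 ?invr_ge0// ltW.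
by nra.
Qed.

Lemma cauchy_transform_kfun : is_free_conv_pow mu n nu ->
  cauchy_transform nu (kfun v) = v * mgen mu L v.
Proof.
move=> /(free_conv_pow_germ muL L0)[_ _ /J_eq1_small[a /andP[a0 a1] Ja]].
have rv : ray 1 = v by rewrite /ray mul1r.
suff J1 : J (ray 1) = 1.
  by rewrite -rv cauchy_transform_kfunE ?J1 ?mulr1// ltr01 lexx.
have nv0 : 0 < normc v by rewrite normc_gt0.
(* Halving [a] leaves an interval of length at least [c] behind the first endpoint, in which the
   interpolation nodes fit. *)
pose a2 := a / 2; pose d := a2 * normc v / 2 * eta.
pose M := 2 * L * (1 + 2 * (n%:R * L + B) / L / d).
have a20 : 0 < a2 by rewrite divr_gt0.
have d0 : 0 < d by rewrite !mulr_gt0// invr_gt0.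
have M0 : 0 < M.
  rewrite !mulr_gt0// ltr_wpDr// !divr_ge0 ?mulr_ge0 ?addr_ge0 ?mulr_ge0//; exact: ltW.
pose c := Num.min (4 * normc v * M)^-1 a2.
have cM : 4 * c * normc v * M <= 1.
  have D0 : 0 < 4 * normc v * M by rewrite mulr_gt0// mulr_gt0.
  have h : c <= 1 / (4 * normc v * M) by rewrite /c ge_min div1r lexx.
  move: h; rewrite ler_pdivlMr// => h; apply: le_trans h.
  by rewrite le_eqVlt; apply/orP; left; apply/eqP; ring.
have c0 : 0 < c by rewrite /c lt_min a20 invr_gt0 mulr_gt0// mulr_gt0.
have ca2 : c <= a2 by rewrite /c ge_min lexx orbT.
have claim k s : a2 <= s <= 1 -> s <= a + c *+ k -> J (ray s) = 1.
  elim: k s => [|k IH] s /andP[as_ s1] sk.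
    by apply: Ja; rewrite (lt_le_trans a20)//=; move: sk; rewrite mulr0n addr0.
  have [sk'|sk'] := leP s (a + c *+ k); first by apply: IH => //; rewrite as_.
  have ck0 : 0 <= c *+ k by rewrite mulrn_wge0// ltW.
  apply: (J_eq1_step a20 (erefl d) (erefl M) (b := a + c *+ k) (c := c)) => //.
  - by rewrite sk' andbT /a2; lra.
  - by move: sk; rewrite mulrSr; lra.
  - by rewrite /a2 in ca2 *; lra.
  - by move=> s' /andP[h1 h2]; apply: IH => //; rewrite h1; lra.
have [k hk] : exists k : nat, 1 <= c *+ k.
  exists (Num.bound c^-1); have := archi_boundP (_ : 0 <= c^-1).
  rewrite invr_ge0 ltW// => /(_ isT) h.
  by rewrite -mulr_natr -ler_pdivrMl// mulr1 ltW.
by apply: (claim k); rewrite ?lexx ?andbT /a2; lra.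
Qed.

End Continuation.

(** * The rescaled K-function *)

Section ScaledKernel.
Variables (R : realType) (mu : probR R) (L : R) (n : nat).
Hypotheses (muL : supported_on mu L) (L1 : 1 <= L).
Let D : set (measurableTypeR R) := `[- L, L]%classic.
Let mD : measurable D := measurable_segment L.
Hypotheses (Et : mean mu D (fun t => t) = 0)
  (Et2 : mean mu D (fun t => (t : R) ^+ 2) = 1).
Variable c : R.
Hypotheses (c0 : 0 < c) (cn : c ^+ 2 * n%:R = 1).
Let kap := L * c.
Hypothesis kap_small : kap <= 1000^-1.

(** The second-order Taylor remainder of the moment generating function, divided by [(c w)^2]; the
    unit variance gives it the value 1 at 0. *)
Definition beta (w : R[i]) : R[i] := cmean mu D
  (fun t : measurableTypeR R => (t : R)%:C ^+ 2 * (1 - (t : R)%:C * (c%:C * w))^-1).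

Let kap0 : 0 < kap.
Proof. by apply: mulr_gt0 => //; exact: lt_le_trans ltr01 L1. Qed.

Let n0 : (0 < n)%N.
Proof. by rewrite lt0n; apply/eqP => n0; move: cn; rewrite n0 mulr0; lra. Qed.

Let c2_kap : c ^+ 2 <= kap.
Proof.
have h : c <= kap by rewrite /kap ler_peMl// ltW.
have h1 : c <= 1 by apply: le_trans h _; have := kap_small; lra.
by rewrite expr2 -[leRHS]mulr1 ler_pM// ltW.
Qed.

Let cwL w : normc w <= 1 -> normc (c%:C * w) * L <= 1000^-1.
Proof.
move=> w1; rewrite normcM normc_real gtr0_norm//; apply: le_trans kap_small.
rewrite /kap [leRHS]mulrC ler_wpM2r//; first exact: le_trans ler01 L1.
by rewrite ler_piMr// ltW.
Qed.

Let cwL2 w : normc w <= 1 -> normc (c%:C * w) * L <= 2^-1.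
Proof. by move=> /cwL; lra. Qed.

Let cbmeas_t : cbmeas D (fun t : measurableTypeR R => (t : R)%:C).
Proof. by apply: cbmeas_real; exact: bmeas_id. Qed.

Let bmeas_t2 : bmeas D (fun t : measurableTypeR R => (t : R) ^+ 2).
Proof. by under eq_fun do rewrite expr2; apply: bmeasM => //; exact: bmeas_id. Qed.

Let cbmeas_beta w : normc w <= 1 -> cbmeas D
  (fun t : measurableTypeR R => (t : R)%:C ^+ 2 * (1 - (t : R)%:C * (c%:C * w))^-1).
Proof.
by move=> w1; apply: cbmeasM => //; [exact: cbmeasX|exact: cbmeas_onemV (cwL2 w1)].
Qed.

Let cmean_real f : cmean mu D (fun t : measurableTypeR R => (f t)%:C) = (mean mu D f)%:C.
Proof. by apply: eq_complexP => //=; exact: (mean_cst mD muL). Qed.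

Lemma mgenE w : normc w <= 1 ->
  mgen mu L (c%:C * w) = 1 + c%:C ^+ 2 * w ^+ 2 * beta w.
Proof.
move=> w1; have bb := cbmeas_beta w1.
have e1 : cmean mu D (fun t : measurableTypeR R => 1 + (c%:C * w) * (t : R)%:C) = 1.
  rewrite cmeanD//; [|exact: cbmeas_cst|by apply: cbmeasM => //; exact: cbmeas_cst].
  by rewrite (cmean_cst mD muL) cmeanZ// cmean_real Et mulr0 addr0.
rewrite /mgen /beta -(cmeanZ mD muL)// -[X in _ = X + _]e1 -(cmeanD mD muL).
- apply: eq_cmean => t /segment_norm tL; field.
  exact: onem_neq0 (cwL2 w1).
- by apply: cbmeasD; [exact: cbmeas_cst|apply: cbmeasM => //; exact: cbmeas_cst].
- by apply: cbmeasM => //; exact: cbmeas_cst.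
Qed.

(** Averaging the weight [t ^ 2], whose mean is 1, rather than bounding it by [L ^ 2] keeps the
    errors linear in [L c]. *)
Let le_cmean_sqr F k : cbmeas D F ->
  (forall t : measurableTypeR R, D t -> normc (F t) <= k * (t : R) ^+ 2) ->
  normc (cmean mu D F) <= k.
Proof.
move=> bF hF; rewrite -[leRHS]mulr1 -Et2 -meanZ//.
by apply: (normc_cmean_le mD muL) => //; apply: bmeasM => //; exact: bmeas_cst.
Qed.

Let kerB t w w' : D t -> normc w <= 1 -> normc w' <= 1 ->
  normc ((1 - t%:C * (c%:C * w))^-1 - (1 - t%:C * (c%:C * w'))^-1) <=
  4 * kap * normc (w - w').
Proof.
move=> Dt w1 w1'; have tL := segment_norm Dt.
have h := onem_neq0 tL (cwL2 w1); have h' := onem_neq0 tL (cwL2 w1').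
have -> : (1 - t%:C * (c%:C * w))^-1 - (1 - t%:C * (c%:C * w'))^-1 =
    (t%:C * c%:C) * (w - w') *
    ((1 - t%:C * (c%:C * w))^-1 * (1 - t%:C * (c%:C * w'))^-1).
  by field; rewrite h h'.
have k1 := normc_onemV tL (cwL2 w1); have k2 := normc_onemV tL (cwL2 w1').
rewrite normcM [normc (_^-1 * _)]normcM [normc (_ * (w - w'))]normcM.
rewrite [normc (t%:C * _)]normcM !normc_real (gtr0_norm c0).
have k12 : normc (1 - t%:C * (c%:C * w))^-1 * normc (1 - t%:C * (c%:C * w'))^-1 <= 2 * 2.
  by rewrite ler_pM ?normc_ge0.
have -> : 4 * kap * normc (w - w') = kap * normc (w - w') * (2 * 2) by ring.
rewrite ler_pM ?mulr_ge0 ?normc_ge0//; first exact: ltW.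
by rewrite ler_wpM2r ?normc_ge0// /kap ler_pM2r.
Qed.

Lemma beta_dist w w' : normc w <= 1 -> normc w' <= 1 ->
  normc (beta w - beta w') <= 4 * kap * normc (w - w').
Proof.
move=> w1 w1'; rewrite /beta -(cmeanB mD muL); [|exact: cbmeas_beta..].
apply: le_cmean_sqr => [|t Dt]; first by apply: cbmeasB; exact: cbmeas_beta.
rewrite -mulrBr normcM normcX normc_real real_normK ?num_real//.
by rewrite mulrC ler_wpM2r ?sqr_ge0// kerB.
Qed.

Lemma beta0 : beta 0 = 1.
Proof.
rewrite /beta -[1 in RHS]/(1%:C) -Et2 -cmean_real; apply: eq_cmean => t _.
by rewrite !mulr0 subr0 invr1 mulr1 rmorphXn.
Qed.

Lemma beta_dist1 w : normc w <= 1 -> normc (beta w - 1) <= 4 * kap * normc w.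
Proof.
move=> w1; rewrite -beta0; apply: le_trans (beta_dist w1 _) _.
  by rewrite normc_zero.
by rewrite subr0.
Qed.

Lemma beta_le2 w : normc w <= 1 -> normc (beta w) <= 2.
Proof.
move=> w1; have := beta_dist1 w1; have := lenormcD (beta w - 1) 1.
rewrite subrK normc_one; have : kap * normc w <= 1000^-1 * 1.
  by rewrite ler_pM// ?normc_ge0// ltW.
by lra.
Qed.

(** The value of [mgen mu L] at [c w] on the unit disc; the resolvent of the normalized measure at
    [zeta w] will be [w * qden w]. *)
Definition qden (w : R[i]) := 1 + c%:C ^+ 2 * w ^+ 2 * beta w.

Let sqb_dist w w' : normc w <= 1 -> normc w' <= 1 ->
  normc (w ^+ 2 * beta w - w' ^+ 2 * beta w') <= 5 * normc (w - w').
Proof.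
move=> w1 w1'.
have -> : w ^+ 2 * beta w - w' ^+ 2 * beta w' =
    (w - w') * ((w + w') * beta w) + w' ^+ 2 * (beta w - beta w') by ring.
apply: le_trans (lenormcD _ _) _; rewrite !normcM.
have h1 : normc (w + w') * normc (beta w) <= 2 * 2.
  by rewrite ler_pM ?normc_ge0 ?beta_le2//; have := lenormcD w w'; lra.
have h2 := beta_dist w1 w1'.
have h3 : normc w' * normc w' <= 1 * 1 by rewrite ler_pM ?normc_ge0.
have h4 : normc w' * normc w' * normc (beta w - beta w') <= 1 * 1 * (4 * kap * normc (w - w')).
  by rewrite ler_pM ?mulr_ge0 ?normc_ge0.
have h5 : normc (w - w') * (normc (w + w') * normc (beta w)) <= normc (w - w') * (2 * 2).
  by rewrite ler_wpM2l ?normc_ge0.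
have h6 : kap * normc (w - w') <= 1000^-1 * normc (w - w').
  by rewrite ler_wpM2r ?normc_ge0.
by have := normc_ge0 (w - w'); lra.
Qed.

Let normc_c2 : normc (c%:C ^+ 2) = c ^+ 2.
Proof. by rewrite normcX normc_real gtr0_norm. Qed.

Lemma qden_dist w w' : normc w <= 1 -> normc w' <= 1 ->
  normc (qden w - qden w') <= 5 * kap * normc (w - w').
Proof.
move=> w1 w1'; have -> : qden w - qden w' =
  c%:C ^+ 2 * (w ^+ 2 * beta w - w' ^+ 2 * beta w') by rewrite /qden; ring.
rewrite normcM normc_c2 (_ : 5 * kap * _ = kap * (5 * normc (w - w'))); last by ring.
by apply: ler_pM; [exact: sqr_ge0|exact: normc_ge0|exact: c2_kap|exact: sqb_dist].
Qed.

Lemma qden_dist1 w : normc w <= 1 -> normc (qden w - 1) <= 2 * kap * normc w ^+ 2.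
Proof.
move=> w1; have -> : qden w - 1 = c%:C ^+ 2 * (w ^+ 2 * beta w) by rewrite /qden; ring.
rewrite normcM normc_c2 normcM normcX.
have h : normc w ^+ 2 * normc (beta w) <= normc w ^+ 2 * 2.
  by rewrite ler_wpM2l ?sqr_ge0 ?beta_le2.
have : c ^+ 2 * (normc w ^+ 2 * normc (beta w)) <= kap * (normc w ^+ 2 * 2).
  by rewrite ler_pM ?sqr_ge0// mulr_ge0 ?sqr_ge0 ?normc_ge0.
by lra.
Qed.

Lemma qden_bounds w : normc w <= 1 -> 2^-1 <= normc (qden w) <= 2.
Proof.
move=> w1; have := qden_dist1 w1; have := lenormcD (qden w - 1) 1.
have := lerB_normc 1 (qden w - 1); rewrite subrK addrCA subrr addr0 normc_one.
have : kap * normc w ^+ 2 <= 1000^-1 * 1.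
  by rewrite ler_pM ?sqr_ge0 ?(ltW kap0)// expr_le1// normc_ge0.
by move=> *; apply/andP; lra.
Qed.

Lemma qden_neq0 w : normc w <= 1 -> qden w != 0.
Proof. by move=> /qden_bounds/andP[h _]; rewrite -normc_gt0; lra. Qed.

(** With [c^2 n = 1], [zeta w] equals [(1 + w^2 beta w) / (w qden w)]; subtracting [1/w + w] leaves
    [w gnum w / qden w]. Both terms of [gnum] are close to 1, whence its size [O(kap)]. *)
Definition gnum (w : R[i]) := (1 - c%:C ^+ 2) * beta w - qden w.

Definition kerr (w : R[i]) := w * gnum w / qden w.

Let normc_onec2 : normc (1 - c%:C ^+ 2) <= 1.
Proof.
rewrite -(rmorphXn (real_complex R)) -(rmorph1 (real_complex R)) -rmorphB normc_real.
by rewrite ger0_norm; have := sqr_ge0 c; have := c2_kap; have := kap_small; lra.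
Qed.

Lemma gnum_dist w w' : normc w <= 1 -> normc w' <= 1 ->
  normc (gnum w - gnum w') <= 9 * kap * normc (w - w').
Proof.
move=> w1 w1'; have -> : gnum w - gnum w' =
  (1 - c%:C ^+ 2) * (beta w - beta w') - (qden w - qden w') by rewrite /gnum; ring.
apply: le_trans (lenormcB _ _) _; rewrite normcM.
have h1 := qden_dist w1 w1'; have h2 := beta_dist w1 w1'.
have : normc (1 - c%:C ^+ 2) * normc (beta w - beta w') <= 1 * (4 * kap * normc (w - w')).
  by rewrite ler_pM ?normc_ge0.
by lra.
Qed.

Lemma gnum_le w : normc w <= 1 -> normc (gnum w) <= 10 * kap.
Proof.
move=> w1; have := gnum_dist w1 (_ : normc 0 <= 1).
rewrite normc_zero => /(_ ler01) h.
have g0 : gnum 0 = - c%:C ^+ 2 by rewrite /gnum /qden beta0 expr0n/=; ring.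
have := lenormcD (gnum w - gnum 0) (gnum 0); rewrite subrK g0 normc_opp normc_c2.
move: h; rewrite subr0 g0.
have : kap * normc w <= kap * 1 by rewrite ler_wpM2l// ltW.
by have := c2_kap; lra.
Qed.

Lemma kerr0 : kerr 0 = 0.
Proof. by rewrite /kerr !mul0r. Qed.

(** A Lipschitz bound is stronger than a bound on the size: it serves for the pair [w], [w^*], for
    steps along a ray, and for comparing two radii. *)
Lemma kerr_dist w w' : normc w <= 1 -> normc w' <= 1 ->
  normc (kerr w - kerr w') <= 200 * kap * normc (w - w').
Proof.
move=> w1 w1'; have /andP[q1 q2] := qden_bounds w1; have /andP[q1' q2'] := qden_bounds w1'.
have -> : kerr w - kerr w' = ((w - w') * gnum w * qden w' +
    w' * ((gnum w - gnum w') * qden w' - gnum w' * (qden w - qden w'))) /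
    (qden w * qden w').
  by rewrite /kerr; field; rewrite !qden_neq0.
rewrite normcM normcV normcM.
set d := normc (w - w'); have d0 : 0 <= d by exact: normc_ge0.
have hV : (normc (qden w) * normc (qden w'))^-1 <= 4.
  rewrite -[leRHS]invrK lef_pV2 ?posrE ?invr_gt0//; last by rewrite mulr_gt0; lra.
  have : 2^-1 * 2^-1 <= normc (qden w) * normc (qden w') by rewrite ler_pM.
  by lra.
have e1 : normc ((w - w') * gnum w * qden w') <= d * (10 * kap) * 2.
  by rewrite !normcM ler_pM ?mulr_ge0 ?normc_ge0// ler_wpM2l ?gnum_le.
have e2 : normc ((gnum w - gnum w') * qden w') <= 9 * kap * d * 2.
  by rewrite normcM ler_pM ?normc_ge0// gnum_dist.
have e3 : normc (gnum w' * (qden w - qden w')) <= 1 * (5 * kap * d).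
  rewrite normcM ler_pM ?normc_ge0 ?qden_dist//.
  by apply: le_trans (gnum_le w1') _; have := kap_small; lra.
have e4 : normc (w' * ((gnum w - gnum w') * qden w' - gnum w' * (qden w - qden w'))) <=
    1 * (23 * kap * d).
  rewrite normcM ler_pM ?normc_ge0//; apply: le_trans (lenormcB _ _) _; lra.
have e5 := lenormcD ((w - w') * gnum w * qden w')
  (w' * ((gnum w - gnum w') * qden w' - gnum w' * (qden w - qden w'))).
(* The numerator is at most [(20 + 23) kap d], and the inverse of the denominator at most 4. *)
have -> : 200 * kap * d = 50 * kap * d * 4 by ring.
rewrite ler_pM ?normc_ge0// ?invr_ge0 ?mulr_ge0 ?normc_ge0//.
have : 0 <= kap * d by rewrite mulr_ge0// ltW.
by lra.
Qed.

Lemma kerr_le w : normc w <= 1 -> normc (kerr w) <= 200 * kap * normc w.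
Proof.
move=> w1; have := kerr_dist w1 (_ : normc 0 <= 1).
by rewrite normc_zero kerr0 !subr0; apply.
Qed.

(* In the variable [w], with [v = c w] and [c = n^(-1/2)], the function [kfun] is a
   perturbation of the K-function [w^-1 + w] of the semicircle law. *)
Definition zeta (w : R[i]) : R[i] := c%:C * kfun mu L n (c%:C * w).

Lemma zetaE w : w != 0 -> normc w <= 1 -> zeta w = w^-1 + w + kerr w.
Proof.
move=> w0 w1; rewrite /zeta /kfun mgenE// -/(qden w).
have cC0 : c%:C != 0 :> R[i] by rewrite -normc_eq0 normc_real normr_eq0 gt_eqF.
have nE : n%:R = c%:C ^- 2 :> R[i].
  apply: (mulfI (expf_neq0 2 cC0)); rewrite mulfV ?expf_neq0//.
  by rewrite -(rmorph_nat (real_complex R)) -(rmorphXn (real_complex R)) -rmorphM cn.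
have nE1 : n.-1%:R = c%:C ^- 2 - 1 :> R[i].
  by apply: (addIr 1); rewrite subrK natr1 prednK.
rewrite nE nE1 /kerr /gnum; have := qden_neq0 w1; rewrite /qden => q0.
by field; rewrite exprMn; apply/and3P; split.
Qed.

Let cmean_conj F : cbmeas D F -> cmean mu D (fun t => (F t)^*) = (cmean mu D F)^*.
Proof.
move=> [_ jF]; rewrite /cmean/= -(meanN mD muL)//; congr Complex; apply: eq_mean => t _;
  by case: (F t).
Qed.

Lemma beta_conj w : normc w <= 1 -> beta w^* = (beta w)^*.
Proof.
move=> w1; rewrite /beta -cmean_conj; last exact: cbmeas_beta.
apply: eq_cmean => t _.
rewrite (rmorphM (@conjc R)) (rmorphXn (@conjc R)) (fmorphV (@conjc R)).
rewrite (rmorphB (@conjc R)) rmorph1 !(rmorphM (@conjc R)).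
by congr (_ ^+ 2 / (1 - _ * (_ * _))); symmetry; exact: conjc_real.
Qed.

Lemma qden_conj w : normc w <= 1 -> qden w^* = (qden w)^*.
Proof.
move=> w1; rewrite /qden beta_conj// (rmorphD (@conjc R)) rmorph1.
rewrite !(rmorphM (@conjc R)) !expr2.
by congr (1 + (_ * _) * _ * _); symmetry; exact: conjc_real.
Qed.

Lemma kerr_conj w : normc w <= 1 -> kerr w^* = (kerr w)^*.
Proof.
move=> w1; rewrite /kerr /gnum qden_conj// beta_conj//.
rewrite !(rmorphM (@conjc R)) (fmorphV (@conjc R)) (rmorphB (@conjc R)).
rewrite (rmorphM (@conjc R)) (rmorphB (@conjc R)) rmorph1 (rmorphXn (@conjc R)).
by congr (_ * ((1 - _ ^+ 2) * _ - _) / _); symmetry; exact: conjc_real.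
Qed.

Lemma normc_conj (w : R[i]) : normc w^* = normc w.
Proof. by case: w => a b /=; rewrite sqrrN. Qed.

Lemma normc_subJ (w : R[i]) : normc (w - w^*) = 2 * `|complex.Im w|.
Proof.
case: w => a b; rewrite normcE2 ReD ReN ImD ImN/= subrr expr0n/= add0r opprK.
rewrite sqrtr_sqr; have -> : b + b = 2 * b by ring.
by rewrite normrM (@ger0_norm _ 2).
Qed.

(* As [kerr] commutes with conjugation, its imaginary part is half the increment
   between [w^*] and [w]; a bound by [normc w] would be useless near the real axis. *)
Lemma Im_kerr_le w : normc w <= 1 ->
  `|complex.Im (kerr w)| <= 200 * kap * `|complex.Im w|.
Proof.
move=> w1; have := kerr_dist w1 (_ : normc w^* <= 1).
rewrite normc_conj => /(_ w1); rewrite kerr_conj// !normc_subJ; lra.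
Qed.

(** The imaginary part of [1/w + w] is [- Im w (1/|w|^2 - 1)]. The correction carries the same
    factor [|Im w|], so the range of admissible [|w|] does not shrink near the real axis. *)
Lemma Im_zeta_ge w : normc w <= 1 -> complex.Im w < 0 ->
  - complex.Im w * ((normc w ^+ 2)^-1 - 1 - 200 * kap) <= complex.Im (zeta w).
Proof.
move=> w1 iw; have w0 : w != 0 by apply/eqP => w0; move: iw; rewrite w0 ltxx.
rewrite zetaE// !ImD ImV; have := Im_kerr_le w1.
rewrite (ltr0_norm iw) => h; have := ler_norm (- complex.Im (kerr w)).
rewrite normrN; set a := (_ ^+ 2)^-1; lra.
Qed.

End ScaledKernel.

(** * Arctangent estimates *)

Section Arctangent.
Variable R : realType.
Implicit Types (a b p q s t x y : R).

Lemma mvt_segment (f df : R -> R) a b : a <= b ->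
  (forall x, a <= x <= b -> is_derive x 1 f (df x)) ->
  exists2 c, a <= c <= b & f b - f a = df c * (b - a).
Proof.
move=> ab dF; have [x||c cab ->] := @MVT_segment R f df a b ab.
- by rewrite in_itv/= => /andP[ax xb]; apply: dF; rewrite !ltW.
- apply: derivable_within_continuous => x; rewrite in_itv/= => /dF h.
  exact: ex_derive.
- by exists c; rewrite // -in_itv.
Qed.

Lemma atan_lipschitz x y : `|atan x - atan y| <= `|x - y|.
Proof.
wlog yx : x y / y <= x.
  move=> h; have [|/ltW xy] := leP y x; first exact: h.
  by rewrite distrC [leRHS]distrC h.
have [c _ ->] := mvt_segment yx (fun x _ => is_derive1_atan x).
rewrite normrM ler_piMl// ger0_norm ?invr_ge0 ?addr_ge0 ?sqr_ge0//.
by rewrite invf_le1 ?lerDl ?sqr_ge0// ltr_wpDr ?sqr_ge0.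
Qed.

Lemma atan_bound x : `|atan x| <= pi / 2.
Proof. by rewrite ler_norml !ltW// ?atan_gtNpi2 ?atan_ltpi2. Qed.

Lemma atan_cubic y : 0 <= y -> y - y ^+ 3 <= atan y <= y.
Proof.
move=> y0; have [c /andP[c0 cy]] := mvt_segment y0 (fun x _ => is_derive1_atan x).
rewrite atan0 !subr0 => ->; have d0 : 0 < 1 + c ^+ 2 by rewrite ltr_wpDr ?sqr_ge0.
have V1 : (1 + c ^+ 2)^-1 <= 1 by rewrite invf_le1 ?lerDl ?sqr_ge0.
have V2 : 1 - c ^+ 2 <= (1 + c ^+ 2)^-1.
  rewrite -(ler_pM2r d0) mulVf ?gt_eqF//.
  by have := sqr_ge0 (c ^+ 2); rewrite expr2; lra.
have cy2 : c ^+ 2 <= y ^+ 2 by rewrite lerXn2r// nnegrE.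
apply/andP; split; last by rewrite ler_piMl.
have -> : y - y ^+ 3 = (1 - y ^+ 2) * y by ring.
by rewrite ler_wpM2r//; lra.
Qed.

Lemma atan_inv y : 0 < y -> atan y^-1 = pi / 2 - atan y.
Proof.
move=> y0; have a0 : 0 < atan y by rewrite -atan0 lt_atan.
have a1 := atan_ltpi2 y; have a2 := atan_gtNpi2 y.
rewrite -[RHS]tanK; last by rewrite in_itv/=; apply/andP; have := pihalf_ge1 R; lra.
congr atan; rewrite /tan sinB cosB sin_pihalf cos_pihalf !mul0r !mul1r.
rewrite subr0 add0r -[in LHS](atanK y) /tan invfM invrK mulrC//.
Qed.

Lemma atan_cot x : 0 < x < pi -> atan (cos x / sin x) = pi / 2 - x.
Proof.
move=> /andP[x0 xpi]; rewrite -[RHS]tanK; last by rewrite in_itv/=; apply/andP; lra.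
congr atan; rewrite /tan sinB cosB sin_pihalf cos_pihalf !mul0r !mul1r.
by rewrite subr0 add0r.
Qed.

Let is_derive_quot a b p q x : p + x * q != 0 ->
  is_derive x 1 (fun y => atan ((a + y * b) / (p + y * q)))
   ((b * p - a * q) / ((p + x * q) ^+ 2 + (a + x * b) ^+ 2)).
Proof.
move=> h.
have lin c d : is_derive x 1 (fun y : R => c + y * d) d.
  have := is_deriveD (is_derive_cst c x 1) (is_deriveM (is_derive_id x 1) (is_derive_cst d x 1)).
  rewrite (_ : cst c + _ = (fun y => c + y * d)); last by apply/funext.
  by move=> h'; apply: (is_derive_eq h'); rewrite /GRing.scale/= mulr0 !add0r mulr1.
have dV := @is_deriveV R (fun y => p + y * q) x q 1 h (lin p q).
have dM := is_deriveM (lin a b) dV.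
have := @is_derive1_comp R atan (fun y => (a + y * b) / (p + y * q)) x _ _
  (is_derive1_atan _) dM.
move=> h'; apply: (is_derive_eq h'); rewrite /GRing.scale/=.
have s0 : (p + x * q) ^+ 2 + (a + x * b) ^+ 2 != 0.
  by rewrite gt_eqF// ltr_pwDl ?sqr_ge0// lt_def sqr_ge0 sqrf_eq0 h.
by field; rewrite s0 h.
Qed.

(** The arctangent is [pi/2 - arg (z - t)], whose differential is [- Im (dz / (z - t))]. The segment
    from [z] to [z'] stays at height at least [eta], so the resolvent is at most [1/eta] on it and
    the error is quadratic. *)
Lemma atan_phase (t eta : R) (z z' : R[i]) : 0 < eta ->
  eta <= complex.Im z -> eta <= complex.Im z' ->
  `|atan ((complex.Re z' - t) / complex.Im z') -
    atan ((complex.Re z - t) / complex.Im z) +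
    complex.Im ((z' - z) / (z - t%:C))| <= normc (z' - z) ^+ 2 / eta ^+ 2.
Proof.
move=> eta0 hz hz'; have [D DE] : {D | D = z' - z} by exists (z' - z).
have z'E : z' = z + D by rewrite DE addrC subrK.
rewrite -DE; pose Z (x : R) := z - t%:C + x%:C * D.
have imZ x : 0 <= x <= 1 -> eta <= complex.Im (Z x).
  move=> /andP[x0 x1]; rewrite z'E ImD in hz'; rewrite /Z !(ImD, ImN, ImZ)/=.
  have -> : complex.Im z - 0 + x * complex.Im D =
    (1 - x) * complex.Im z + x * (complex.Im z + complex.Im D) by ring.
  have -> : eta = (1 - x) * eta + x * eta by ring.
  by rewrite lerD// ler_wpM2l// subr_ge0.
have nZ x : 0 <= x <= 1 -> eta <= normc (Z x).
  by move=> /imZ h; apply: le_trans (Im_le_normc _); apply: le_trans h (ler_norm _).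
pose f (x : R) := atan ((complex.Re z - t + x * complex.Re D) / (complex.Im z + x * complex.Im D)).
have df x : 0 <= x <= 1 -> is_derive x 1 f (- complex.Im (D / Z x)).
  move=> x01; have im0 : complex.Im z + x * complex.Im D != 0.
    rewrite gt_eqF//; have := imZ x x01; rewrite /Z !(ImD, ImN, ImZ)/=; lra.
  have := is_derive_quot (complex.Re z - t) (complex.Re D) (p := complex.Im z)
    (q := complex.Im D) im0.
  move=> h'; apply: (is_derive_eq h'); rewrite ImM ReV ImV normc_sqr /Z !(ReD, ImD, ReN, ImN, ReZ, ImZ)/=.
  rewrite subr0; set p := _ + x * complex.Im D; set a := _ + x * complex.Re D.
  have s0 : a ^+ 2 + p ^+ 2 != 0.
    by rewrite gt_eqF// ltr_wpDl ?sqr_ge0// lt_def sqr_ge0 sqrf_eq0 andbT.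
  have -> : complex.Re D * complex.Im z - (complex.Re z - t) * complex.Im D =
    complex.Re D * p - a * complex.Im D by rewrite /p /a; ring.
  by clearbody p a; field.
have [x x01] := mvt_segment ler01 df.
rewrite /f !mul0r !addr0 !mul1r subr0 mulr1 => fE.
have -> : (complex.Re z' - t) / complex.Im z' =
    (complex.Re z - t + complex.Re D) / (complex.Im z + complex.Im D).
  by rewrite z'E ReD ImD; congr (_ / _); ring.
rewrite fE addrC -ImN -ImD.
apply: le_trans (Im_le_normc _) _.
have Zx0 : Z x != 0 by rewrite -normc_gt0; exact: lt_le_trans eta0 (nZ x x01).
have n0 := nZ 0 (_ : 0 <= 0 <= 1); rewrite lexx ler01 in n0.
have Z00 : Z 0 != 0 by rewrite -normc_gt0; exact: lt_le_trans eta0 (n0 isT).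
have Z0E : z - t%:C = Z 0 by rewrite /Z mul0r addr0.
have ZxE : Z x - Z 0 = x%:C * D by rewrite /Z; ring.
rewrite Z0E; have -> : D / Z 0 - D / Z x = D * (x%:C * D) * ((Z x)^-1 * (Z 0)^-1).
  by rewrite -ZxE; field; rewrite Zx0 Z00.
rewrite !normcM !normcV normc_real.
have xb : `|x| <= 1 by case/andP: x01 => x0 x1; rewrite ger0_norm.
have V c : eta <= c -> c^-1 <= eta^-1.
  by move=> ec; rewrite lef_pV2 ?posrE// (lt_le_trans eta0).
rewrite [eta ^+ 2]expr2 invfM [normc D ^+ 2]expr2.
apply: ler_pM; rewrite ?mulr_ge0 ?invr_ge0 ?normc_ge0//.
  by rewrite ler_wpM2l ?normc_ge0// ler_piMl ?normc_ge0.
by apply: ler_pM; rewrite ?invr_ge0 ?normc_ge0 ?V ?n0 ?nZ.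
Qed.

Lemma pi_le4 : pi <= 4 :> R.
Proof. by have := pihalf_lt2 R; lra. Qed.

(* Combining the kernels at two heights cancels the [1/s] tail of the error
   [pi/2 - atan s], leaving a function dominated by the Poisson kernel. *)
Let kernel_bound_pos s d l : 0 <= s -> `|d| <= 3 -> 3 / 2 <= l <= 3 ->
  `|pi / 2 - (l * atan s - atan ((s + d) / l)) / (l - 1)| <= 1000 / (1 + s ^+ 2).
Proof.
move=> s0 d3 /andP[l1 l2]; have l10 : 0 < l - 1 by lra.
have l0 : 0 < l by lra.
have -> : pi / 2 - (l * atan s - atan ((s + d) / l)) / (l - 1) =
    (l * (pi / 2 - atan s) - (pi / 2 - atan ((s + d) / l))) / (l - 1).
  by field; rewrite gt_eqF.
rewrite normrM normfV (gtr0_norm l10) ler_pdivrMr// mulrAC ler_pdivlMr; last first.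
  by rewrite ltr_wpDr ?sqr_ge0.
suff h : `|l * (pi / 2 - atan s) - (pi / 2 - atan ((s + d) / l))| * (1 + s ^+ 2) <= 500.
  by apply: le_trans h _; lra.
(* Up to 6 a constant bound is enough, as [1 + s^2 <= 37]. Beyond 6, [s + d >= s / 2], and the
   expansion of the arctangent at 0 applies to both inverse arguments. *)
have [s6|s6] := leP s 6.
  have h1 : `|l * (pi / 2 - atan s) - (pi / 2 - atan ((s + d) / l))| <= 13.
    have := atan_bound s; have := atan_bound ((s + d) / l); have := pi_le4.
    rewrite !ler_norml => ? /andP[? ?] /andP[a1 a2].
    have : 0 <= l * (pi / 2 - atan s) <= 3 * 4.
      by rewrite mulr_ge0 ?ler_pM//; lra.
    by move=> /andP[? ?]; apply/andP; lra.
  have : s ^+ 2 <= 6 ^+ 2 by rewrite lerXn2r// nnegrE.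
  move=> s2; have : 13 * (1 + s ^+ 2) <= 13 * (1 + 6 ^+ 2) by lra.
  by move=> h; apply: le_trans (ler_wpM2r _ h1) _; [rewrite addr_ge0 ?sqr_ge0|lra].
move: d3; rewrite ler_norml => /andP[d1 d2].
have sp : 0 < s by lra. have sd : 0 < s + d by lra.
pose y := s^-1; pose w := l / (s + d).
have y0 : 0 < y by rewrite invr_gt0.
have w0 : 0 < w by rewrite divr_gt0.
have -> : pi / 2 - atan s = atan y by rewrite atan_inv.
have -> : pi / 2 - atan ((s + d) / l) = atan w by rewrite -atan_inv ?divr_gt0// invf_div.
have /andP[y1 y2] := atan_cubic (ltW y0); have /andP[w1 w2] := atan_cubic (ltW w0).
have sy : s * y = 1 by rewrite mulfV// gt_eqF.
have ws : w * s <= 6.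
  by rewrite /w mulrAC ler_pdivrMr//; nra.
have y6 : y <= 1 / 6 by rewrite /y -div1r ler_pdivrMr//; lra.
(* The cancellation of the [1/s] tails: the linear terms differ by [O(1/s^2)] only. *)
have lw : l * y - w = l * d * y * (s + d)^-1 by rewrite /y /w; field; rewrite !gt_eqF.
have key : `|l * y - w| * s ^+ 2 <= 18.
  rewrite lw !normrM (gtr0_norm l0) (gtr0_norm y0) normfV (gtr0_norm sd).
  have -> : l * `|d| * y * (s + d)^-1 * s ^+ 2 = (s * y) * (l * `|d|) * (s / (s + d)).
    by rewrite expr2; ring.
  rewrite sy mul1r (_ : 18 = 9 * 2); last by ring.
  have dn : `|d| <= 3 by rewrite ler_norml d1 d2.
  rewrite ler_pM ?mulr_ge0 ?invr_ge0 ?(ltW l0) ?(ltW sp) ?(ltW sd)//.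
    by rewrite (_ : 9 = 3 * 3) ?ler_pM//; [exact: ltW|ring].
  by rewrite ler_pdivrMr//; lra.
have c1 : y ^+ 3 * s ^+ 2 <= 1.
  have -> : y ^+ 3 * s ^+ 2 = y * (s * y) ^+ 2 by ring.
  by rewrite sy expr1n mulr1; lra.
have c2 : w ^+ 3 * s ^+ 2 <= 36.
  have -> : w ^+ 3 * s ^+ 2 = (w * s) ^+ 2 * w by ring.
  have -> : 36 = 6 ^+ 2 * 1 :> R by ring.
  have ws0 : 0 <= w * s by apply: mulr_ge0; exact: ltW.
  rewrite ler_pM ?sqr_ge0 ?(ltW w0)//; first by rewrite lerXn2r ?nnegrE.
  by rewrite /w ler_pdivrMr//; lra.
have s36 : 6 * 6 <= s * s by apply: ler_pM => //; exact: ltW.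
have s21 : 1 + s ^+ 2 <= 2 * s ^+ 2 by rewrite expr2; lra.
set X := l * atan y - atan w.
have X2 : `|X| * s ^+ 2 <= 60.
  have hX : `|X| <= `|l * y - w| + 3 * y ^+ 3 + w ^+ 3.
    have y3 : 0 <= y ^+ 3 by rewrite exprn_ge0// ltW.
    have w3 : 0 <= w ^+ 3 by rewrite exprn_ge0// ltW.
    have la1 : l * (y - y ^+ 3) <= l * atan y by rewrite ler_pM2l.
    have la2 : l * atan y <= l * y by rewrite ler_pM2l.
    have la3 : l * y ^+ 3 <= 3 * y ^+ 3 by rewrite ler_wpM2r.
    have n1 := ler_norm (l * y - w); have n2 := ler_norm (- (l * y - w)).
    rewrite normrN in n2.
    by rewrite ler_norml; apply/andP; split; rewrite /X; lra.
  apply: le_trans (ler_wpM2r (sqr_ge0 s) hX) _; lra.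
have : `|X| * (1 + s ^+ 2) <= `|X| * (2 * s ^+ 2) by rewrite ler_wpM2l.
lra.
Qed.

Lemma kernel_bound s d l : `|d| <= 3 -> 3 / 2 <= l <= 3 ->
  `|(if 0 <= s then pi / 2 else - (pi / 2)) -
    (l * atan s - atan ((s + d) / l)) / (l - 1)| <= 1000 / (1 + s ^+ 2).
Proof.
move=> d3 l3; case: ifPn => [s0|]; first exact: kernel_bound_pos.
rewrite -ltNge => s0; have ns : 0 <= - s by lra.
have := kernel_bound_pos ns (_ : `|- d| <= 3) l3; rewrite normrN sqrrN => /(_ d3).
rewrite -opprD mulNr !atanN -normrN; congr (`|_| <= _).
by ring.
Qed.

End Arctangent.

(** * The phase along a ray *)

(** A mean value inequality stated with increments in place of derivatives. It serves for the phase,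
    with [K] of order [kap], and with [K = 0] for a function to be shown constant. *)
Lemma telescope_lipschitz (R : realType) (f : R -> R) (a b K A : R) :
  a <= b -> 0 <= A ->
  (forall s s', a <= s -> s < s' -> s' <= b ->
     `|f s' - f s| <= K * (s' - s) + A * (s' - s) ^+ 2) ->
  `|f b - f a| <= K * (b - a).
Proof.
move=> ab A0 hf; apply/ler_addgt0Pr => e e0.
move: ab; rewrite le_eqVlt => /predU1P[<-|ab].
  by rewrite !subrr normr0 mulr0 add0r ltW.
(* the quadratic term vanishes as the subdivision is refined *)
pose N := (Num.bound (A * (b - a) ^+ 2 / e)).+1.
have N0 : 0 < N%:R :> R by rewrite ltr0n.
pose h := (b - a) / N%:R; have h0 : 0 < h by rewrite divr_gt0// subr_gt0.
have Nh : h * N%:R = b - a by rewrite divfK// gt_eqF.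
have step i : (i <= N)%N ->
    `|f (a + h * i%:R) - f a| <= (K * h + A * h ^+ 2) * i%:R.
  elim: i => [|i IH] iN; first by rewrite !mulr0 addr0 subrr normr0.
  have -> : f (a + h * i.+1%:R) - f a =
     (f (a + h * i.+1%:R) - f (a + h * i%:R)) + (f (a + h * i%:R) - f a) by ring.
  apply: le_trans (ler_normD _ _) _; rewrite -natr1 [in leRHS]mulrDr mulr1 addrC.
  apply: lerD; first exact/IH/ltnW.
  have d : a + h * (i%:R + 1) - (a + h * i%:R) = h by ring.
  have := hf (a + h * i%:R) (a + h * (i%:R + 1)); rewrite d; apply.
  - by rewrite lerDl mulr_ge0// ltW.
  - by rewrite mulrDr mulr1 addrA ltrDl.
  - rewrite natr1 -lerBrDl -Nh ler_pM2l// ler_nat//.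
have := step N (leqnn N); rewrite Nh addrCA subrr addr0 => /le_trans; apply.
have -> : (K * h + A * h ^+ 2) * N%:R = K * (h * N%:R) + A * h * (h * N%:R) by ring.
rewrite Nh lerD2l /h mulrA mulrAC ler_pdivrMr// -mulrA -expr2.
rewrite -ler_pdivrMl// [_^-1 * _]mulrC ltW//.
have hb : 0 <= A * (b - a) ^+ 2 / e.
  by apply: divr_ge0; [apply: mulr_ge0 => //; exact: sqr_ge0|exact: ltW].
by apply: lt_trans (archi_boundP hb) _; rewrite ltr_nat ltnSn.
Qed.

Section Phase.
Variables (R : realType) (mu nu : probR R) (L B : R) (n : nat).
Hypotheses (muL : supported_on mu L) (L1 : 1 <= L).
Hypotheses (nuB : supported_on nu B) (B0 : 0 < B).
Let D : set (measurableTypeR R) := `[- L, L]%classic.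
Let E : set (measurableTypeR R) := `[- B, B]%classic.
Let mE : measurable E := measurable_segment B.
Hypotheses (Et : mean mu D (fun t => t) = 0)
  (Et2 : mean mu D (fun t => (t : R) ^+ 2) = 1).
Hypothesis nu_pow : is_free_conv_pow mu n nu.
Variable c : R.
Hypotheses (c0 : 0 < c) (cn : c ^+ 2 * n%:R = 1).
Let kap := L * c.
Hypothesis kap_small : kap <= 1000^-1.

Let zt w := zeta mu L n c w.
Let qd w := qden mu L c w.
Let er w := kerr mu L c w.

Variable w0 : R[i].
Hypotheses (w1 : normc w0 <= 1) (iw : complex.Im w0 < 0).
Let gam := (normc w0 ^+ 2)^-1 - 1 - 200 * kap.
Hypothesis gam0 : 0 < gam.
Let eta := - complex.Im w0 * gam.
Let ray (s : R) : R[i] := s%:C * w0.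

Let kap0 : 0 < kap.
Proof. by apply: mulr_gt0 => //; exact: lt_le_trans ltr01 L1. Qed.

Let kap2_ge0 : 0 <= 2 * kap.
Proof. by rewrite mulr_ge0// ltW. Qed.

Let kap200_ge0 : 0 <= 200 * kap.
Proof. by have := kap0; lra. Qed.

Let kap200_le1 : 200 * kap <= 1.
Proof. by have := kap_small; lra. Qed.

Let w00 : w0 != 0.
Proof. by apply/eqP => h; move: iw; rewrite h ltxx. Qed.

Let nw0 : 0 < normc w0.
Proof. by rewrite normc_gt0. Qed.

Let eta0 : 0 < eta.
Proof. by rewrite mulr_gt0// oppr_gt0. Qed.

Let normc_ray s : 0 < s -> normc (ray s) = s * normc w0.
Proof. by move=> s0; rewrite normcM normc_real gtr0_norm. Qed.

Let ray1 s : 0 < s <= 1 -> normc (ray s) <= s.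
Proof. by move=> /andP[s0 s1]; rewrite normc_ray// ler_piMr// ltW. Qed.

Let ray_le1 s : 0 < s <= 1 -> normc (ray s) <= 1.
Proof. by move=> s01; apply: le_trans (ray1 s01) _; case/andP: s01. Qed.

Let ray_neq0 s : 0 < s -> ray s != 0.
Proof. by move=> s0; rewrite -normc_gt0 normc_ray// mulr_gt0. Qed.

(** The lower bound for the height decreases outwards along the ray, so its value at [w0] holds on
    the whole ray. *)
Let Im_zt s : 0 < s <= 1 -> eta <= complex.Im (zt (ray s)).
Proof.
move=> s01; have /andP[s0 s1] := s01.
have iwr : complex.Im (ray s) = s * complex.Im w0 by rewrite ImZ.
have iwr0 : complex.Im (ray s) < 0 by rewrite iwr pmulr_rlt0.
apply: le_trans (Im_zeta_ge muL L1 Et Et2 c0 cn kap_small (ray_le1 s01) iwr0).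
rewrite iwr normc_ray// /eta -/kap.
have -> : - (s * complex.Im w0) = - complex.Im w0 * s by ring.
rewrite -[leRHS]mulrA ler_pM2l ?oppr_gt0// /gam.
set a := (normc w0 ^+ 2)^-1; have a0 : 0 < a by rewrite invr_gt0 exprn_gt0.
have -> : s * (((s * normc w0) ^+ 2)^-1 - 1 - 200 * kap) = a / s - s * (1 + 200 * kap).
  by rewrite /a; field; rewrite !gt_eqF.
have h1 : a <= a / s by rewrite ler_peMr ?(ltW a0)// invf_ge1.
have h2 : s * (1 + 200 * kap) <= 1 * (1 + 200 * kap).
  by apply: ler_wpM2r s1; exact: addr_ge0 ler01 kap200_ge0.
by lra.
Qed.

Let cC0 : c%:C != 0 :> R[i].
Proof. by rewrite -normc_eq0 normc_real normr_eq0 gt_eqF. Qed.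

Let eta_le s t : 0 < s <= 1 -> eta <= normc (zt (ray s) - (c * t)%:C).
Proof.
move=> s01; apply: le_trans (Im_zt s01) _; apply: le_trans (ler_norm _) _.
apply: le_trans (Im_le_normc _).
by rewrite [in leRHS]ImD [in leRHS]ImN/= oppr0 addr0.
Qed.

Let bmeas_ct : bmeas E (fun t : measurableTypeR R => c * (t : R)).
Proof. by apply: bmeasM => //; [exact: bmeas_cst|exact: bmeas_id]. Qed.

Let cbmeas_res s : 0 < s <= 1 ->
  cbmeas E (fun t : measurableTypeR R => (zt (ray s) - (c * (t : R))%:C)^-1).
Proof.
move=> s01; apply: (cbmeasV (d := eta)) => //; last by move=> t _; exact: eta_le.
by apply: cbmeasB => //; [exact: cbmeas_cst|exact: cbmeas_real].
Qed.

(** The continued functional equation at [v = c * ray s], with heights rescaled by [c]. *)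
Lemma resolvent_zeta s : 0 < s <= 1 ->
  cmean nu E (fun t : measurableTypeR R => (zt (ray s) - (c * (t : R))%:C)^-1) =
  ray s * qd (ray s).
Proof.
move=> s01; have /andP[s0 s1] := s01.
have n0 : (0 < n)%N by rewrite lt0n; apply/eqP => h; move: cn; rewrite h mulr0 => /eqP; rewrite eq_sym oner_eq0.
have L0 : 0 < L by exact: lt_le_trans ltr01 L1.
pose v := c%:C * ray s.
have v0 : v != 0 by rewrite mulf_neq0// ray_neq0.
have vL : normc v * L <= 4^-1.
  rewrite normcM normc_real gtr0_norm// mulrAC [c * L]mulrC -/kap.
  have : kap * normc (ray s) <= kap * 1 by rewrite ler_pM2l// ray_le1.
  by have := kap_small; lra.
have etac0 : 0 < eta / c by rewrite divr_gt0.
have hk s' : 0 < s' <= 1 -> eta / c <= complex.Im (kfun mu L n (s'%:C * v)).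
  move=> /andP[s'0 s'1]; rewrite ler_pdivrMr// mulrC -ImZ.
  have -> : s'%:C * v = c%:C * ray (s' * s).
    by rewrite /v /ray rmorphM /=; ring.
  apply: Im_zt; rewrite mulr_gt0//=; apply: le_trans s1.
  by rewrite ler_piMl// ltW.
have := cauchy_transform_kfun muL L0 nuB B0 n0 v0 vL etac0 hk nu_pow.
rewrite (cauchy_transformE mE nuB) /v (mgenE muL L1 Et c0 kap_small (ray_le1 s01)).
move=> h; apply: (mulfI cC0).
rewrite [RHS]mulrA -[RHS]h -(cmeanZ mE nuB); last exact: cbmeas_res.
apply: eq_cmean => t _; rewrite /zt /zeta.
have := @eta_le s (t : R) s01; rewrite /zt /zeta rmorphM /= -mulrBr => e1.
have : c%:C * (kfun mu L n (c%:C * ray s) - (t : R)%:C) != 0.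
  by rewrite -normc_gt0; exact: lt_le_trans eta0 e1.
rewrite mulf_eq0 negb_or => /andP[_ k0].
by rewrite invfM mulrA mulfV// mul1r.
Qed.

(** The mean of [pi/2 - arg (zt w - c t)], as [zt w] lies in the upper half-plane on the ray. *)
Let theta (w : R[i]) : R := mean nu E (fun t : measurableTypeR R =>
  atan ((complex.Re (zt w) - c * (t : R)) / complex.Im (zt w))).

Lemma bmeas_phase (p q : R) :
  bmeas E (fun t : measurableTypeR R => atan ((p - c * (t : R)) / q)).
Proof.
apply: (@bmeas_comp _ _ (@atan R) (pi / 2)).
- by move=> x; exact: continuous_atan.
- exact: atan_bound.
- apply: bmeasM => //; last exact: bmeas_cst.
  by apply: bmeasD => //; [exact: bmeas_cst|exact: bmeasN].
Qed.

Let theta_step s s' : 0 < s <= 1 -> 0 < s' <= 1 ->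
  `|theta (ray s') - theta (ray s) +
    complex.Im ((zt (ray s') - zt (ray s)) * (ray s * qd (ray s)))| <=
  normc (zt (ray s') - zt (ray s)) ^+ 2 / eta ^+ 2.
Proof.
move=> s01 s'01; rewrite -resolvent_zeta// -(cmeanZ mE nuB); last exact: cbmeas_res.
set z' := zt (ray s'); set z := zt (ray s).
have bz : cbmeas E (fun t : measurableTypeR R => (z' - z) * (z - (c * (t : R))%:C)^-1).
  by apply: cbmeasM => //; [exact: cbmeas_cst|exact: cbmeas_res].
have [_ jbz] := bz.
rewrite /theta -/z -/z' [complex.Im (cmean _ _ _)]/=.
rewrite -(meanB mE nuB); [|exact: bmeas_phase..].
rewrite -(meanD mE nuB)//; last by apply: bmeasD => //; [|apply: bmeasN]; exact: bmeas_phase.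
rewrite -[leRHS](mean_cst mE nuB); apply: (norm_mean_le mE nuB).
- apply: bmeasD => //; apply: bmeasD => //; last apply: bmeasN => //; exact: bmeas_phase.
- exact: bmeas_cst.
- by move=> t _; apply: atan_phase => //; exact: Im_zt.
Qed.

(* For the semicircle law the corresponding function is constant along the ray. *)
Let W s := theta (ray s) + complex.Im (ray s ^+ 2) / 2.

(** Only the quadratic coefficient depends on [a]; the linear one stays bounded as [a] tends to 0.
    Its value is [404 = 4 + 2 * 200], from [qd - 1] and from the increment of [er]. *)
Let W_step a s s' : 0 < a -> a <= s -> s < s' -> s' <= 1 ->
  `|W s' - W s| <= 404 * kap * (s' - s) +
   ((((a * normc w0) ^+ 2)^-1 + 2) ^+ 2 / eta ^+ 2 + 1) * (s' - s) ^+ 2.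
Proof.
move=> a0 as_ ss' s'1.
have s0 : 0 < s by lra.
have s'0 : 0 < s' by lra.
have s01 : 0 < s <= 1 by apply/andP; lra.
have s'01 : 0 < s' <= 1 by apply/andP; lra.
have wn := ray_neq0 s0; have wn' := ray_neq0 s'0.
have h1 := ray_le1 s01; have h1' := ray_le1 s'01.
have d0 : 0 < s' - s by lra.
have := theta_step s01 s'01.
have zE : zt (ray s) = (ray s)^-1 + ray s + er (ray s) by exact: (zetaE muL).
have zE' : zt (ray s') = (ray s')^-1 + ray s' + er (ray s') by exact: (zetaE muL).
have erB : normc (er (ray s') - er (ray s)) <= 200 * kap * normc (ray s' - ray s).
  exact: (kerr_dist muL).
pose Dl := ray s' - ray s.
have DlE : Dl = (s' - s)%:C * w0 by rewrite /Dl /ray rmorphB /=; ring.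
have nDl : normc Dl <= s' - s.
  by rewrite DlE normcM normc_real gtr0_norm// ler_piMr// ltW.
have zB : zt (ray s') - zt (ray s) =
    Dl * (1 - (ray s * ray s')^-1) + (er (ray s') - er (ray s)).
  rewrite zE zE' /Dl; move: wn wn'; move: (ray s) (ray s') (er _) (er _).
  by move=> x y p q wn wn'; field; rewrite wn wn'.
have nzB : normc (zt (ray s') - zt (ray s)) <= (((a * normc w0) ^+ 2)^-1 + 2) * (s' - s).
  rewrite zB; apply: le_trans (lenormcD _ _) _.
  have e1 : normc (1 - (ray s * ray s')^-1) <= 1 + ((a * normc w0) ^+ 2)^-1.
    apply: le_trans (lenormcB _ _) _; rewrite normc_one lerD2l normcV normcM.
    rewrite !normc_ray// lef_pV2 ?posrE ?exprn_gt0 ?mulr_gt0//.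
    by rewrite expr2 ler_pM ?mulr_ge0 ?(ltW a0) ?(ltW nw0)// ler_wpM2r ?(ltW nw0)//; lra.
  have e2 : normc (Dl * (1 - (ray s * ray s')^-1)) <=
      (s' - s) * (1 + ((a * normc w0) ^+ 2)^-1).
    by rewrite normcM ler_pM ?normc_ge0.
  have e3 : 200 * kap * normc Dl <= 1 * (s' - s).
    by apply: ler_pM; rewrite ?normc_ge0.
  by rewrite -/Dl in erB; lra.
set Y := complex.Im (_ * (ray s * _)) => hth.
(* The part of the increment that is absent for the semicircle law, where [qd] is 1 and [er] is
   0. *)
pose rst := Dl * (ray s - (ray s')^-1) * (qd (ray s) - 1) +
   (er (ray s') - er (ray s)) * (ray s * qd (ray s)).
have YE : Y = complex.Im (Dl * ray s) - complex.Im (Dl / ray s') + complex.Im rst.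
  rewrite -ImN -!ImD /Y zB /rst; congr complex.Im.
  move: wn wn'; move: (ray s) (ray s') (Dl) (qd _) (er _ - _).
  by move=> x y z q p wn wn'; field; rewrite wn wn'.
(* Two points of one ray have a real quotient; this removes the contribution of the pole. *)
have imq : complex.Im (Dl / ray s') = 0.
  rewrite DlE /ray invfM mulrCA mulrA mulrCA mulrA -[_ * w0^-1]mulrC.
  have -> : w0^-1 * ((s' - s)%:C * s'%:C^-1 * w0) = (s' - s)%:C * s'%:C^-1.
    by field; rewrite w00 -normc_eq0 normc_real normr_eq0 gt_eqF.
  by rewrite -(fmorphV (real_complex R)) -(rmorphM (real_complex R)).
have rstle : normc rst <= 404 * kap * (s' - s).
  apply: le_trans (lenormcD _ _) _.
  have q1 := qden_dist1 muL L1 Et2 c0 kap_small h1.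
  have /andP[_ q2] := qden_bounds muL L1 Et2 c0 kap_small h1.
  (* [qd - 1] vanishes to second order at 0 and so absorbs the pole. *)
  have e1 : normc (ray s - (ray s')^-1) * normc (qd (ray s) - 1) <= 4 * kap.
    have f1 : normc (ray s - (ray s')^-1) <= normc (ray s) + (normc (ray s'))^-1.
      by rewrite -normcV lenormcB.
    have g0 : 0 <= 2 * kap * normc (ray s) ^+ 2 by rewrite mulr_ge0 ?sqr_ge0.
    apply: le_trans (ler_pM (normc_ge0 _) (normc_ge0 _) f1 q1) _.
    set x := normc (ray s); set y := normc (ray s').
    have x0 : 0 < x by rewrite normc_gt0.
    have xy : x <= y by rewrite /x /y !normc_ray// ler_wpM2r// ltW.
    have x2 : x ^+ 2 <= 1 by rewrite expr_le1// normc_ge0.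
    have f2 : y^-1 * x ^+ 2 <= 1.
      rewrite mulrC ler_pdivrMr ?mul1r; last exact: lt_le_trans xy.
      by apply: le_trans xy; rewrite expr2 ler_piMl// ltW.
    have f3 : x * x ^+ 2 <= 1 * 1 by rewrite ler_pM ?sqr_ge0// ltW.
    have -> : (x + y^-1) * (2 * kap * x ^+ 2) = 2 * kap * (x * x ^+ 2 + y^-1 * x ^+ 2) by ring.
    have -> : 4 * kap = 2 * kap * 2 by ring.
    by apply: ler_wpM2l => //; lra.
  have e2 : normc (Dl * (ray s - (ray s')^-1) * (qd (ray s) - 1)) <= (s' - s) * (4 * kap).
    by rewrite -mulrA !normcM ler_pM ?mulr_ge0 ?normc_ge0.
  have e3 : normc (ray s * qd (ray s)) <= 1 * 2 by rewrite normcM ler_pM ?normc_ge0.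
  have e4 : normc (er (ray s') - er (ray s)) <= 200 * kap * (s' - s).
    by apply: le_trans erB _; rewrite ler_wpM2l.
  have e5 : normc ((er (ray s') - er (ray s)) * (ray s * qd (ray s))) <=
      200 * kap * (s' - s) * (1 * 2) by rewrite normcM ler_pM ?normc_ge0.
  by lra.
have wsq : complex.Im (ray s' ^+ 2) / 2 - complex.Im (ray s ^+ 2) / 2 =
    complex.Im (Dl * ray s) + complex.Im (Dl ^+ 2) / 2.
  have -> : ray s' = Dl + ray s by rewrite /Dl subrK.
  have -> : (Dl + ray s) ^+ 2 = Dl ^+ 2 + (Dl * ray s + Dl * ray s) + ray s ^+ 2 by ring.
  by rewrite !ImD; field.
have dl2 : `|complex.Im (Dl ^+ 2)| <= (s' - s) ^+ 2.
  by apply: le_trans (Im_le_normc _) _; rewrite normcX lerXn2r// nnegrE ?normc_ge0// ltW.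
have -> : W s' - W s = (theta (ray s') - theta (ray s) + Y) - complex.Im rst +
    complex.Im (Dl ^+ 2) / 2.
  have -> : W s' - W s = theta (ray s') - theta (ray s) +
      (complex.Im (ray s' ^+ 2) / 2 - complex.Im (ray s ^+ 2) / 2).
    by rewrite /W opprD addrACA.
  rewrite YE imq wsq; move: (theta _ - theta _) (complex.Im rst) => p q.
  by move: (complex.Im (Dl * _)) (complex.Im (Dl ^+ 2)) => y z; ring.
have im_rst := Im_le_normc rst.
have sq : normc (zt (ray s') - zt (ray s)) ^+ 2 / eta ^+ 2 <=
   (((a * normc w0) ^+ 2)^-1 + 2) ^+ 2 / eta ^+ 2 * (s' - s) ^+ 2.
  move: nzB; set M := _ + 2 => nzB.
  have -> : M ^+ 2 / eta ^+ 2 * (s' - s) ^+ 2 = (M * (s' - s)) ^+ 2 / eta ^+ 2 by ring.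
  rewrite ler_pM2r ?invr_gt0 ?exprn_gt0// lerXn2r ?nnegrE ?normc_ge0//.
  exact: le_trans (normc_ge0 _) nzB.
apply: le_trans (ler_normD _ _) _; apply: le_trans (lerD (ler_normB _ _) (lexx _)) _.
rewrite normrM [`|2^-1|]ger0_norm ?invr_ge0//.
by have := sqr_ge0 (s' - s); lra.
Qed.

(** Near the vertex [zt (ray a)] is [w0^-1 / a] up to [O(a)], and the bounded [c t] is negligible,
    so every phase tends to that of [w0^-1]. *)
Let W_small e : 0 < e -> exists2 a, 0 < a <= 1 &
  `|W a - atan (- complex.Re w0 / complex.Im w0)| <= e.
Proof.
move=> e0; pose X := complex.Re w0^-1; pose Y := complex.Im w0^-1.
have Y0 : 0 < Y.
  by rewrite /Y ImV -mulNr divr_gt0 ?oppr_gt0 ?exprn_gt0.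
have XY : - complex.Re w0 / complex.Im w0 = X / Y.
  rewrite /X /Y ReV ImV; field.
  by rewrite gt_eqF//=; exact: negbT (lt_eqF iw).
pose K := 2 * (Y * (2 + c * B) + `|X| * 2) / Y ^+ 2.
have K0 : 0 <= K.
  rewrite divr_ge0 ?sqr_ge0// mulr_ge0// addr_ge0 ?mulr_ge0 ?addr_ge0 ?mulr_ge0//; exact: ltW.
(* [Y / 4] keeps the height above [Y / (2 a)]; the phases then err by at most [a K], and the 1 in
   [K + 1] pays for the term [Im (ray a ^ 2) / 2]. *)
pose a := Num.min 1 (Num.min (Y / 4) (e / (K + 1))).
have a0 : 0 < a by rewrite !lt_min ltr01 !divr_gt0//=; lra.
have a1 : a <= 1 by rewrite ge_min lexx.
have aY : a <= Y / 4 by rewrite !ge_min lexx orbT.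
have ae : a * (K + 1) <= e.
  by rewrite -ler_pdivlMr ?ltr_wpDl// !ge_min lexx !orbT.
have a01 : 0 < a <= 1 by rewrite a0.
exists a => //; rewrite XY.
have zE : zt (ray a) = (ray a)^-1 + ray a + er (ray a).
  by apply: (zetaE muL) => //; [exact: ray_neq0|exact: ray_le1].
pose ee := ray a + er (ray a).
have nee : normc ee <= 2 * a.
  apply: le_trans (lenormcD _ _) _.
  have h := kerr_le muL L1 Et2 c0 kap_small (ray_le1 a01).
  have h1 := ray1 a01.
  have : 200 * kap * normc (ray a) <= 1 * a.
    by apply: ler_pM; rewrite ?normc_ge0.
  by rewrite /er; rewrite -/kap in h; lra.
have zR : complex.Re (zt (ray a)) = X / a + complex.Re ee.
  rewrite zE -addrA ReD -/ee /ray invfM -(fmorphV (real_complex R)) ReZ.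
  by rewrite -/X mulrC.
have zI : complex.Im (zt (ray a)) = Y / a + complex.Im ee.
  rewrite zE -addrA ImD -/ee /ray invfM -(fmorphV (real_complex R)) ImZ.
  by rewrite -/Y mulrC.
have e1 : `|complex.Re ee| <= 2 * a := le_trans (Re_le_normc _) nee.
have e2 : `|complex.Im ee| <= 2 * a := le_trans (Im_le_normc _) nee.
have zI_ge : Y / (2 * a) <= complex.Im (zt (ray a)).
  rewrite zI; have -> : Y / (2 * a) = Y / a - Y / (2 * a) by field; rewrite gt_eqF.
  rewrite lerD2l; apply: (@le_trans _ _ (- `|complex.Im ee|)).
    rewrite lerN2; apply: le_trans e2 _.
    by rewrite ler_pdivlMr ?mulr_gt0//; nra.
  by rewrite lerNl -normrN ler_norm.
have zI0 : 0 < complex.Im (zt (ray a)).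
  by apply: lt_le_trans zI_ge; rewrite divr_gt0// mulr_gt0.
have th : `|theta (ray a) - atan (X / Y)| <= a * K.
  rewrite -(mean_cst mE nuB (atan (X / Y))) -(meanB mE nuB).
  - rewrite -[leRHS](mean_cst mE nuB); apply: (norm_mean_le mE nuB).
    + by apply: bmeasD => //; [exact: bmeas_phase|exact: bmeas_cst].
    + exact: bmeas_cst.
    + move=> t /segment_norm tB; apply: le_trans (atan_lipschitz _ _) _.
      have -> : (complex.Re (zt (ray a)) - c * (t : R)) / complex.Im (zt (ray a)) - X / Y =
         (Y * (complex.Re ee - c * (t : R)) - X * complex.Im ee) /
         (complex.Im (zt (ray a)) * Y).
        move: zI0; rewrite zR zI; clearbody X Y.
        move: (complex.Re ee) (complex.Im ee) => p q y0.
        have y0' : 0 < Y + q * a.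
          by move: y0; rewrite -(pmulr_lgt0 _ a0) mulrDl divfK ?gt_eqF.
        by field; rewrite ?gt_eqF.
      rewrite normrM normfV [`|_ * Y|]gtr0_norm ?mulr_gt0//.
      have hn : `|Y * (complex.Re ee - c * (t : R)) - X * complex.Im ee| <=
          Y * (2 + c * B) + `|X| * 2.
        apply: le_trans (ler_normB _ _) _; rewrite !normrM (gtr0_norm Y0) lerD//.
          rewrite ler_pM2l//; apply: le_trans (ler_normB _ _) _.
          rewrite lerD//; first lra.
          by rewrite normrM gtr0_norm// ler_pM2l.
        by rewrite ler_wpM2l//; lra.
      rewrite ler_pdivrMr ?mulr_gt0//; apply: le_trans hn _.
      have -> : a * K * (complex.Im (zt (ray a)) * Y) =
         (Y * (2 + c * B) + `|X| * 2) * (2 * a / Y * complex.Im (zt (ray a))).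
        by rewrite /K; field; rewrite gt_eqF.
      rewrite ler_peMr//.
        by rewrite addr_ge0 ?mulr_ge0 ?addr_ge0 ?mulr_ge0//; exact: ltW.
      have : 2 * a / Y * (Y / (2 * a)) <= 2 * a / Y * complex.Im (zt (ray a)).
        by rewrite ler_pM2l// divr_gt0// mulr_gt0.
      by have -> : 2 * a / Y * (Y / (2 * a)) = 1; [field; rewrite !gt_eqF|].
  - exact: bmeas_phase.
  - exact: bmeas_cst.
have i2 : `|complex.Im (ray a ^+ 2) / 2| <= a.
  rewrite normrM [`|2^-1|]ger0_norm ?invr_ge0//.
  have := Im_le_normc (ray a ^+ 2); rewrite normcX.
  have : normc (ray a) ^+ 2 <= 1 * a by rewrite expr2 ler_pM ?normc_ge0 ?ray1 ?ray_le1.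
  by lra.
rewrite /W addrAC; apply: le_trans (ler_normD _ _) _.
by lra.
Qed.

Lemma phase_estimate :
  `|mean nu E (fun t : measurableTypeR R =>
      atan ((complex.Re (zt w0) - c * (t : R)) / complex.Im (zt w0))) +
    complex.Im (w0 ^+ 2) / 2 - atan (- complex.Re w0 / complex.Im w0)| <= 404 * kap.
Proof.
have W1 : W 1 = mean nu E (fun t : measurableTypeR R =>
      atan ((complex.Re (zt w0) - c * (t : R)) / complex.Im (zt w0))) +
    complex.Im (w0 ^+ 2) / 2 by rewrite /W /theta /ray mul1r.
rewrite -W1; apply/ler_addgt0Pr => e /W_small[a /andP[a0 a1] ha].
have -> : W 1 - atan (- complex.Re w0 / complex.Im w0) =
   (W 1 - W a) + (W a - atan (- complex.Re w0 / complex.Im w0)) by ring.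
apply: le_trans (ler_normD _ _) (lerD _ ha).
have A0 : 0 <= (((a * normc w0) ^+ 2)^-1 + 2) ^+ 2 / eta ^+ 2 + 1.
  by rewrite addr_ge0// divr_ge0 ?sqr_ge0.
apply: le_trans (telescope_lipschitz a1 A0 _) _ => [s s' as_ ss' s'1|].
  exact: W_step a0 as_ ss' s'1.
have ka : 0 <= kap * a by rewrite mulr_ge0// ltW.
by move: ka; rewrite mulrBr mulr1; move: (kap * a) kap => u v; rewrite -mulrA; lra.
Qed.

Lemma resolvent_zeta1 :
  cmean nu E (fun t : measurableTypeR R => (zt w0 - (c * (t : R))%:C)^-1) = w0 * qd w0.
Proof.
by have := resolvent_zeta (s := 1); rewrite /ray mul1r; apply; rewrite ltr01 lexx.
Qed.

Lemma Im_zeta_gt0 : 0 < complex.Im (zt w0).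
Proof.
apply: lt_le_trans eta0 _; have := Im_zt (s := 1); rewrite /ray mul1r; apply.
by rewrite ltr01 lexx.
Qed.

End Phase.

(** * The semicircle law *)

Section Semicircle.
Variable R : realType.
Notation leb := (@lebesgue_measure R).
Implicit Types (x y : R).

Let g (t : R) : R := Num.sqrt (4 - t ^+ 2) * \1_(`[- 2, 2] : set R) t.

Let I x : R := \int[leb]_(t in `]-oo, x]) g t.

Let g_in t : -2 <= t <= 2 -> g t = Num.sqrt (4 - t ^+ 2).
Proof.
by move=> t2; rewrite /g indicE mem_set ?mulr1//= in_itv.
Qed.

Let g_out t : ~~ (-2 <= t <= 2) -> g t = 0.
Proof.
move=> t2; rewrite /g indicE memNset ?mulr0//= in_itv/=.
exact/negP.
Qed.

Let g_integrable : leb.-integrable setT (EFin \o g).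
Proof.
pose f (t : R) := Num.sqrt (4 - t ^+ 2).
have -> : EFin \o g = (EFin \o f) \_ (`[- 2, 2] : set R).
  apply/funext => t; rewrite patchE /=; case: ifPn => [|t2].
    by rewrite inE /= in_itv/= => t2; rewrite g_in.
  rewrite g_out//; apply: contra t2 => t2; by rewrite inE /= in_itv.
apply/integrable_restrict => //=; rewrite setTI.
apply: measurable_bounded_integrable => //.
- by rewrite /= lebesgue_measure_itv/=; case: ifPn => _; rewrite ?ltry// -EFinB ltry.
- apply: measurable_funTS.
  have -> : f = @Num.sqrt R \o (fun t : R => 4 - t ^+ 2) by apply/funext.
  apply: measurableT_comp.
    by apply: continuous_measurable_fun; exact: sqrt_continuous.
  by apply: measurable_funB => //; exact: measurable_funX.
- exists 2; split; first exact: num_real.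
  move=> M M2 t _; rewrite /f/= ger0_norm ?sqrtr_ge0//; apply: le_trans (ltW M2).
  rewrite -[leRHS]ger0_norm// -sqrtr_sqr ler_wsqrtr//.
  by have := sqr_ge0 t; lra.
Qed.

Let I_bounds x y m M : x <= y -> (forall t, x < t <= y -> m <= g t <= M) ->
  m * (y - x) <= I y - I x <= M * (y - x).
Proof.
move=> xy hg.
have itS (A : set R) : measurable A -> leb.-integrable A (EFin \o g).
  by move=> mA; apply: integrableS g_integrable.
have IE : I y - I x = \int[leb]_(t in `]x, y]) g t.
  rewrite /I (_ : `]-oo, y]%classic = `]-oo, x]%classic `|` `]x, y]%classic).
    rewrite Rintegral_setU//.
    - by rewrite addrC addKr.
    - by apply: itS; exact: measurableU.
    - apply/disj_setPS => t [/=]; rewrite !in_itv/= => tx /andP[xt _].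
      by move: xt; rewrite ltNge tx.
  by rewrite (@itv_bndbnd_setU _ _ _ (BRight x)).
have cstE k : \int[leb]_(t in `]x, y]) (cst k t) = k * (y - x).
  rewrite Rintegral_cst//= lebesgue_measure_itv/= lte_fin.
  move: xy; rewrite le_eqVlt => /predU1P[->|xy]; first by rewrite ltxx subrr.
  by rewrite xy.
have itc k : leb.-integrable `]x, y] (EFin \o (fun=> k : R)).
  apply: measurable_bounded_integrable => //=.
  - rewrite lebesgue_measure_itv/=; case: ifPn => _; rewrite ?ltry//.
  - exact: bounded_cst.
rewrite IE -(cstE m) -(cstE M); apply/andP; split; apply: le_Rintegral => //;
  try exact: itc; try exact: itS; by move=> t; rewrite /= in_itv/= => /hg/andP[].
Qed.

Let g_bounds t : 0 <= g t <= 2.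
Proof.
have [t2|t2] := boolP (-2 <= t <= 2); last by rewrite g_out// lexx ler0n.
rewrite g_in// sqrtr_ge0/= -[leRHS]ger0_norm// -sqrtr_sqr ler_wsqrtr//.
by have := sqr_ge0 t; lra.
Qed.

Lemma semicircle_cdf_lip x y : x <= y ->
  0 <= semicircle_cdf y - semicircle_cdf x <= y - x.
Proof.
move=> xy; rewrite /semicircle_cdf -mulrBr -/(I x) -/(I y).
have /andP[h1 h2] := I_bounds xy (fun t _ => g_bounds t).
rewrite mul0r in h1.
have p2 := pi_ge2 R; have p0 := pi_gt0 R.
rewrite mulr_ge0 ?invr_ge0 ?mulr_ge0//=; [|exact: ltW..].
rewrite mulrC ler_pdivrMr ?mulr_gt0//; apply: le_trans h2 _.
by rewrite mulrC ler_wpM2l ?subr_ge0//; lra.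
Qed.

Let I_left x : x <= -2 -> I x = 0.
Proof.
move=> x2; rewrite /I (eq_Rintegral leb (g := fun=> 0)).
  by rewrite Rintegral_cst// mul0r.
move=> t; rewrite inE /= in_itv/= => tx.
have [t2|] := boolP (-2 <= t <= 2); last exact: g_out.
have -> : t = -2 by case/andP: t2 => ? _; lra.
by rewrite g_in ?lexx//=; [rewrite sqrrN -natrX subrr sqrtr0|lra].
Qed.

Let g_cos (t : R) : g (2 * cos t) = 2 * `|sin t|.
Proof.
have /andP[c1 c2] : -1 <= cos t <= 1 by rewrite cos_geN1 cos_le1.
rewrite g_in; last by apply/andP; lra.
have -> : 4 - (2 * cos t) ^+ 2 = (2 * sin t) ^+ 2.
  by rewrite !exprMn sin2cos2; ring.
by rewrite sqrtr_sqr normrM ger0_norm.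
Qed.

Let sin_lip (a b : R) : `|sin a - sin b| <= `|a - b|.
Proof.
wlog ba : a b / b <= a.
  move=> h; have [|/ltW ab] := leP b a; first exact: h.
  by rewrite distrC [leRHS]distrC h.
have [d _ ->] := mvt_segment ba (fun x _ => is_derive_sin x).
by rewrite normrM ler_piMl// ler_norml cos_geN1 cos_le1.
Qed.

Let cos_lip (a b : R) : `|cos a - cos b| <= `|a - b|.
Proof.
wlog ba : a b / b <= a.
  move=> h; have [|/ltW ab] := leP b a; first exact: h.
  by rewrite distrC [leRHS]distrC h.
have [d _ ->] := mvt_segment ba (fun x _ => is_derive_cos x).
by rewrite normrM normrN ler_piMl// ler_norml sin_geN1 sin_le1.
Qed.

Let cos_mvt (a b : R) : a <= b -> exists2 d, a <= d <= b & cos b - cos a = - sin d * (b - a).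
Proof. by move=> ab; exact: mvt_segment ab (fun x _ => is_derive_cos x). Qed.

(** The function [F] below has increments of second order, so it is constant and equals its value at
    [pi], where the integral vanishes. Increments of the integral are estimated by the extreme
    values of the density. *)
Lemma semicircle_cdf_cos (t : R) : 0 <= t <= pi ->
  semicircle_cdf (2 * cos t) = 1 - (t - sin t * cos t) / pi.
Proof.
move=> /andP[t0 tpi]; have p0 := pi_gt0 R.
pose F (s : R) := I (2 * cos s) + 2 * s - 2 * (sin s * cos s).
have Fpi : F pi = 2 * pi.
  by rewrite /F cospi sinpi mul0r mulr0 subr0 I_left ?add0r//; lra.
suff Ft : F t = 2 * pi.
  have It : I (2 * cos t) = 2 * pi - 2 * t + 2 * (sin t * cos t) by rewrite -Ft /F; ring.
  rewrite /semicircle_cdf -/(I (2 * cos t)) It; move: p0; move: (@pi R) => p p0.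
  by field; rewrite gt_eqF.
suff : `|F pi - F t| <= 0 * (pi - t).
  by rewrite mul0r normr_le0 subr_eq0 Fpi => /eqP.
(* The increments turn out to be at most [4 h^2 + 6 h^2]. *)
apply: (@telescope_lipschitz _ _ _ _ _ 20) => // s s' ts ss' s'pi.
rewrite mul0r add0r; set h := s' - s; have h0 : 0 < h by rewrite subr_gt0.
have [d /andP[d1 d2] cE] := cos_mvt (ltW ss').
have s0 : 0 <= sin s by apply: sin_ge0_pi; apply/andP; lra.
have sd0 : 0 <= sin d by apply: sin_ge0_pi; apply/andP; lra.
have len : 2 * cos s - 2 * cos s' = 2 * sin d * h.
  by rewrite -mulrBr -opprB cE /h; ring.
have gs t' : 2 * cos s' < t' <= 2 * cos s ->
    2 * sin s - 2 * h <= g t' <= 2 * sin s + 2 * h.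
  move=> /andP[t1 t2].
  have /andP[c1 c2] : -1 <= cos s <= 1 by rewrite cos_geN1 cos_le1.
  have /andP[c1' c2'] : -1 <= cos s' <= 1 by rewrite cos_geN1 cos_le1.
  have t'1 : -1 <= t' / 2 <= 1 by apply/andP; lra.
  pose u := acos (t' / 2).
  have cu : 2 * cos u = t' by rewrite /u acosK ?in_itv//=; field.
  have u0 := acos_ge0 t'1; have upi := acos_lepi t'1.
  have us : s <= u <= s'.
    have sI : s \in `[0, pi] by rewrite in_itv/=; apply/andP; lra.
    have s'I : s' \in `[0, pi] by rewrite in_itv/=; apply/andP; lra.
    have uI : u \in `[0, pi] by rewrite in_itv/= u0 upi.
    have tu : cos u = t' / 2 by rewrite -cu; field.
    rewrite leNgt -(ltr_cos uI sI) tu leNgt -(ltr_cos s'I uI) tu -!leNgt.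
    by apply/andP; lra.
  have /andP[su us'] := us.
  rewrite -cu g_cos; have := sin_lip u s.
  rewrite [leRHS]ger0_norm ?subr_ge0// => sl.
  have su0 : 0 <= sin u by apply: sin_ge0_pi; apply/andP.
  rewrite ger0_norm//; move: sl; rewrite ler_norml => /andP[? ?].
  by apply/andP; rewrite /h; lra.
have lenpos : 2 * cos s' <= 2 * cos s by rewrite -subr_ge0 len !mulr_ge0// ltW.
have := I_bounds lenpos gs; rewrite len.
have [e /andP[e1 e2] sE] := mvt_segment (ltW ss') (fun x _ => is_derive_sin x).
rewrite -/h in cE sE.
have ds : `|sin d - sin s| <= h.
  by apply: le_trans (sin_lip _ _) _; rewrite ger0_norm; rewrite /h; lra.
have ce : `|cos e - cos s| <= h.
  by apply: le_trans (cos_lip _ _) _; rewrite ger0_norm; rewrite /h; lra.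
have cs' : `|cos s' - cos s| <= h.
  by apply: le_trans (cos_lip _ _) _; rewrite ger0_norm; rewrite /h; lra.
have sd1 : `|sin d| <= 1 by rewrite ler_norml sin_geN1 sin_le1.
have s1 : `|sin s| <= 1 by rewrite ler_norml sin_geN1 sin_le1.
have c1 : `|cos s| <= 1 by rewrite ler_norml cos_geN1 cos_le1.
have ce1 : `|cos e| <= 1 by rewrite ler_norml cos_geN1 cos_le1.
set Id := I _ - I _ => /andP[I1 I2].
pose r := Id - 4 * sin s * sin d * h.
have hr : `|r| <= 4 * h ^+ 2.
  have : `|r| <= 4 * h ^+ 2 * sin d by rewrite ler_norml /r; apply/andP; lra.
  have h2 : 0 <= 4 * h ^+ 2 by rewrite mulr_ge0// sqr_ge0.
  by move=> hr; apply: le_trans hr _; rewrite ler_piMr// sin_le1.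
(* The first-order terms cancel by the Pythagorean identity; [q] collects the deviations at the
   intermediate points. *)
pose q := sin s * (sin s - sin d) + cos s * (cos s - cos e) + cos e * (cos s - cos s').
have hq : `|q| <= 3 * h.
  have -> : 3 * h = 1 * h + 1 * h + 1 * h by ring.
  apply: le_trans (ler_normD _ _) (lerD _ _); last first.
    by rewrite normrM ler_pM// distrC.
  apply: le_trans (ler_normD _ _) (lerD _ _).
    by rewrite normrM ler_pM// distrC.
  by rewrite normrM ler_pM// distrC.
have -> : F s' - F s = - r + 2 * h * q.
  have -> : F s' - F s = - Id + 2 * h - 2 * (sin s' * cos s' - sin s * cos s).
    by rewrite /F /Id /h; ring.
  have sE' : sin s' = sin s + cos e * h by rewrite -sE; ring.
  have cE' : cos s' = cos s - sin d * h by have := cE; rewrite mulNr => <-; ring.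
  rewrite /r /q sE' cE'.
  have := cos2Dsin2 s; move: (sin s) (cos s) (sin d) (cos e) => S c Sd Ce h1.
  apply/eqP; rewrite -subr_eq0; apply/eqP.
  transitivity (2 * h * (1 - (c ^+ 2 + S ^+ 2))); first by ring.
  by rewrite h1 subrr mulr0.
apply: le_trans (ler_normD _ _) _; rewrite normrN normrM.
have : `|2 * h| * `|q| <= (2 * h) * (3 * h).
  by rewrite ler_pM// ger0_norm// mulr_ge0// ltW.
by have := sqr_ge0 h; rewrite expr2 in hr *; lra.
Qed.

Lemma semicircle_cdf2 : semicircle_cdf (2 : R) = 1.
Proof.
have := @semicircle_cdf_cos 0; rewrite cos0 sin0 mulr1 mul0r subr0 mul0r subr0.
by apply; rewrite lexx pi_ge0.
Qed.

Lemma semicircle_cdfN2 : semicircle_cdf (- 2 : R) = 0.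
Proof. by rewrite /semicircle_cdf -/(I (- 2)) I_left ?mulr0. Qed.

Lemma semicircle_cdf_ge0 x : 0 <= semicircle_cdf x.
Proof.
rewrite mulr_ge0 ?invr_ge0 ?mulr_ge0 ?pi_ge0//; apply: Rintegral_ge0 => t _.
by have /andP[] := g_bounds t.
Qed.

Lemma semicircle_cdf_le1 x : semicircle_cdf x <= 1.
Proof.
have [x2|/ltW x2] := leP x 2.
  by have /andP[] := semicircle_cdf_lip x2; rewrite semicircle_cdf2; lra.
have := I_bounds x2 (m := 0) (M := 0); rewrite !mul0r => h.
have : 0 <= I x - I 2 <= 0.
  apply: h => t /andP[t2 _]; rewrite g_out ?lexx//.
  by apply/negP => /andP[_]; rewrite leNgt t2.
move=> /le_anti/esym/eqP; rewrite subr_eq0 => /eqP e.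
by rewrite -semicircle_cdf2 /semicircle_cdf -/(I x) -/(I 2) e.
Qed.

End Semicircle.

(** * Comparison of distribution functions *)

Section KernelCdf.
Variables (R : realType) (nu : probR R) (B : R).
Hypotheses (nuB : supported_on nu B) (B0 : 0 < B).
Let E : set (measurableTypeR R) := `[- B, B]%classic.
Let mE : measurable E := measurable_segment B.
Variables (n : nat) (c : R).
Hypotheses (c0 : 0 < c) (cn : c ^+ 2 * n%:R = 1).

Let below x : set (measurableTypeR R) := [set t | c * (t : R) <= x].

Let measurable_below x : measurable (below x).
Proof.
have -> : below x = `]-oo, (x / c)]%classic.
  by apply/seteqP; split=> t; rewrite /below /= in_itv/= ler_pdivlMr// mulrC.
exact: measurable_itv.
Qed.

Let normalizedE x : normalized n nu `]-oo, x]%classic = nu (below x).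
Proof.
have sn : Num.sqrt n%:R = c^-1.
  have -> : n%:R = c^-1 ^+ 2.
    apply: (mulfI (_ : c ^+ 2 != 0)); first by rewrite expf_neq0// gt_eqF.
    by rewrite cn -exprMn divff ?expr1n// gt_eqF.
  by rewrite sqrtr_sqr ger0_norm// invr_ge0 ltW.
rewrite /normalized sn; congr (nu _); apply/seteqP; split=> t /=.
- by move=> [u]; rewrite in_itv/= => ux <-; rewrite /below /= mulrA divff ?mul1r// gt_eqF.
- move=> tx; exists (c * (t : R)); first by rewrite in_itv.
  by rewrite mulrA mulVf ?mul1r// gt_eqF.
Qed.

Lemma normalized_cdf_mean x : normalized_cdf n nu x =
  mean nu E (fun t : measurableTypeR R => if c * (t : R) <= x then 1 else 0).
Proof.
rewrite /normalized_cdf normalizedE /mean /Rintegral.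
have -> : (fun t : measurableTypeR R => (if c * (t : R) <= x then 1 else 0)%:E) =
    (fun t => (\1_(below x) t)%:E) :> (measurableTypeR R -> \bar R).
  apply/funext => t; rewrite indicE; case: ifPn => tx; first by rewrite mem_set.
  by rewrite memNset//= /below /=; exact/negP.
rewrite -(integral_supported mE nuB).
  by rewrite integral_indic// setIT.
by apply/measurable_EFinP; exact: measurable_indic.
Qed.

Lemma normalized_cdf_le x y : x <= y -> normalized_cdf n nu x <= normalized_cdf n nu y.
Proof.
move=> xy; rewrite /normalized_cdf !normalizedE fine_le//.
- by rewrite fin_num_measure.
- by rewrite fin_num_measure.
- by apply: le_measure; rewrite ?inE// => t; rewrite /below/= => /le_trans; apply.
Qed.

Lemma normalized_cdf_ge0 x : 0 <= normalized_cdf n nu x.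
Proof. by rewrite fine_ge0// normalizedE. Qed.

Lemma normalized_cdf_le1 x : normalized_cdf n nu x <= 1.
Proof.
rewrite /normalized_cdf normalizedE -[leRHS]/(fine 1%E) fine_le//.
- by rewrite fin_num_measure.
- exact: probability_le1.
Qed.

(** With [s = (x - c t) / v], the pointwise error bound [1000 / (1 + s^2)] equals
    [- 1000 v Im (1 / (z1 - c t))], whose mean is controlled by the resolvent at [z1]. *)
Lemma cdf_kernel (z1 z2 : R[i]) (l : R) : 0 < complex.Im z1 ->
  complex.Im z2 = l * complex.Im z1 -> 3 / 2 <= l <= 3 ->
  `|complex.Re z2 - complex.Re z1| <= 3 * complex.Im z1 ->
  `|pi * (normalized_cdf n nu (complex.Re z1) - 2^-1) -
    (l * mean nu E (fun t : measurableTypeR R => atan ((complex.Re z1 - c * (t : R)) / complex.Im z1)) -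
     mean nu E (fun t : measurableTypeR R => atan ((complex.Re z2 - c * (t : R)) / complex.Im z2)))
      / (l - 1)| <=
  1000 * complex.Im z1 *
  normc (cmean nu E (fun t : measurableTypeR R => (z1 - (c * (t : R))%:C)^-1)).
Proof.
set v := complex.Im z1; set x := complex.Re z1; set y := complex.Re z2.
move=> v0 -> l3 xy; have l10 : 0 < l - 1 by case/andP: l3 => ? _; lra.
have bph p q := @bmeas_phase R B c p q.
have bct : bmeas E (fun t : measurableTypeR R => c * (t : R)).
  by apply: bmeasM => //; [exact: bmeas_cst|exact: bmeas_id].
have bres : cbmeas E (fun t : measurableTypeR R => (z1 - (c * (t : R))%:C)^-1).
  apply: (cbmeasV (d := v)) => //.
    by apply: cbmeasB => //; [exact: cbmeas_cst|exact: cbmeas_real].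
  move=> t _; apply: le_trans (ler_norm _) _; apply: le_trans (Im_le_normc _).
  by rewrite [in leRHS]ImD [in leRHS]ImN/= oppr0 addr0.
have bind : bmeas E (fun t : measurableTypeR R => if c * (t : R) <= x then 1 else 0 : R).
  split; last by exists 1 => t _; case: ifP; rewrite ?normr1 ?normr0.
  have -> : (fun t : measurableTypeR R => if c * (t : R) <= x then 1 else 0 : R) = \1_(below x).
    apply/funext => t; rewrite indicE; case: ifPn => tx; first by rewrite mem_set.
    by rewrite memNset//= /below /=; exact/negP.
  exact: measurable_indic.
have bZ (k : R) (f : measurableTypeR R -> R) : bmeas E f -> bmeas E (fun t => k * f t).
  by move=> bf; apply: bmeasM => //; exact: bmeas_cst.
pose ph1 (t : measurableTypeR R) := atan ((x - c * (t : R)) / v).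
pose ph2 (t : measurableTypeR R) := atan ((y - c * (t : R)) / (l * v)).
pose ind (t : measurableTypeR R) : R := if c * (t : R) <= x then 1 else 0.
have b1 : bmeas E (fun t => pi * (ind t - 2^-1)).
  by apply: (bZ pi (fun t => ind t - 2^-1)); apply: bmeasD => //; exact: bmeas_cst.
have bph1 : bmeas E ph1 by exact: bph.
have bph2 : bmeas E ph2 by exact: bph.
have bl1 : bmeas E (fun t => l * ph1 t) := bZ l ph1 bph1.
have bl : bmeas E (fun t => l * ph1 t - ph2 t).
  by apply: bmeasD => //; exact: bmeasN.
have b2 : bmeas E (fun t => (l - 1)^-1 * (l * ph1 t - ph2 t)) := bZ _ _ bl.
have -> : pi * (normalized_cdf n nu x - 2^-1) - (l * mean nu E ph1 - mean nu E ph2) / (l - 1) =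
   mean nu E (fun t => pi * (ind t - 2^-1) - (l - 1)^-1 * (l * ph1 t - ph2 t)).
  rewrite (meanB mE nuB)// (meanZ mE nuB) ?(meanB mE nuB)//; last 2 first.
  - exact: bmeas_cst.
  - by apply: bmeasD => //; exact: bmeas_cst.
  rewrite (mean_cst mE nuB) -normalized_cdf_mean (meanZ mE nuB)//.
  rewrite (meanB mE nuB)//.
  by rewrite (meanZ mE nuB)// [(l - 1)^-1 * _]mulrC.
have br : bmeas E (fun t : measurableTypeR R =>
    1000 * v * - complex.Im (z1 - (c * (t : R))%:C)^-1).
  by apply: (bZ _ (fun t => - complex.Im (z1 - (c * (t : R))%:C)^-1)); apply: bmeasN; case: bres.
apply: (@le_trans _ _ (mean nu E (fun t : measurableTypeR R =>
    1000 * v * - complex.Im (z1 - (c * (t : R))%:C)^-1))).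
  apply: (norm_mean_le mE nuB) => //; first by apply: bmeasD => //; exact: bmeasN.
  move=> t _; pose s := (x - c * (t : R)) / v.
  have dE : `|(y - x) / v| <= 3.
    by rewrite normrM normfV (gtr0_norm v0) ler_pdivrMr.
  have := kernel_bound s dE l3.
  have -> : (s + (y - x) / v) / l = (y - c * (t : R)) / (l * v).
    by rewrite /s; field; rewrite gt_eqF//= gt_eqF//; case/andP: l3 => ? _; lra.
  rewrite -/(ph1 t) -/(ph2 t) [_ / (l - 1)]mulrC.
  have -> : (if 0 <= s then pi / 2 else - (pi / 2)) = pi * (ind t - 2^-1) :> R.
    have -> : (0 <= s) = (c * (t : R) <= x).
      by rewrite /s pmulr_lge0 ?invr_gt0// subr_ge0.
    by rewrite /ind; case: ifP => _; move: (@pi R) => p; field.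
  have -> // : 1000 / (1 + s ^+ 2) = 1000 * v * - complex.Im (z1 - (c * (t : R))%:C)^-1.
  rewrite ImV normc_sqr ReD ReN ImD ImN/= oppr0 addr0 opprK -/v -/x /s.
  have s0 : v ^+ 2 + (x - c * (t : R)) ^+ 2 != 0.
    by rewrite gt_eqF// ltr_pwDl ?sqr_ge0// exprn_gt0.
  have s0' : (x - c * (t : R)) ^+ 2 + v ^+ 2 != 0 by rewrite addrC.
  by clearbody v x; field; rewrite ?s0 ?s0' gt_eqF.
rewrite (meanZ mE nuB); last by apply: bmeasN; case: bres.
have k0 : 0 < 1000 * v by lra.
rewrite (ler_pM2l k0) (meanN mE nuB); last by case: bres.
apply: le_trans (ler_norm _) _; rewrite normrN.
exact: (Im_le_normc (cmean nu E (fun t : measurableTypeR R => (z1 - (c * (t : R))%:C)^-1))).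
Qed.

End KernelCdf.

(** * The uniform estimate in terms of the scale [d] *)

Section BerryEsseen.
Variables (R : realType) (mu nu : probR R) (L B : R) (n : nat).
Hypotheses (muL : supported_on mu L) (L1 : 1 <= L).
Hypotheses (nuB : supported_on nu B) (B0 : 0 < B).
Let D : set (measurableTypeR R) := `[- L, L]%classic.
Let E : set (measurableTypeR R) := `[- B, B]%classic.
Hypotheses (Et : mean mu D (fun t => t) = 0)
  (Et2 : mean mu D (fun t => (t : R) ^+ 2) = 1).
Hypothesis nu_pow : is_free_conv_pow mu n nu.
Variable c : R.
Hypotheses (c0 : 0 < c) (cn : c ^+ 2 * n%:R = 1).
Variable d : R.
Hypotheses (d0 : 0 < d) (d_small : d <= 100^-1) (kapE : L * c = d / 2000).

Let kap_small : L * c <= 1000^-1.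
Proof. by rewrite kapE; have := d_small; lra. Qed.

(** The point [r exp (- i t)], in the lower half-plane so that its image lies in the upper one. *)
Let arc (r t : R) : R[i] := (r * cos t) +i* (- (r * sin t)).

Let normc_arc r t : 0 <= r -> normc (arc r t) = r.
Proof.
move=> r0; rewrite normcE2/= sqrrN !exprMn -mulrDr cos2Dsin2 mulr1 sqrtr_sqr.
by rewrite ger0_norm.
Qed.

Let theta (w : R[i]) := mean nu E (fun t : measurableTypeR R =>
  atan ((complex.Re (zeta mu L n c w) - c * (t : R)) / complex.Im (zeta mu L n c w))).

(** With [L c = d / 2000] the error [200 kap] becomes [d / 10], small against [1/r^2 - 1], which is
    about [2 k d], and [404 kap] is below [d]. The factor [sin t] in the second bound controls the
    ratio of two heights up to the edges. *)
Let arc_facts (r t : R) (k := (1 - r) / d) : 1 <= k <= 2 -> 0 < t < pi ->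
  [/\ `|complex.Re (zeta mu L n c (arc r t)) - cos t * (r^-1 + r)| <= d / 10,
      `|complex.Im (zeta mu L n c (arc r t)) - sin t * (r^-1 - r)| <= d / 10 * sin t,
      `|theta (arc r t) - (pi / 2 - t + r ^+ 2 * (sin t * cos t))| <= d,
      normc (cmean nu E (fun t' : measurableTypeR R =>
        (zeta mu L n c (arc r t) - (c * (t' : R))%:C)^-1)) <= 2 &
      0 < complex.Im (zeta mu L n c (arc r t))].
Proof.
move=> k12 tpi.
have rE : 1 - r = k * d by rewrite /k divfK// gt_eqF.
have /andP[k1 k2] := k12.
have /andP[r0 r1] : 0 < r < 1.
  by apply/andP; have := d_small; have := d0; nra.
have s0 : 0 < sin t by apply: sin_gt0_pi.
have w1 : normc (arc r t) <= 1 by rewrite normc_arc; lra.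
have iw : complex.Im (arc r t) < 0 by rewrite /= oppr_lt0 mulr_gt0.
have w0 : arc r t != 0 by rewrite -normc_gt0 normc_arc// ltW.
have zE := zetaE muL L1 Et Et2 c0 cn kap_small w0 w1.
have kle := kerr_le muL L1 Et2 c0 kap_small w1.
have ikle := Im_kerr_le muL L1 Et2 c0 kap_small w1.
rewrite (normc_arc t (ltW r0)) in kle.
have inv_re : complex.Re (arc r t)^-1 = cos t * r^-1.
  by rewrite ReV (normc_arc t (ltW r0))/=; field; rewrite gt_eqF.
have inv_im : complex.Im (arc r t)^-1 = sin t * r^-1.
  by rewrite ImV (normc_arc t (ltW r0))/=; field; rewrite gt_eqF.
have gam0 : 0 < (normc (arc r t) ^+ 2)^-1 - 1 - 200 * (L * c).
  rewrite (normc_arc t (ltW r0)).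
  have r2 : 0 < r ^+ 2 by rewrite exprn_gt0.
  have h : (1 + d / 5) * r ^+ 2 < 1.
    have -> : r = 1 - k * d by rewrite -rE; ring.
    have := d0; have := d_small; nra.
  have h' : 1 + d / 5 < (r ^+ 2)^-1 by rewrite -[ltRHS]div1r ltr_pdivlMr.
  have := d0; have := kapE; lra.
have pe := phase_estimate muL L1 nuB B0 Et Et2 nu_pow c0 cn kap_small w1 iw gam0.
have re := resolvent_zeta1 muL L1 nuB B0 Et Et2 nu_pow c0 cn kap_small w1 iw gam0.
have ig := Im_zeta_gt0 muL L1 Et Et2 c0 cn kap_small w1 iw gam0.
split=> //.
- rewrite zE !ReD inv_re /=.
  have -> : cos t / r + r * cos t + complex.Re (kerr mu L c (arc r t)) - cos t * (r^-1 + r) =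
    complex.Re (kerr mu L c (arc r t)) by ring.
  apply: le_trans (Re_le_normc _) _; apply: le_trans kle _.
  have -> : 200 * (L * c) * r = r * (d / 10) by rewrite kapE; field.
  by apply: ler_piMl; [have := d0; lra|exact: ltW].
- rewrite zE !ImD inv_im /=.
  have -> : sin t / r + - (r * sin t) + complex.Im (kerr mu L c (arc r t)) - sin t * (r^-1 - r) =
    complex.Im (kerr mu L c (arc r t)) by ring.
  apply: le_trans ikle _; rewrite /= normrN normrM (gtr0_norm r0) (gtr0_norm s0).
  have -> : 200 * (L * c) * (r * sin t) = r * (d / 10 * sin t) by rewrite kapE; field.
  apply: ler_piMl; last exact: ltW.
  by apply: mulr_ge0; [have := d0; lra|exact: ltW].
- move: pe; have -> : complex.Im (arc r t ^+ 2) / 2 = - (r ^+ 2 * (sin t * cos t)).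
    by rewrite expr2 ImM/=; field.
  have -> : - complex.Re (arc r t) / complex.Im (arc r t) = cos t / sin t.
    by rewrite /=; field; rewrite gt_eqF//= gt_eqF.
  rewrite (atan_cot tpi) -/(theta (arc r t)).
  set a := theta _ + - _ - _; move=> ha.
  have -> : theta (arc r t) - (pi / 2 - t + r ^+ 2 * (sin t * cos t)) = a.
    by rewrite /a; ring.
  by apply: le_trans ha _; have := d0; have := kapE; lra.
- rewrite re normcM; have /andP[_ q2] := qden_bounds muL L1 Et2 c0 kap_small w1.
  by rewrite -[leRHS]mul1r ler_pM ?normc_ge0.
Qed.

(** The kernel estimate needs real parts that differ by at most three times the height, which may be
    as small as order [d^2]. Two separate bounds [d / 10] would be too weak; the Lipschitz bound
    gives [d^2 / 10] for radii at distance [d]. *)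
Let arc_re_diff (r r' t : R) : 0 < r <= 1 -> 0 < r' <= 1 ->
  `|complex.Re (zeta mu L n c (arc r' t)) - complex.Re (zeta mu L n c (arc r t)) -
    cos t * ((r'^-1 + r') - (r^-1 + r))| <= d / 10 * `|r' - r|.
Proof.
move=> /andP[r0 r1] /andP[r0' r1'].
have zE p : 0 < p -> p <= 1 -> complex.Re (zeta mu L n c (arc p t)) =
    cos t * (p^-1 + p) + complex.Re (kerr mu L c (arc p t)).
  move=> p0 p1; have np := normc_arc t (ltW p0).
  have w0 : arc p t != 0 by rewrite -normc_gt0 np.
  have w1 : normc (arc p t) <= 1 by rewrite np.
  rewrite (zetaE muL L1 Et Et2 c0 cn kap_small w0 w1).
  set K := kerr mu L c _; rewrite 2!ReD ReV np; move: (complex.Re K) => q.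
  by rewrite /=; field; rewrite gt_eqF.
rewrite !zE//.
have -> : cos t * (r'^-1 + r') + complex.Re (kerr mu L c (arc r' t)) -
    (cos t * (r^-1 + r) + complex.Re (kerr mu L c (arc r t))) -
    cos t * (r'^-1 + r' - (r^-1 + r)) =
    complex.Re (kerr mu L c (arc r' t) - kerr mu L c (arc r t)).
  by rewrite ReD ReN; ring.
apply: le_trans (Re_le_normc _) _.
have h : normc (kerr mu L c (arc r' t) - kerr mu L c (arc r t)) <=
    200 * (L * c) * normc (arc r' t - arc r t).
  by apply: (kerr_dist muL L1 Et2 c0 kap_small); rewrite normc_arc// ltW.
apply: le_trans h _; have -> : 200 * (L * c) = d / 10 by rewrite kapE; field.
have -> // : normc (arc r' t - arc r t) = `|r' - r|.
rewrite normcE2 ReD ReN ImD ImN /=.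
have -> : (r' * cos t - r * cos t) ^+ 2 + (- (r' * sin t) - - (r * sin t)) ^+ 2 =
  (r' - r) ^+ 2 * (cos t ^+ 2 + sin t ^+ 2) by ring.
by rewrite cos2Dsin2 mulr1 sqrtr_sqr.
Qed.

Let F x := normalized_cdf n nu x.

(* lra and nra slow down with the size of the context, which is large here:
   drop the local hypotheses that were not moved to the goal. *)
Ltac clear_local := clear - R mu nu L B n muL L1 nuB B0 D E Et Et2 nu_pow c c0 cn
  d d0 d_small kapE kap_small arc normc_arc theta arc_facts arc_re_diff F.
Ltac lra_goal := clear_local; lra.
Ltac nra_goal := clear_local; nra.

Let cdf_on_arc (t : R) : 0 < t < pi -> d <= sin t ->
  exists2 x, `|x - 2 * cos t| <= d &
    `|F x - semicircle_cdf (2 * cos t)| <= 2200 * d.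
Proof.
move=> tpi dst; have := d_small; have := d0 => dp ds.
have sp : 0 < sin t by lra.
have s1 : sin t <= 1 by exact: sin_le1.
(* The radii [1 - d] and [1 - 2 d] give heights near [2 d sin t] and [4 d sin t], hence a ratio [l]
   near 2. *)
have [r1 r1E] : {r | r = 1 - d} by exists (1 - d).
have [r2 r2E] : {r | r = 1 - 2 * d} by exists (1 - 2 * d).
have r10 : 0 < r1 by lra.
have r20 : 0 < r2 by lra.
have k1 : (1 - r1) / d = 1 by rewrite r1E; field; rewrite gt_eqF.
have k2 : (1 - r2) / d = 2 by rewrite r2E; field; rewrite gt_eqF.
have [x1E v1E th1 g1 v1p] := @arc_facts r1 t (ltac:(rewrite k1; apply/andP; lra)) tpi.
have [x2E v2E th2 _ v2p] := @arc_facts r2 t (ltac:(rewrite k2; apply/andP; lra)) tpi.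
set z1 := zeta mu L n c (arc r1 t) in x1E v1E th1 g1 v1p.
set z2 := zeta mu L n c (arc r2 t) in x2E v2E th2 v2p.
have r1i : r1^-1 - 1 - d = d ^+ 2 / r1.
  have -> : d = 1 - r1 by rewrite r1E; ring.
  by field; rewrite gt_eqF.
have r2i : r2^-1 - 1 - 2 * d = 4 * d ^+ 2 / r2.
  have -> : d = (1 - r2) / 2 by rewrite r2E; field.
  by field; rewrite gt_eqF.
have q1 : 0 <= d ^+ 2 / r1 <= 102 / 100 * d ^+ 2.
  apply/andP; split; first by rewrite divr_ge0 ?sqr_ge0 ?(ltW r10).
  by rewrite ler_pdivrMr// r1E; have := sqr_ge0 d; move: dp ds; nra_goal.
have q2 : 0 <= 4 * d ^+ 2 / r2 <= 41 / 10 * d ^+ 2.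
  apply/andP; split; first by rewrite divr_ge0 ?(ltW r20)// mulr_ge0 ?sqr_ge0.
  by rewrite ler_pdivrMr// r2E; have := sqr_ge0 d; move: dp ds; nra_goal.
have dd : 0 <= d ^+ 2 <= d / 100 by rewrite sqr_ge0 expr2; move: dp ds; nra_goal.
move: q1 q2 dd => /andP[q11 q12] /andP[q21 q22] /andP[dd0 dd1].
have h1 : 2 * d <= r1^-1 - r1 <= 203 / 100 * d.
  by apply/andP; move: r1E r1i q11 q12 dd0 dd1 dp; lra_goal.
have h2 : 4 * d <= r2^-1 - r2 <= 41 / 10 * d.
  by apply/andP; move: r2E r2i q21 q22 dd0 dd1 dp; lra_goal.
move: h1 h2 => /andP[h11 h12] /andP[h21 h22].
move: v1E v2E; rewrite !ler_norml => /andP[v11 v12] /andP[v21 v22].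
set v1 := complex.Im z1 in v11 v12 v1p *; set v2 := complex.Im z2 in v21 v22 v2p *.
have sm a b : a <= b -> sin t * a <= sin t * b by move=> ab; rewrite ler_pM2l.
have := sm _ _ h11; have := sm _ _ h12; have := sm _ _ h21; have := sm _ _ h22.
set p1 := sin t * (r1^-1 - r1) in v11 v12 *; set p2 := sin t * (r2^-1 - r2) in v21 v22 *.
set u := sin t * d; move=> m22 m21 m12 m11.
have u0 : 0 < u by rewrite mulr_gt0.
have ds_u : d / 10 * sin t = u / 10 by rewrite /u; ring.
have b1 : 19 / 10 * u <= v1 <= 215 / 100 * u.
  have e1 : sin t * (2 * d) = 2 * u by rewrite /u; ring.
  have e2 : sin t * (203 / 100 * d) = 203 / 100 * u by rewrite /u; ring.
  by apply/andP; move: m11 m12 v11 v12 u0; rewrite e1 e2 ds_u; lra_goal.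
have b2 : 39 / 10 * u <= v2 <= 42 / 10 * u.
  have e1 : sin t * (4 * d) = 4 * u by rewrite /u; ring.
  have e2 : sin t * (41 / 10 * d) = 41 / 10 * u by rewrite /u; ring.
  by apply/andP; move: m21 m22 v21 v22 u0; rewrite e1 e2 ds_u; lra_goal.
move: b1 b2 => /andP[b11 b12] /andP[b21 b22].
have [l lE] : {l | l = v2 / v1} by exists (v2 / v1).
have lv : v2 = l * v1 by clearbody v1 v2; rewrite lE divfK ?gt_eqF.
have l3 : 3 / 2 <= l <= 3.
  clearbody v1 v2 u; rewrite lE ler_pdivlMr// ler_pdivrMr//; apply/andP.
  by move: b11 b12 b21 b22 u0; lra_goal.
have c1 : `|cos t| <= 1 by rewrite ler_norml cos_geN1 cos_le1.
(* [1/r + r] is stationary at 1, so it varies only by [O(d^2)] between the two radii. *)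
have g12 : `|(r2^-1 + r2) - (r1^-1 + r1)| <= 41 / 10 * d ^+ 2.
  by rewrite ler_norml; apply/andP; move: r1E r2E r1i r2i q11 q12 q21 q22; lra_goal.
have xx : `|complex.Re z2 - complex.Re z1| <= 3 * v1.
  have := @arc_re_diff r1 r2 t; rewrite -/z1 -/z2 r10 r20 => h.
  have {h} := h (ltac:(move: r1E dp; lra_goal)) (ltac:(move: r2E dp; lra_goal)).
  have -> : `|r2 - r1| = d.
    by rewrite r1E r2E -normrN ger0_norm; [ring|move: dp; lra_goal].
  have e : d / 10 * d = d ^+ 2 / 10 by ring.
  rewrite e; set y := complex.Re z2 - _; set q := _ * (_ - (r1^-1 + r1)) => h.
  have hq : `|q| <= 1 * (41 / 10 * d ^+ 2) by rewrite normrM ler_pM.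
  have -> : y = (y - q) + q by ring.
  apply: le_trans (ler_normD _ _) _.
  (* The restriction [d <= sin t] turns the error [d^2] into a multiple of the height. *)
  have du : d ^+ 2 <= u by rewrite expr2 ler_pM2r.
  by move: h hq du b11 u0; lra_goal.
have ker := @cdf_kernel R nu B nuB n c c0 cn z1 z2 l v1p lv l3 xx.
move: ker th1 th2; rewrite -/(theta (arc r1 t)) -/(theta (arc r2 t)).
move: (theta (arc r1 t)) (theta (arc r2 t)) => T1 T2 ker th1 th2.
exists (complex.Re z1).
  have -> : complex.Re z1 - 2 * cos t = (complex.Re z1 - cos t * (r1^-1 + r1)) +
      cos t * (d ^+ 2 / r1).
    by rewrite -r1i r1E; ring.
  apply: le_trans (ler_normD _ _) _.
  have : `|cos t * (d ^+ 2 / r1)| <= 1 * (102 / 100 * d ^+ 2).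
    by rewrite normrM ler_pM// ger0_norm.
  by move: x1E dd1 dp; lra_goal.
have tI : 0 <= t <= pi by case/andP: tpi => t0 tp; rewrite !ltW.
rewrite (semicircle_cdf_cos tI).
set S := sin t * cos t in th1 th2 *.
have S1 : `|S| <= 1.
  by rewrite normrM -[leRHS]mul1r ler_pM// ler_norml sin_geN1 sin_le1.
(* The common approximate value of both phases, obtained at [r = 1]; it equals [pi] times the
   semicircle distribution function at [2 cos t] minus one half. *)
have [T TE] : {T | T = pi / 2 - t + S} by exists (pi / 2 - t + S).
have e1 : `|T1 - T| <= 3 * d.
  have -> : T1 - T =
    (T1 - (pi / 2 - t + r1 ^+ 2 * S)) + (r1 ^+ 2 - 1) * S by rewrite TE; ring.
  apply: le_trans (ler_normD _ _) _.
  have : `|(r1 ^+ 2 - 1) * S| <= 2 * d * 1.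
    rewrite normrM ler_pM// r1E ler_norml; apply/andP.
    have -> : (1 - d) ^+ 2 - 1 = - 2 * d + d ^+ 2 by ring.
    by move: dp dd0 dd1; lra_goal.
  by move: th1; move: dp; lra_goal.
have e2 : `|T2 - T| <= 5 * d.
  have -> : T2 - T =
    (T2 - (pi / 2 - t + r2 ^+ 2 * S)) + (r2 ^+ 2 - 1) * S by rewrite TE; ring.
  apply: le_trans (ler_normD _ _) _.
  have : `|(r2 ^+ 2 - 1) * S| <= 4 * d * 1.
    rewrite normrM ler_pM// r2E ler_norml; apply/andP.
    have -> : (1 - 2 * d) ^+ 2 - 1 = - 4 * d + 4 * d ^+ 2 by ring.
    by move: dp dd0 dd1; lra_goal.
  by move: th2; move: dp; lra_goal.
have p0 := pi_gt0 R; have pi2 := pi_ge2 R.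
have l10 : 0 < l - 1 by case/andP: l3; lra_goal.
pose Q := (l * T1 - T2) / (l - 1).
(* The coefficients [l / (l - 1)] and [- 1 / (l - 1)] add up to 1, so only the errors remain:
   [3 * 3 d + 5 d], divided by [l - 1 >= 1/2]. *)
have QT : `|Q - T| <= 28 * d.
  have -> : Q - T = (l * (T1 - T) - (T2 - T)) / (l - 1).
    by rewrite /Q; field; rewrite gt_eqF.
  rewrite normrM normfV (gtr0_norm l10) ler_pdivrMr//.
  apply: le_trans (ler_normB _ _) _; rewrite normrM.
  move: l3 => /andP[l31 l32].
  have l0 : 0 < l by move: l31; lra_goal.
  have : `|l| * `|T1 - T| <= 3 * (3 * d) by rewrite ler_pM// gtr0_norm.
  have : 2^-1 * (28 * d) <= (l - 1) * (28 * d).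
    by rewrite ler_pM2r; [move: l31; lra_goal|move: dp; lra_goal].
  by move: e2; lra_goal.
have ker' : `|pi * (F (complex.Re z1) - 2^-1) - Q| <= 4300 * d.
  apply: le_trans ker _.
  have k0 : 0 <= 1000 * v1 by clearbody v1; move: v1p; lra_goal.
  have h2 := ler_wpM2l k0 g1.
  have : u <= 1 * d by rewrite ler_pM2r.
  move=> h1; apply: le_trans h2 _; move: h1 b12.
  by clearbody u v1; lra_goal.
have piE : pi * (F (complex.Re z1) - (1 - (t - S) / pi)) =
    (pi * (F (complex.Re z1) - 2^-1) - Q) + (Q - T).
  rewrite TE; move: p0; move: (@pi R) (F _) (Q) => p f q p0.
  by field; rewrite gt_eqF.
have : pi * `|F (complex.Re z1) - (1 - (t - S) / pi)| <= 4328 * d.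
  rewrite -[X in X * `|_|](gtr0_norm p0) -normrM piE.
  by apply: le_trans (ler_normD _ _) _; move: ker' QT; lra_goal.
have : 2 * `|F (complex.Re z1) - (1 - (t - S) / pi)| <=
   pi * `|F (complex.Re z1) - (1 - (t - S) / pi)| by apply: ler_wpM2r.
by move: dp; lra_goal.
Qed.

Ltac clear_local ::= clear - R mu nu L B n muL L1 nuB B0 D E Et Et2 nu_pow c c0 cn
  d d0 d_small kapE kap_small arc normc_arc theta arc_facts arc_re_diff F cdf_on_arc.

(** The values on the arc are known at some point within [d] of [2 cos t]. Taking [2 cos t = x + d]
    or [x - d] puts that point on the side of [x] where monotonicity helps, and the 1-Lipschitz
    semicircle function loses only [d]. *)
Lemma normalized_cdf_dist x : `|F x - semicircle_cdf x| <= 2300 * d.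
Proof.
have ds := d_small; have dp := d0.
have dd0 : 0 <= d ^+ 2 := sqr_ge0 d.
have dd1 : d ^+ 2 <= d / 100 by rewrite expr2; move: ds dp; nra_goal.
(* For [|y| <= a] the angle satisfies [sin t >= d]; beyond [a] the semicircle law has mass at most
   [2 d^2] on each side. *)
pose a := 2 * (1 - d ^+ 2).
have near y : - a <= y <= a -> exists2 x', `|x' - y| <= d &
    `|F x' - semicircle_cdf y| <= 2200 * d.
  move=> /andP[ya1 ya2]; pose t := acos (y / 2).
  have y1 : -1 < y / 2 < 1.
    have d2 : 0 < d ^+ 2 by rewrite exprn_gt0.
    by apply/andP; rewrite /a in ya1 ya2; move: ya1 ya2 d2; lra_goal.
  have y1' : -1 <= y / 2 <= 1 by case/andP: y1 => ? ?; rewrite !ltW.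
  have yE : y = 2 * cos t by rewrite /t acosK ?in_itv//=; field.
  have t0 : 0 < t by apply: acos_gt0; case/andP: y1 => ? ->; rewrite ltW.
  have tp : t < pi by apply: acos_ltpi; case/andP: y1 => -> ?; rewrite ltW.
  have tpi : 0 < t < pi by rewrite t0.
  have st : d <= sin t.
    rewrite /t sin_acos// -[d in leLHS]ger0_norm ?(ltW dp)// -sqrtr_sqr ler_wsqrtr//.
    have : (y / 2) ^+ 2 <= (1 - d ^+ 2) ^+ 2.
      rewrite -ler_sqrt ?sqr_ge0// !sqrtr_sqr.
      have h1 : 0 <= 1 - d ^+ 2 by move: dd1 ds; lra_goal.
      rewrite [leRHS]ger0_norm// ler_norml; apply/andP; rewrite /a in ya1 ya2.
      by move: ya1 ya2; lra_goal.
    move=> h; have -> : d ^+ 2 = 1 - (1 - d ^+ 2) by ring.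
    rewrite lerD2l lerN2; apply: le_trans h _.
    rewrite expr2 ler_piMr//; move: dd0 dd1 ds; lra_goal.
  by have [x' h1 h2] := cdf_on_arc tpi st; exists x'; rewrite yE.
have a0 : 0 <= a by rewrite /a; move: dd1 ds; lra_goal.
have aI : - a <= a <= a by apply/andP; split => //; move: a0; lra_goal.
have aI' : - a <= - a <= a by apply/andP; split => //; move: a0; lra_goal.
have sa : 1 - 2 * d ^+ 2 <= semicircle_cdf a.
  have a2 : a <= 2 by rewrite /a; move: dd0; lra_goal.
  have /andP[_] := semicircle_cdf_lip a2; rewrite semicircle_cdf2 /a.
  by lra_goal.
have sNa : semicircle_cdf (- a) <= 2 * d ^+ 2.
  have a2 : - 2 <= - a by rewrite /a; move: dd0; lra_goal.
  have /andP[_] := semicircle_cdf_lip a2; rewrite semicircle_cdfN2 /a.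
  by lra_goal.
have F0 y : 0 <= F y by exact: normalized_cdf_ge0.
have F1 y : F y <= 1 by exact: (normalized_cdf_le1 nu c0 cn y).
have Fle y z : y <= z -> F y <= F z.
  exact: (normalized_cdf_le nu c0 cn).
have Sle y z : y <= z -> _ := @semicircle_cdf_lip R y z.
have upper : F x - semicircle_cdf x <= 2300 * d.
  have xd : x <= x + d by rewrite lerDl ltW.
  have [ya|ya] := leP (x + d) a; last first.
    have ad : a - d <= x by move: ya; lra_goal.
    have ad' : a - d <= a by move: dp; lra_goal.
    have /andP[h1 _] := Sle _ _ ad; have /andP[_ h2] := Sle _ _ ad'.
    by move: h1 h2 (F1 x) sa; move: dd1 dp; lra_goal.
  have [yNa|yNa] := leP (- a) (x + d).
    have [x' h1 h2] := near (x + d) (ltac:(by apply/andP)).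
    have xx' : x <= x' by move: h1; rewrite ler_norml => /andP[h1 _]; move: h1; lra_goal.
    have := Fle _ _ xx'; move: h2; rewrite ler_norml => /andP[_ h2].
    have /andP[_ h3] := Sle _ _ xd.
    by move: h2 h3; move: dp; lra_goal.
  have [x' h1 h2] := near _ aI'.
  have xx' : x <= x' by move: h1; rewrite ler_norml => /andP[h1 _]; move: h1 yNa; lra_goal.
  have := Fle _ _ xx'; move: h2; rewrite ler_norml => /andP[_ h2].
  by have := semicircle_cdf_ge0 x; move: h2 sNa; move: dp dd1; lra_goal.
have lower : semicircle_cdf x - F x <= 2300 * d.
  have xd : x - d <= x by rewrite gerBl ltW.
  have [ya|ya] := leP (- a) (x - d); last first.
    have ad : x <= - a + d by move: ya; lra_goal.
    have ad' : - a <= - a + d by move: dp; lra_goal.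
    have /andP[h1 _] := Sle _ _ ad; have /andP[_ h2] := Sle _ _ ad'.
    by move: h1 h2 (F0 x) sNa; move: dd1 dp; lra_goal.
  have [yNa|yNa] := leP (x - d) a.
    have [x' h1 h2] := near (x - d) (ltac:(by apply/andP)).
    have xx' : x' <= x by move: h1; rewrite ler_norml => /andP[_ h1]; move: h1; lra_goal.
    have := Fle _ _ xx'; move: h2; rewrite ler_norml => /andP[h2 _].
    have /andP[_ h3] := Sle _ _ xd.
    by move: h2 h3; move: dp; lra_goal.
  have [x' h1 h2] := near _ aI.
  have xx' : x' <= x by move: h1; rewrite ler_norml => /andP[_ h1]; move: h1 yNa; lra_goal.
  have := Fle _ _ xx'; move: h2; rewrite ler_norml => /andP[h2 _].
  by have := semicircle_cdf_le1 x; move: h2 sa; move: dp dd1; lra_goal.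
by rewrite ler_norml; apply/andP; move: upper lower; lra_goal.
Qed.

End BerryEsseen.

(** * From the scale [d] to the bound in [L] and [n] *)

Lemma support_radius_ge1 (R : realType) (mu : probR R) (L : R)
    (D : set (measurableTypeR R) := `[- L, L]%classic) :
  0 < L -> supported_on mu L -> mean mu D (fun t => (t : R) ^+ 2) = 1 -> 1 <= L.
Proof.
move=> L0 muL Et2; have mD : measurable D := measurable_segment L.
have bt2 : bmeas D (fun t => (t : R) ^+ 2) by apply: bmeasM => //; exact: bmeas_id.
have h : mean mu D (fun t => (t : R) ^+ 2) <= L ^+ 2.
  rewrite -[leRHS](mean_cst mD muL); apply: (le_mean mD muL) => //.
    exact: bmeas_cst.
  move=> t /segment_norm tL; rewrite -real_normK ?num_real// lerXn2r// nnegrE//.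
  exact: ltW.
by move: h; rewrite Et2 -[leLHS](expr1n _ 2) ler_sqr// nnegrE ltW.
Qed.

Theorem theorem1 (R : realType) :
  exists C : R, 0 < C /\
    forall (L : R) (mu : probR R),
      0 < L ->
      supported_on mu L ->
      ('E_mu[(fun u : measurableTypeR R => (u : R))] = 0)%E ->
      (variance mu (fun u : measurableTypeR R => (u : R)) = 1)%E ->
      exists n0 : nat, forall n : nat, (1 <= n)%N -> (n0 <= n)%N ->
        forall nu : probR R, is_free_conv_pow mu n nu ->
          (ereal_sup [set `|normalized_cdf n nu x - semicircle_cdf x|%:E
                     | x in [set: R]]
           <= (C * L ^+ 3 / Num.sqrt n%:R)%:E)%E.
Proof.
exists (2300 * 2000); split=> [|L mu L0 muL mu0 mu1]; first by lra.
have Et := mean_id muL mu0; have Et2 := mean_sqr muL mu0 mu1.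
have L1 := support_radius_ge1 L0 muL Et2.
(* The threshold [M^2] for [n] is what makes [d = 2000 L / sqrt n] at most 1/100. *)
pose M := 100 * (2000 * L).
exists (Num.bound (M ^+ 2)) => n n1 nM nu nu_pow.
have nR : 0 < n%:R :> R by rewrite ltr0n.
have s0 : 0 < Num.sqrt n%:R :> R by rewrite sqrtr_gt0.
have [c cE] : {c : R | c = (Num.sqrt n%:R)^-1} by exists (Num.sqrt n%:R)^-1.
have c0 : 0 < c by rewrite cE invr_gt0.
have cn : c ^+ 2 * n%:R = 1.
  by rewrite cE exprVn sqr_sqrtr ?ler0n// mulVf// gt_eqF.
have Ms : M <= Num.sqrt n%:R.
  have M0 : 0 <= M by rewrite /M; lra.
  rewrite -[M]ger0_norm// -sqrtr_sqr ler_wsqrtr//.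
  have := archi_boundP (sqr_ge0 M) => h; apply: le_trans (ltW h) _.
  by rewrite ler_nat.
have Lc0 : 0 < L * c by rewrite mulr_gt0.
have [d dE] : {d : R | d = 2000 * (L * c)} by exists (2000 * (L * c)).
have d0 : 0 < d by rewrite dE; lra.
have d_small : d <= 100^-1.
  rewrite dE cE mulrA ler_pdivrMr//.
  by move: Ms; rewrite /M; move: (2000 * L) (Num.sqrt _) => u v; lra.
have kapE : L * c = d / 2000 by rewrite dE; field.
have [_ /supported_on_pos[B nuB B0] _] := free_conv_pow_germ muL L0 nu_pow.
apply: ge_ereal_sup => _ [x _ <-]; rewrite lee_fin.
have h := normalized_cdf_dist muL L1 nuB B0 Et Et2 nu_pow c0 cn d0 d_small kapE x.
apply: le_trans h _; rewrite -cE.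
(* The estimate obtained is linear in [L]; [L >= 1] weakens it to the cubic form. *)
have L3 : L * c <= L ^+ 3 * c.
  rewrite ler_pM2r// exprS ler_peMr ?(ltW L0)//.
  by rewrite expr2 -[leLHS]mulr1 ler_pM.
have -> : 2300 * 2000 * L ^+ 3 * c = 2300 * 2000 * (L ^+ 3 * c) by ring.
by rewrite dE; lra.
Qed.
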